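(* Let $W$ be a $3$-dimensional faithful complex representation of $PSL(2,7)$. Then the quotient variety $\mathbb{P}(W)/PSL(2,7)$ has only abelian singularities, i.e. every singular point of it is an abelian singularity.
   Context: $PSL(2,7)$ is the projective special linear group of $2\times2$ matrices over $\mathbb{F}_7$. $\mathbb{P}(W)$ is the complex projective space of one-dimensional subspaces of $W$, with the induced action. For an algebraic variety $X$ over $\mathbb{C}$, a point $v\in X$ is an abelian (quotient) singularity if the completion $\widehat{\mathcal{O}_{X,v}}$ of the local ring at $v$ is isomorphic to the completion $\widehat{\mathcal{O}_{Y,0}}$, where $Y=\mathbb{C}^n/A$ is the quotient of some $\mathbb{C}^n$ by a finite abelian group $A$ acting linearly, and $0$ denotes the image of the origin. *)

(* Defs.v *)
From HB Require Import structures.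
From mathcomp Require Import all_boot all_order all_algebra all_fingroup.
From mathcomp Require Import all_solvable mxrepresentation.
From mathcomp Require Import boolp classical_sets functions reals complex mpoly.

Set Implicit Arguments.
Unset Strict Implicit.
Unset Printing Implicit Defensive.

Import GRing.Theory.
Local Open Scope ring_scope.
Local Open Scope classical_set_scope.

Section SpecialLinear.
Variables (n : nat) (F : finFieldType).

Definition SLset : {set {'GL_n[F]}} :=
  finset (fun u : {'GL_n[F]} => \det (GLval u) == 1).

Lemma SLset_group_set : group_set SLset.
Proof.
apply/group_setP; split=> [|u v]; first by rewrite inE GL_1E det1.
by rewrite !inE GL_MxE det_mulmx => /eqP-> /eqP->; rewrite mulr1.
Qed.
Canonical SL := Group SLset_group_set.

Definition PSL : {group coset_of 'Z(SL)} := (SL / 'Z(SL))%G.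
End SpecialLinear.
Arguments SL n%_N F%_type.
Arguments PSL n%_N F%_type.

(* The K-algebra S/(S \cap I), for S a subalgebra and I an ideal of the
   K-algebra of all functions T -> A.                                         *)
Record subquot_data (K : comNzRingType) (T : Type) (A : comAlgType K) := {
  sq_sub : set (T -> A);
  sq_ideal : set (T -> A);
  sq_sub1 : sq_sub 1;
  sq_subB : forall f g, sq_sub f -> sq_sub g -> sq_sub (f - g);
  sq_subM : forall f g, sq_sub f -> sq_sub g -> sq_sub (f * g);
  sq_subZ : forall k f, sq_sub f -> sq_sub (k *: f);
  sq_ideal0 : sq_ideal 0;
  sq_idealB : forall f g, sq_ideal f -> sq_ideal g -> sq_ideal (f - g);
  sq_idealM : forall f g, sq_ideal g -> sq_ideal (f * g) }.

Section Subquotient.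
Variables (K : comNzRingType) (T : Type) (A : comAlgType K).
Variable D : subquot_data T A.
Implicit Types f g h : T -> A.
Local Notation S := (sq_sub D).
Local Notation I := (sq_ideal D).

Definition sq_coset f : set (T -> A) := [set g | I (g - f)].

Record subquot := Subquot {
  sq_carrier : set (T -> A);
  sq_carrierP : exists2 f, S f & sq_carrier = sq_coset f }.

Definition sq_class f (Sf : S f) : subquot :=
  Subquot (ex_intro2 _ _ f Sf erefl).

Lemma sq_idealN f : I f -> I (- f).
Proof. by move=> If; rewrite -sub0r; apply: sq_idealB => //; apply: sq_ideal0. Qed.
Lemma sq_idealD f g : I f -> I g -> I (f + g).
Proof. by move=> If Ig; rewrite -[g]opprK; apply/sq_idealB/sq_idealN. Qed.
Lemma sq_sub0 : S 0.
Proof. rewrite -(subrr 1); apply: sq_subB; apply: sq_sub1. Qed.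
Lemma sq_subN f : S f -> S (- f).
Proof. by move=> Sf; rewrite -sub0r; apply: sq_subB => //; apply: sq_sub0. Qed.
Lemma sq_subD f g : S f -> S g -> S (f + g).
Proof. by move=> Sf Sg; rewrite -[g]opprK; apply/sq_subB/sq_subN. Qed.

Lemma subquot_eq (c d : subquot) : sq_carrier c = sq_carrier d -> c = d.
Proof.
case: c d => [c cP] [d dP] /= e; rewrite -{}e in dP *.
by congr Subquot; apply: Prop_irrelevance.
Qed.

Lemma sq_classP f g (Sf : S f) (Sg : S g) :
  sq_class Sf = sq_class Sg <-> I (f - g).
Proof.
split=> [[e]|Ifg].
  have: sq_coset f f by rewrite /sq_coset /= subrr; apply: sq_ideal0.
  by rewrite e.
apply: subquot_eq; apply/seteqP; split=> h /= Ih.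
  by have := sq_idealD Ih Ifg; rewrite addrA subrK.
by have := sq_idealB Ih Ifg; rewrite opprB addrA subrK.
Qed.

Lemma sq_repr_subproof (c : subquot) : exists f, exists Sf : S f, c = sq_class Sf.
Proof.
by case: (c) => s [f Sf e]; exists f, Sf; apply: subquot_eq.
Qed.

Definition sq_repr c : T -> A := projT1 (cid (sq_repr_subproof c)).

Lemma sq_repr_sub c : S (sq_repr c).
Proof. by rewrite /sq_repr; case: cid => f []. Qed.

Lemma sq_reprK c : sq_class (sq_repr_sub c) = c.
Proof.
have [Sf e] := projT2 (cid (sq_repr_subproof c)); rewrite [RHS]e.
by apply/sq_classP; rewrite subrr; apply: sq_ideal0.
Qed.

Lemma sq_class_repr f (Sf : S f) : I (sq_repr (sq_class Sf) - f).
Proof. by apply/(sq_classP (sq_repr_sub _) Sf); rewrite sq_reprK. Qed.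

Lemma sq_ind (P : subquot -> Prop) :
  (forall f (Sf : S f), P (sq_class Sf)) -> forall c, P c.
Proof. by move=> H c; rewrite -(sq_reprK c). Qed.

HB.instance Definition _ := gen_eqMixin subquot.
HB.instance Definition _ := gen_choiceMixin subquot.

Definition sq_zero := sq_class sq_sub0.
Definition sq_one := sq_class (sq_sub1 D).
Definition sq_opp c := sq_class (sq_subN (sq_repr_sub c)).
Definition sq_add c d := sq_class (sq_subD (sq_repr_sub c) (sq_repr_sub d)).
Definition sq_mul c d := sq_class (sq_subM (sq_repr_sub c) (sq_repr_sub d)).
Definition sq_scale k c := sq_class (sq_subZ k (sq_repr_sub c)).

Lemma sq_oppE f (Sf : S f) : sq_opp (sq_class Sf) = sq_class (sq_subN Sf).
Proof.
by apply/sq_classP; rewrite -opprD; apply/sq_idealN/sq_class_repr.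
Qed.
Lemma sq_addE f g (Sf : S f) (Sg : S g) :
  sq_add (sq_class Sf) (sq_class Sg) = sq_class (sq_subD Sf Sg).
Proof.
by apply/sq_classP; rewrite opprD addrACA; apply: sq_idealD; apply: sq_class_repr.
Qed.
Lemma sq_mulE f g (Sf : S f) (Sg : S g) :
  sq_mul (sq_class Sf) (sq_class Sg) = sq_class (sq_subM Sf Sg).
Proof.
apply/sq_classP; set f' := sq_repr _; set g' := sq_repr _.
have -> : f' * g' - f * g = g' * (f' - f) + f * (g' - g).
  by rewrite !mulrBr addrA [g' * f']mulrC [g' * f]mulrC subrK.
by apply: sq_idealD; apply: sq_idealM; apply: sq_class_repr.
Qed.
Lemma fct_scaleE (k : K) f : k *: f = (fun=> k%:A) * f.
Proof. by apply/funext => t; rewrite /GRing.mul /= mulr_algl. Qed.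
Lemma sq_scaleE k f (Sf : S f) : sq_scale k (sq_class Sf) = sq_class (sq_subZ k Sf).
Proof.
apply/sq_classP; rewrite -scalerBr fct_scaleE.
by apply/sq_idealM/sq_class_repr.
Qed.

Lemma sq_class_eq f g (Sf : S f) (Sg : S g) : f = g -> sq_class Sf = sq_class Sg.
Proof. by move=> e; apply/sq_classP; rewrite e subrr; apply: sq_ideal0. Qed.

Let sqE := (sq_addE, sq_mulE, sq_oppE, sq_scaleE).
Ltac sq := repeat (elim/sq_ind => ? ?); rewrite ?sqE; apply: sq_class_eq.

Lemma sq_addA : associative sq_add. Proof. by sq; rewrite addrA. Qed.
Lemma sq_addC : commutative sq_add. Proof. by sq; rewrite addrC. Qed.
Lemma sq_add0 : left_id sq_zero sq_add. Proof. by sq; rewrite add0r. Qed.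
Lemma sq_addN : left_inverse sq_zero sq_opp sq_add.
Proof. by sq; rewrite addNr. Qed.
HB.instance Definition _ :=
  GRing.isZmodule.Build subquot sq_addA sq_addC sq_add0 sq_addN.

Lemma sq_mulA : associative sq_mul. Proof. by sq; rewrite mulrA. Qed.
Lemma sq_mulC : commutative sq_mul. Proof. by sq; rewrite mulrC. Qed.
Lemma sq_mul1 : left_id sq_one sq_mul. Proof. by sq; rewrite mul1r. Qed.
Lemma sq_mulr1 : right_id sq_one sq_mul. Proof. by sq; rewrite mulr1. Qed.
Lemma sq_mulDl : left_distributive sq_mul +%R.
Proof. by rewrite /GRing.add /=; sq; rewrite mulrDl. Qed.
Lemma sq_mulDr : right_distributive sq_mul +%R.
Proof. by rewrite /GRing.add /=; sq; rewrite mulrDr. Qed.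
HB.instance Definition _ := GRing.Zmodule_isPzRing.Build subquot
  sq_mulA sq_mul1 sq_mulr1 sq_mulDl sq_mulDr.
HB.instance Definition _ := GRing.PzRing_hasCommutativeMul.Build subquot sq_mulC.

Lemma sq_scaleA a b c : sq_scale a (sq_scale b c) = sq_scale (a * b) c.
Proof. by elim/sq_ind: c => f Sf; sq; rewrite scalerA. Qed.
Lemma sq_scale1 : left_id 1 sq_scale. Proof. by sq; rewrite scale1r. Qed.
Lemma sq_scaleDr : right_distributive sq_scale +%R.
Proof. by move=> k; rewrite /GRing.add /=; sq; rewrite scalerDr. Qed.
Lemma sq_scaleDl c : {morph sq_scale^~ c : a b / a + b}.
Proof.
by move=> a b; rewrite [RHS]/GRing.add /=; elim/sq_ind: c => f Sf; sq;
   rewrite scalerDl.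
Qed.
HB.instance Definition _ := GRing.Zmodule_isLmodule.Build K subquot
  sq_scaleA sq_scale1 sq_scaleDr sq_scaleDl.

Lemma sq_scaleAl (k : K) (c d : subquot) : k *: (c * d) = (k *: c) * d.
Proof.
rewrite /GRing.mul /GRing.scale /=.
by elim/sq_ind: c => f Sf; elim/sq_ind: d => g Sg; sq; rewrite !fct_scaleE mulrA.
Qed.

End Subquotient.

Section CommutativeAlgebra.
Variable A : comNzRingType.

Definition is_ideal (J : set A) :=
  [/\ J 0, forall a b, J a -> J b -> J (a + b) & forall a b, J b -> J (a * b)].

Definition is_prime_ideal (P : set A) :=
  [/\ is_ideal P, ~ P 1 & forall a b, P (a * b) -> P a \/ P b].

Definition gen_ideal d (x : 'I_d -> A) : set A :=
  [set a | exists c : 'I_d -> A, a = \sum_i c i * x i].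

Definition noetherian :=
  forall J : set A, is_ideal J -> exists d (x : 'I_d -> A), J = gen_ideal x.

Definition has_prime_chain (d : nat) := exists P : nat -> set A,
  (forall i, (i <= d)%N -> is_prime_ideal (P i)) /\
  (forall i, (i < d)%N -> P i `<` P i.+1).

Definition krull_dim (d : nat) :=
  has_prime_chain d /\ forall e, has_prime_chain e -> (e <= d)%N.

(* To be used with m the maximal ideal of a local ring A. *)
Definition regular_local_ring (m : set A) :=
  noetherian /\
  exists2 d, krull_dim d & exists x : 'I_d -> A, m = gen_ideal x.

Definition ideal_pow (m : set A) (k : nat) : set A :=
  [set a | exists N (c : 'I_N -> A) (x : 'I_N -> 'I_k -> A),
     (forall i j, m (x i j)) /\ a = \sum_i c i * \prod_j x i j].

Lemma ideal_pow0 m k : ideal_pow m k 0.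
Proof. by exists 0%N, (fun=> 0), (fun _ _ => 0); split=> [[]|]; rewrite ?big_ord0. Qed.

Lemma ideal_powD m k a b :
  ideal_pow m k a -> ideal_pow m k b -> ideal_pow m k (a + b).
Proof.
move=> [N [c [x [mx ->]]]] [M [d [y [my ->]]]].
exists (N + M)%N, (fun i : 'I_(N + M) => match fintype.split i with inl j => c j | inr j => d j end),
  (fun i : 'I_(N + M) => match fintype.split i with inl j => x j | inr j => y j end); split.
  by move=> i j; case: fintype.split.
rewrite big_split_ord /=; congr (_ + _); apply: eq_bigr => i _.
  by rewrite (unsplitK (inl i)).
by rewrite (unsplitK (inr i)).
Qed.

Lemma ideal_powM m k a b : ideal_pow m k b -> ideal_pow m k (a * b).
Proof.
move=> [N [c [x [mx ->]]]]; exists N, (fun i => a * c i), x; split=> //.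
by rewrite mulr_sumr; apply: eq_bigr => i _; rewrite mulrA.
Qed.

Lemma ideal_powB m k a b :
  ideal_pow m k a -> ideal_pow m k b -> ideal_pow m k (a - b).
Proof. by move=> ma mb; apply: ideal_powD => //; rewrite -mulN1r; apply: ideal_powM. Qed.

End CommutativeAlgebra.

Section Completion.
Variables (K : comNzRingType) (A : comAlgType K) (m : set A).

(* The inverse limit of the A/m^k: sequences a with a_(k+1) = a_k mod m^k for
   all k, modulo those with a_k in m^k for all k.                             *)
Definition coherent : set (nat -> A) :=
  [set a | forall k, ideal_pow m k (a k.+1 - a k)].
Definition null_sequence : set (nat -> A) := [set a | forall k, ideal_pow m k (a k)].

Lemma coherent1 : coherent 1.
Proof. by move=> k; rewrite subrr; apply: ideal_pow0. Qed.
Lemma coherentB a b : coherent a -> coherent b -> coherent (a - b).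
Proof.
move=> ca cb k; have -> : (a - b) k.+1 - (a - b) k = (a k.+1 - a k) - (b k.+1 - b k).
  by rewrite -[(a - b) k.+1]/(a k.+1 - b k.+1) -[(a - b) k]/(a k - b k) !opprD addrACA.
exact: ideal_powB.
Qed.
Lemma coherentM a b : coherent a -> coherent b -> coherent (a * b).
Proof.
move=> ca cb k.
have -> : (a * b) k.+1 - (a * b) k =
    b k.+1 * (a k.+1 - a k) + a k * (b k.+1 - b k).
  rewrite -[(a * b) k.+1]/(a k.+1 * b k.+1) -[(a * b) k]/(a k * b k) !mulrBr addrA.
  by rewrite [b _ * a k.+1]mulrC [b _ * a k]mulrC subrK.
by apply: ideal_powD; apply: ideal_powM.
Qed.
Lemma coherentZ (k : K) a : coherent a -> coherent (k *: a).
Proof.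
move=> ca i; have -> : (k *: a) i.+1 - (k *: a) i = k%:A * (a i.+1 - a i).
  by rewrite mulr_algl scalerBr.
exact: ideal_powM.
Qed.
Lemma null_sequence0 : null_sequence 0.
Proof. by move=> k; apply: ideal_pow0. Qed.
Lemma null_sequenceB a b :
  null_sequence a -> null_sequence b -> null_sequence (a - b).
Proof. by move=> na nb k; apply: ideal_powB. Qed.
Lemma null_sequenceM a b : null_sequence b -> null_sequence (a * b).
Proof. by move=> nb k; apply: ideal_powM. Qed.

Definition completion_data : subquot_data nat A :=
  Build_subquot_data coherent1 coherentB coherentM coherentZ
    null_sequence0 null_sequenceB null_sequenceM.

Definition completion := subquot completion_data.
HB.instance Definition _ := GRing.ComPzRing.on completion.
HB.instance Definition _ := GRing.Lmodule.on completion.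

End Completion.

(* Isomorphism of K-algebras. *)
Definition completions_isomorphic (K : comNzRingType)
    (A : comAlgType K) (m : set A) (B : comAlgType K) (n : set B) :=
  exists f : {linear completion m -> completion n},
    monoid_morphism f /\ bijective f.

(* A topological space with a sheaf of K-valued functions, i.e. a ringed space
   of functions. A function is total on the space; being regular on U only
   depends on its restriction to U.                                           *)
Record fspace (K : comNzRingType) := {
  point_of :> Type;
  fopen : set (set point_of);
  fregular : set point_of -> set (point_of -> K);
  fopenT : fopen setT;
  fopenI : forall U V, fopen U -> fopen V -> fopen (U `&` V);
  fopen_bigcup : forall (J : Type) (U : J -> set point_of),
    (forall j, fopen (U j)) -> fopen (\bigcup_j U j);
  fregular_cst : forall U k, fopen U -> fregular U (cst k);
  fregularB : forall U f g, fopen U ->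
    fregular U f -> fregular U g -> fregular U (f - g);
  fregularM : forall U f g, fopen U ->
    fregular U f -> fregular U g -> fregular U (f * g);
  fregular_ext : forall U f g, fopen U ->
    (forall x, U x -> f x = g x) -> fregular U f -> fregular U g;
  fregularS : forall U V f, fopen U -> fopen V -> V `<=` U ->
    fregular U f -> fregular V f;
  fregular_local : forall U f, fopen U ->
    (forall x, U x -> exists V, [/\ fopen V, V x, V `<=` U & fregular V f]) ->
    fregular U f }.

Section LocalRing.
Variables (K : fieldType) (X : fspace K) (x : X).

Definition regular_near : set (X -> K^o) :=
  [set f | exists U, [/\ fopen U, U x & fregular U f]].
Definition zero_near : set (X -> K^o) :=
  [set f | exists U, [/\ fopen U, U x & forall y, U y -> f y = 0]].

Lemma regular_near1 : regular_near 1.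
Proof. by exists setT; split=> //; [apply: fopenT | apply/fregular_cst/fopenT]. Qed.
Lemma regular_near2 f g : regular_near f -> regular_near g ->
  exists U, [/\ fopen U, U x, fregular U f & fregular U g].
Proof.
move=> [U [oU Ux Uf]] [V [oV Vx Vg]]; have oUV := fopenI oU oV.
exists (U `&` V); split=> //.
- by apply: fregularS Uf => // y [].
- by apply: fregularS Vg => // y [].
Qed.
Lemma regular_nearB f g : regular_near f -> regular_near g -> regular_near (f - g).
Proof.
move=> nf ng; have [U [oU Ux Uf Ug]] := regular_near2 nf ng.
by exists U; split=> //; apply: fregularB.
Qed.
Lemma regular_nearM f g : regular_near f -> regular_near g -> regular_near (f * g).
Proof.
move=> nf ng; have [U [oU Ux Uf Ug]] := regular_near2 nf ng.
by exists U; split=> //; apply: fregularM.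
Qed.
Lemma regular_nearZ (k : K) f : regular_near f -> regular_near (k *: f).
Proof.
move=> [U [oU Ux Uf]]; exists U; split=> //.
exact: (fregularM oU (fregular_cst k oU) Uf).
Qed.
Lemma zero_near0 : zero_near 0.
Proof. by exists setT; split=> //; apply: fopenT. Qed.
Lemma zero_nearB f g : zero_near f -> zero_near g -> zero_near (f - g).
Proof.
move=> [U [oU Ux Uf]] [V [oV Vx Vg]]; exists (U `&` V); split=> //.
  exact: fopenI.
by move=> y [Uy Vy]; rewrite -[LHS]/(f y - g y) Uf // Vg // subrr.
Qed.
Lemma zero_nearM f g : zero_near g -> zero_near (f * g).
Proof.
move=> [U [oU Ux Ug]]; exists U; split=> // y Uy.
by rewrite -[LHS]/(f y * g y) Ug // mulr0.
Qed.

Definition germ_data : subquot_data X K^o :=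
  Build_subquot_data regular_near1 regular_nearB regular_nearM regular_nearZ
    zero_near0 zero_nearB zero_nearM.

(* The local ring at x: functions regular near x, modulo those vanishing near x. *)
Definition local_ring := subquot germ_data.

Definition germ (f : X -> K) (nf : regular_near f) : local_ring :=
  @sq_class K X K^o germ_data f nf.

HB.instance Definition _ := GRing.ComPzRing.on local_ring.
HB.instance Definition _ := GRing.Lmodule.on local_ring.

Lemma local_ring_nonzero : (1 : local_ring) != 0.
Proof.
apply/eqP => /sq_classP [U [_ Ux /(_ x Ux)]]; rewrite subr0 => /eqP.
by rewrite oner_eq0.
Qed.
HB.instance Definition _ :=
  GRing.PzSemiRing_isNonZero.Build local_ring local_ring_nonzero.
HB.instance Definition _ :=
  GRing.Lmodule_isLalgebra.Build K local_ring (@sq_scaleAl _ _ _ germ_data).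
HB.instance Definition _ := GRing.Lalgebra_isComAlgebra.Build K local_ring.

Definition max_ideal : set local_ring :=
  [set a | exists f (nf : regular_near f), a = germ nf /\ f x = 0].

Definition singular_point := ~ regular_local_ring max_ideal.
End LocalRing.

Local Obligation Tactic := idtac.

Section LocallyFractions.
Variables (K : comNzRingType) (X : Type) (op : set (set X)).
Hypotheses (opT : op setT) (opI : forall U V, op U -> op V -> op (U `&` V)).
Hypothesis (op_bigcup : forall (J : Type) (U : J -> set X),
  (forall j, op (U j)) -> op (\bigcup_j U j)).
Variable (frac : set X -> set (X -> K)).
Hypothesis (frac_cst : forall U k, frac U (cst k)).
Hypothesis (fracB : forall U f g, frac U f -> frac U g -> frac U (f - g)).
Hypothesis (fracM : forall U f g, frac U f -> frac U g -> frac U (f * g)).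
Hypothesis (frac_ext : forall U f g,
  (forall x, U x -> f x = g x) -> frac U f -> frac U g).
Hypothesis (fracS : forall (U V : set X) f, V `<=` U -> frac U f -> frac V f).

Definition locally_frac (U : set X) : set (X -> K) :=
  [set f | forall x, U x -> exists V, [/\ op V, V x, V `<=` U & frac V f]].

Lemma locally_frac2 U f g : locally_frac U f -> locally_frac U g ->
  forall x, U x -> exists V, [/\ op V, V x, V `<=` U & frac V f /\ frac V g].
Proof.
move=> Uf Ug x Ux; have [V [oV Vx VU Vf]] := Uf x Ux.
have [W [oW Wx WU Wg]] := Ug x Ux.
exists (V `&` W); split=> //; [exact: opI | by move=> y [/VU] |].
by split; [apply: fracS Vf | apply: fracS Wg] => y [].
Qed.

Program Definition locally_frac_fspace : fspace K :=
  @Build_fspace K X op locally_frac opT opI op_bigcup _ _ _ _ _ _.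
Next Obligation. by move=> U k oU x Ux; exists U; split. Qed.
Next Obligation.
move=> U f g _ Uf Ug x Ux; have [V [? ? ? []]] := locally_frac2 Uf Ug Ux.
by exists V; split=> //; apply: fracB.
Qed.
Next Obligation.
move=> U f g _ Uf Ug x Ux; have [V [? ? ? []]] := locally_frac2 Uf Ug Ux.
by exists V; split=> //; apply: fracM.
Qed.
Next Obligation.
move=> U f g _ fg Uf x Ux; have [V [? ? VU Vf]] := Uf x Ux.
by exists V; split=> //; apply: frac_ext Vf => y /VU /fg.
Qed.
Next Obligation.
move=> U V f oU oV VU Uf x Vx; have [W [oW Wx _ Wf]] := Uf x (VU x Vx).
exists (W `&` V); split=> //; first exact: opI.
by apply: fracS Wf => y [].
Qed.
Next Obligation.
move=> U f _ H x Ux; have [V [_ Vx VU Vf]] := H x Ux.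
have [W [? ? WV ?]] := Vf x Vx; exists W; split=> //.
exact: subset_trans VU.
Qed.
End LocallyFractions.

Section AffineSpace.
Variables (K : fieldType) (n : nat).
Implicit Types (U : set 'rV[K]_n) (f g : 'rV[K]_n -> K).

Definition affine_open : set (set 'rV[K]_n) :=
  [set U | exists S : set {mpoly K[n]},
     U = [set v : 'rV[K]_n | exists2 p, S p & p.@[v 0] != 0]].

Definition affine_frac U : set ('rV[K]_n -> K) :=
  [set f | exists p q : {mpoly K[n]},
     forall v, U v -> q.@[v 0] != 0 /\ f v = p.@[v 0] / q.@[v 0]].

Lemma affine_openT : affine_open setT.
Proof.
exists [set 1]; apply/seteqP; split=> // v _.
by exists 1 => //; rewrite meval1 oner_eq0.
Qed.
Lemma affine_openI U V : affine_open U -> affine_open V -> affine_open (U `&` V).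
Proof.
move=> [S ->] [T ->].
exists [set r | exists p q, [/\ S p, T q & r = p * q]].
apply/seteqP; split=> v /=.
  move=> [[p Sp p0] [q Tq q0]]; exists (p * q); first by exists p, q.
  by rewrite mevalM mulf_neq0.
move=> [_ [p [q [Sp Tq ->]]]]; rewrite mevalM mulf_eq0 negb_or => /andP[p0 q0].
by split; [exists p | exists q].
Qed.
Lemma affine_open_bigcup (J : Type) (U : J -> set 'rV[K]_n) :
  (forall j, affine_open (U j)) -> affine_open (\bigcup_j U j).
Proof.
move=> /choice[S US]; exists (\bigcup_j S j); apply/seteqP; split=> v.
  by move=> [j _]; rewrite US => -[p Sp p0]; exists p => //; exists j.
by move=> [p [j _ Sp] p0]; exists j; rewrite // US; exists p.
Qed.
Lemma affine_frac_cst U k : affine_frac U (cst k).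
Proof.
by exists k%:MP, 1 => v _; rewrite mevalC meval1 divr1; split=> //; apply: oner_neq0.
Qed.
Lemma affine_fracB U f g : affine_frac U f -> affine_frac U g -> affine_frac U (f - g).
Proof.
move=> [p [q fE]] [r [s gE]]; exists (p * s - r * q), (q * s) => v Uv.
have [q0 fv] := fE v Uv; have [s0 gv] := gE v Uv.
rewrite mevalB !mevalM mulf_neq0 //; split=> //.
by rewrite -[LHS]/(f v - g v) fv gv -mulNr addf_div // mulNr.
Qed.
Lemma affine_fracM U f g : affine_frac U f -> affine_frac U g -> affine_frac U (f * g).
Proof.
move=> [p [q fE]] [r [s gE]]; exists (p * r), (q * s) => v Uv.
have [q0 fv] := fE v Uv; have [s0 gv] := gE v Uv.
rewrite !mevalM mulf_neq0 //; split=> //.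
by rewrite -[LHS]/(f v * g v) fv gv mulf_div.
Qed.
Lemma affine_frac_ext U f g :
  (forall v, U v -> f v = g v) -> affine_frac U f -> affine_frac U g.
Proof. by move=> fg [p [q fE]]; exists p, q => v Uv; rewrite -fg //; apply: fE. Qed.
Lemma affine_fracS U V f : V `<=` U -> affine_frac U f -> affine_frac V f.
Proof. by move=> VU [p [q fE]]; exists p, q => v /VU; apply: fE. Qed.

Definition affine_space : fspace K :=
  locally_frac_fspace affine_openT affine_openI affine_open_bigcup
    affine_frac_cst affine_fracB affine_fracM affine_frac_ext affine_fracS.
End AffineSpace.

Section ProjectiveSpace.
Variables (K : fieldType) (n : nat).

(* P(W) for W = 'rV[K]_n; its dimension is n - 1. *)
Definition line := {L : {vspace 'rV[K]_n} | \dim L == 1%N}.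
Implicit Types (L : line) (U : set line) (f g : line -> K).

(* For homogeneous p, this is the negation of "p vanishes on L". *)
Definition nonvanishing (p : {mpoly K[n]}) L :=
  forall w, w \in val L -> w != 0 -> p.@[w 0] != 0.

Definition proj_open : set (set line) :=
  [set U | exists S : set {mpoly K[n]},
     (forall p, S p -> exists d, p \is d.-homog) /\
     U = [set L | exists2 p, S p & nonvanishing p L]].

Definition proj_frac U : set (line -> K) :=
  [set f | exists d (p q : {mpoly K[n]}),
     [/\ p \is d.-homog, q \is d.-homog & forall L, U L ->
       forall w, w \in val L -> w != 0 ->
         q.@[w 0] != 0 /\ f L = p.@[w 0] / q.@[w 0]]].

Lemma line_neq0 L : exists2 w, w \in val L & w != 0.
Proof.
exists (vpick (val L)); first exact: memv_pick.
by rewrite vpick0 -dimv_eq0 (eqP (valP L)).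
Qed.

Lemma line_colinear L v w : v \in val L -> w \in val L -> v != 0 ->
  exists c, w = c *: v.
Proof.
move=> vL wL v0; apply/vlineP; suff -> : <[v]>%VS = val L by [].
by apply/eqP; rewrite eqEdim -memvE vL dim_vline v0 (eqP (valP L)).
Qed.

Lemma homog_mevalZ d (p : {mpoly K[n]}) c (w : 'rV[K]_n) : p \is d.-homog ->
  p.@[(c *: w) 0] = c ^+ d * p.@[w 0].
Proof.
move=> /dhomogP hp; rewrite !mevalE mulr_sumr big_seq [RHS]big_seq.
apply: eq_bigr => m /hp; rewrite /= => <-; rewrite mulrCA; congr (_ * _).
rewrite mdegE -prodrXr -big_split /=; apply: eq_bigr => i _.
by rewrite mxE exprMn.
Qed.

Lemma nonvanishingE d (p : {mpoly K[n]}) L : p \is d.-homog ->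
  nonvanishing p L <-> exists2 w, w \in val L & (w != 0) && (p.@[w 0] != 0).
Proof.
move=> hp; split=> [H|[v vL /andP[v0 pv]] w wL w0].
  by have [w wL w0] := line_neq0 L; exists w; rewrite // w0 H.
have [c wE] := line_colinear vL wL v0; rewrite wE (homog_mevalZ _ _ hp).
by rewrite mulf_neq0 // expf_neq0 //; apply: contraNneq w0 => c0; rewrite wE c0 scale0r.
Qed.

Lemma proj_openT : proj_open setT.
Proof.
exists [set 1]; split; first by move=> _ ->; exists 0%N; apply: dhomog1.
apply/seteqP; split=> // L _.
by exists 1 => // w _ _; rewrite meval1 oner_eq0.
Qed.
Lemma proj_openI U V : proj_open U -> proj_open V -> proj_open (U `&` V).
Proof.
move=> [S [hS ->]] [T [hT ->]].
exists [set r | exists p q, [/\ S p, T q & r = p * q]]; split.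
  move=> _ [p [q [/hS[d hp] /hT[e hq] ->]]]; exists (d + e)%N; exact: dhomogM.
apply/seteqP; split=> L /=.
  move=> [[p Sp p0] [q Tq q0]]; exists (p * q); first by exists p, q.
  by move=> w wL w0; rewrite mevalM mulf_neq0 ?p0 ?q0.
move=> [_ [p [q [Sp Tq ->]]] pq0]; split; [exists p => // | exists q => //].
  by move=> w wL w0; have := pq0 w wL w0; rewrite mevalM mulf_eq0 negb_or => /andP[].
by move=> w wL w0; have := pq0 w wL w0; rewrite mevalM mulf_eq0 negb_or => /andP[].
Qed.
Lemma proj_open_bigcup (J : Type) (U : J -> set line) :
  (forall j, proj_open (U j)) -> proj_open (\bigcup_j U j).
Proof.
move=> /choice[S US]; exists (\bigcup_j S j); split.
  by move=> p [j _ Sp]; have [+ _] := US j; apply.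
apply/seteqP; split=> L.
  by move=> [j _]; rewrite (US j).2 => -[p Sp p0]; exists p => //; exists j.
by move=> [p [j _ Sp] p0]; exists j; rewrite // (US j).2; exists p.
Qed.
Lemma proj_frac_cst U k : proj_frac U (cst k).
Proof.
exists 0%N, k%:MP, 1; split; last 1 first.
- by move=> L _ w _ _; rewrite mevalC meval1 divr1; split=> //; apply: oner_neq0.
- by rewrite -[k%:MP]mulr1 mul_mpolyC; apply/dhomogZ/dhomog1.
- exact: dhomog1.
Qed.
Lemma proj_fracB U f g : proj_frac U f -> proj_frac U g -> proj_frac U (f - g).
Proof.
move=> [d [p [q [hp hq fE]]]] [e [r [s [hr hs gE]]]].
exists (d + e)%N, (p * s - r * q), (q * s); split; [|exact: dhomogM|].
  by apply: rpredB; [|rewrite addnC]; apply: dhomogM.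
move=> L UL w wL w0.
have [q0 fv] := fE L UL w wL w0; have [s0 gv] := gE L UL w wL w0.
rewrite mevalB !mevalM mulf_neq0 //; split=> //.
by rewrite -[LHS]/(f L - g L) fv gv -mulNr addf_div // mulNr.
Qed.
Lemma proj_fracM U f g : proj_frac U f -> proj_frac U g -> proj_frac U (f * g).
Proof.
move=> [d [p [q [hp hq fE]]]] [e [r [s [hr hs gE]]]].
exists (d + e)%N, (p * r), (q * s); split; [exact: dhomogM|exact: dhomogM|].
move=> L UL w wL w0.
have [q0 fv] := fE L UL w wL w0; have [s0 gv] := gE L UL w wL w0.
rewrite !mevalM mulf_neq0 //; split=> //.
by rewrite -[LHS]/(f L * g L) fv gv mulf_div.
Qed.
Lemma proj_frac_ext U f g :
  (forall L, U L -> f L = g L) -> proj_frac U f -> proj_frac U g.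
Proof.
move=> fg [d [p [q [hp hq fE]]]]; exists d, p, q; split=> // L UL w wL w0.
by rewrite -fg //; apply: fE.
Qed.
Lemma proj_fracS U V f : V `<=` U -> proj_frac U f -> proj_frac V f.
Proof.
move=> VU [d [p [q [hp hq fE]]]]; exists d, p, q; split=> // L /VU; exact: fE.
Qed.

Definition proj_space : fspace K :=
  locally_frac_fspace proj_openT proj_openI proj_open_bigcup
    proj_frac_cst proj_fracB proj_fracM proj_frac_ext proj_fracS.
End ProjectiveSpace.

Section Quotient.
Variables (K : comNzRingType) (X : fspace K).
Variables (gT : finGroupType) (G : {group gT}) (to : action G X).

Definition orbit_of (x : X) : set X := [set y | exists2 g, g \in G & y = to x g].

Definition orbit_space := {O : set X | exists x, O = orbit_of x}.

Definition orbit_proj (x : X) : orbit_space := exist _ _ (ex_intro _ x erefl).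

(* A set is open, a function is regular, when its pullback to X is. *)
Program Definition quotient_space : fspace K := {|
  point_of := orbit_space;
  fopen := [set U | fopen (orbit_proj @^-1` U)];
  fregular := fun U => [set f : orbit_space -> K |
                        fregular (orbit_proj @^-1` U) (f \o orbit_proj)] |}.
Next Obligation. exact: fopenT. Qed.
Next Obligation. by move=> U V; apply: fopenI. Qed.
Next Obligation. by move=> J U oU; rewrite /= preimage_bigcup; apply: fopen_bigcup. Qed.
Next Obligation. by move=> U k oU; apply: fregular_cst. Qed.
Next Obligation. by move=> U f g oU; apply: fregularB. Qed.
Next Obligation. by move=> U f g oU; apply: fregularM. Qed.
Next Obligation.
by move=> U f g oU fg; apply: fregular_ext => // x Ux; apply: fg.
Qed.
Next Obligation.
by move=> U V f oU oV VU; apply: fregularS => // x; apply: VU.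
Qed.
Next Obligation.
move=> U f oU H; apply: fregular_local => // x Ux.
by have [V [oV Vx VU Vf]] := H _ Ux; exists (orbit_proj @^-1` V); split=> // y /VU.
Qed.

End Quotient.

Section RepresentationActions.
Variables (K : fieldType) (gT : finGroupType) (G : {group gT}) (n : nat).
Variable rG : mx_representation K G n.

(* W is 'rV[K]_n, on which G acts on the right, as usual for mx_representation.
   An action must be defined, and injective, outside G too: there subg G g = 1.   *)
Definition linear_act (v : 'rV[K]_n) (g : gT) : 'rV[K]_n := v *m rG (val (subg G g)).

Lemma linear_act_is_action : is_action G linear_act.
Proof.
split=> [g u v|v g h Gg Gh]; rewrite /linear_act.
  by move/(can_inj (repr_mxK rG (valP (subg G g)))).
by rewrite !subgK ?groupM //= repr_mxM // mulmxA.
Qed.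

Definition linear_action : action G (affine_space K n) := Action linear_act_is_action.

Definition act_hom (g : gT) : 'End('rV[K]_n) := linfun (mulmxr (rG (val (subg G g)))).

Lemma act_homE g v : act_hom g v = linear_act v g.
Proof. by rewrite lfunE. Qed.

Lemma act_hom_ker0 g : lker (act_hom g) == 0%VS.
Proof.
apply/lker0P => u v; rewrite !act_homE.
by case: linear_act_is_action => inj _; apply: inj.
Qed.

Lemma line_act_dim (L : line K n) g : \dim (act_hom g @: val L)%VS == 1%N.
Proof. by rewrite limg_dim_eq ?(valP L) // (eqP (act_hom_ker0 g)) capv0. Qed.

Definition line_act (L : line K n) (g : gT) : line K n :=
  exist _ (act_hom g @: val L)%VS (line_act_dim L g).

Lemma line_act_is_action : is_action G line_act.
Proof.
split=> [g L M /(congr1 val) /= e|L g h Gg Gh]; apply/val_inj.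
  have K1 := lker0_lfunK (act_hom_ker0 g).
  have K2 : ((act_hom g)^-1 \o act_hom g)%VF = \1%VF.
    by apply/lfunP => v; rewrite comp_lfunE id_lfunE K1.
  by rewrite -[LHS]lim1g -[RHS]lim1g -K2 !limg_comp e.
rewrite /= -limg_comp; congr (_ @: _)%VS; apply/lfunP => v.
rewrite comp_lfunE !act_homE.
by case: linear_act_is_action => _; apply.
Qed.

Definition proj_action : action G (proj_space K n) := Action line_act_is_action.
End RepresentationActions.

Definition linear_quotient (K : fieldType) (gT : finGroupType) (G : {group gT})
    (n : nat) (rG : mx_representation K G n) : fspace K :=
  quotient_space (linear_action rG).

Definition proj_quotient (K : fieldType) (gT : finGroupType) (G : {group gT})
    (n : nat) (rG : mx_representation K G n) : fspace K :=
  quotient_space (proj_action rG).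

Definition origin_image (K : fieldType) (gT : finGroupType) (G : {group gT})
    (n : nat) (rG : mx_representation K G n) : linear_quotient rG :=
  orbit_proj (linear_action rG) (0 : 'rV[K]_n).

(* Nonsingular points are not excluded. *)
Definition abelian_singularity (K : fieldType) (X : fspace K) (x : X) :=
  exists (n : nat) (aT : finGroupType) (A : {group aT})
         (rA : mx_representation K A n),
    abelian A /\
    completions_isomorphic (max_ideal (x := x))
                           (max_ideal (x := origin_image rA)).

(* Main.v *)
(* Let H be the stabilizer in G = PSL(2, 7) of a line L of W. By Maschke, W = L + V for
   an H-invariant plane V, and t |-> L_t = <(1, t)> identifies the plane T = Hom(L, V),
   on which H acts linearly, with an H-stable neighbourhood of L in P(W). This chart
   induces an isomorphism between the completions of P(W) / G at L and of T / H at 0: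
   both topologies are those of the orders of vanishing along the orbits, since every
   function x vanishing on an orbit is a root of the polynomial prod_g (X - g x), and a
   germ at L is approximated by G-invariant functions, averages of functions that
   vanish to high order at the rest of the orbit of L.

   If H is abelian, we are done. Otherwise H is dihedral of order 6 or 8. Indeed H'
   acts trivially on L and in SL(V). So an involution of H' is -1 on V, hence central
   in H, and centralizers of involutions of G are dihedral of order 8; an element of
   order 7 of H' would have the same trace as its square, which is one of its conjugates;
   in the remaining case H' has order 3, and its normalizer in G is dihedral of order 6.
   As H acts on T through a group generated by diag(z, 1/z) and a swap, its invariants
   are the polynomials in x y and x^m + y^m, with z of order m, and T / H is isomorphic
   to the affine plane, the quotient of C^2 by the trivial group. *)
Require Import Defs.
From HB Require Import structures.
From mathcomp Require Import all_boot all_order all_algebra all_fingroup.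
From mathcomp Require Import all_solvable all_field mxrepresentation reals complex.

Set Implicit Arguments.
Unset Strict Implicit.
Unset Printing Implicit Defensive.

Import GRing.Theory Num.Theory.
Local Open Scope ring_scope.

(** * Subgroups of PSL(2, 7) *)

(** Pullback of germs along the chart need not be surjective: an H-invariant function near 0 has no
    reason to come from a G-invariant one. So two estimates replace an isomorphism of local rings:
    orders of vanishing are reflected up to a constant factor, and the image is dense. The factor is
    a group order: the orbit polynomial puts x^|G| in the ideal generated by the invariants that
    vanish on the orbit, polarization, valid in characteristic 0, extends this to products of |G|
    different functions, and averaging makes the coefficients invariant.

    A function on the chart may make no sense at the other points of the orbit. It is therefore
    never extended alone, but together with a multiplier that is 1 at L and 0 at these points, and
    traces are divided by the trace of the multiplier.

    The map from T / H to the plane, by contrast, is an isomorphism on the local rings themselves.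
    It requires c^2 to act nontrivially on T, which does not follow from faithfulness alone, T being
    V twisted by the inverse of the character of L; but c is conjugate to its inverse in H, so this
    character is 1 at c^2.

    The facts about PSL(2, 7) are checked on the 336 matrices of SL(2, 7). *)

(* D is dihedral of order 6 or 8. *)
Definition dihedral8 (gT : finGroupType) (D : {group gT}) := exists c s,
  [/\ [/\ c \in D, s \in D & (s ^+ 2 = 1)%g], (c ^ s = c^-1)%g, (c ^+ 2 != 1)%g &
      forall g, g \in D -> exists (i : 'I_4) (j : 'I_2), g = (c ^+ i * s ^+ j)%g].

Section DihedralSubgroup.
Local Open Scope group_scope.
Variables (gT : finGroupType).

Lemma abelian_card_le4 (H : {group gT}) : (#|H| <= 4)%N -> abelian H.
Proof.
have := cardG_gt0 H; case nH: #|H| => [|[|[|[|[|n]]]]] // _ _.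
- by rewrite (card1_trivg nH) abelian1.
- by apply: cyclic_abelian; apply: prime_cyclic; rewrite nH.
- by apply: cyclic_abelian; apply: prime_cyclic; rewrite nH.
- exact: (@card_p2group_abelian _ 2).
Qed.

Lemma dihedral8_card (D : {group gT}) : dihedral8 D -> (#|D| <= 8)%N.
Proof.
move=> [c [s [_ _ _ Dcs]]].
pose f (ij : 'I_4 * 'I_2) := c ^+ ij.1 * s ^+ ij.2.
have sD : D \subset f @: [set: 'I_4 * 'I_2].
  by apply/subsetP => g /Dcs[i [j ->]]; apply/imsetP; exists (i, j).
by apply: leq_trans (subset_leq_card sD) (leq_trans (leq_imset_card _ _) _);
  rewrite cardsT card_prod !card_ord.
Qed.

(** A proper subgroup contains at most half of at most 8 elements, and groups of order at most 4 are
    abelian. *)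
Lemma dihedral8_sub (D H : {group gT}) : dihedral8 D -> H \subset D -> ~~ abelian H ->
  dihedral8 H.
Proof.
move=> D8 sHD nabH; suff -> : H = D by [].
apply/val_inj/eqP; rewrite eqEcard sHD leqNgt /=; apply: contra nabH => ltHD.
apply: abelian_card_le4; have /dvdnP[k Dk] := cardSg sHD.
have := dihedral8_card D8; rewrite Dk in ltHD *.
have := cardG_gt0 H; case: k {Dk} ltHD => [|[|k]]; rewrite ?mul0n ?mul1n ?ltnn //.
move=> _ _ leq8; rewrite -(leq_pmul2l (isT : (0 < 2)%N)).
by apply: leq_trans leq8; rewrite leq_mul2r orbT.
Qed.

End DihedralSubgroup.

(* Matrices over F_7, with entries represented by natural numbers below 7. *)
Definition quad := (nat * nat * nat * nat)%type.

Definition quad_mul (p q : quad) : quad :=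
  let: (a, b, c, d) := p in let: (a', b', c', d') := q in
  ((a * a' + b * c') %% 7, (a * b' + b * d') %% 7,
   (c * a' + d * c') %% 7, (c * b' + d * d') %% 7)%N.
Definition quad_one : quad := (1, 0, 0, 1)%N.
(** Entries are natural numbers, so -1 is represented by 6, here and in [quad_det]. *)
Definition quad_opp (p : quad) : quad :=
  let: (a, b, c, d) := p in ((6 * a) %% 7, (6 * b) %% 7, (6 * c) %% 7, (6 * d) %% 7)%N.
Definition quad_det (p : quad) := let: (a, b, c, d) := p in ((a * d + 6 * (b * c)) %% 7)%N.
Definition quad_exp p n := iter n (quad_mul p) quad_one.
(** Stands for equality of the classes in PSL(2, 7), the centre of SL(2, 7) being {1, -1}. *)
Definition quad_eq p q := (p == q) || (p == quad_opp q).

Definition F7_pairs := [seq (a, b) | a <- iota 0 7, b <- iota 0 7].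
Definition quads : seq quad :=
  [seq q <- [seq (p.1, p.2, p'.1, p'.2) | p <- F7_pairs, p' <- F7_pairs] | quad_det q == 1%N].

(* The test is not a mere conjunction because vm_compute evaluates both sides of &&. *)
Definition dihedral_quads n (C : seq quad) c s :=
  if [&& quad_eq (quad_mul s s) quad_one, quad_eq (quad_mul c (quad_mul s c)) s &
         ~~ quad_eq (quad_mul c c) quad_one]
  then all (fun g => has (fun i => quad_eq g (quad_exp c i) || quad_eq g (quad_mul (quad_exp c
    i) s)) (iota 0 n)) C
  else false.

(** Commutation is tested without regard to sign only in the checks that follow; here the centre of
    SL(2, 7) itself is at stake. *)
Definition quads_center (Q : seq quad) := all (fun u => quad_eq u quad_one ||
  has (fun g => quad_mul g u != quad_mul u g) Q) Q.

(** With [quad_eq], [C] is the centralizer in PSL(2, 7). In SL(2, 7) the matrices [u] have order 4,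
    since their square is -1. *)
Definition quads_order2 (Q : seq quad) := all (fun u =>
    let C := [seq g <- Q | quad_eq (quad_mul g u) (quad_mul u g)] in
    has (fun c => has (dihedral_quads 4 C c) C) C)
  [seq u <- Q | quad_eq (quad_mul u u) quad_one & ~~ quad_eq u quad_one].

(** An element that normalizes the subgroup of order 3 sends [u] to [u] or to its square, whence the
    two alternatives in [C]. The rotation of the dihedral group is [u] itself. *)
Definition quads_order3 (Q : seq quad) := all (fun u =>
    let C := [seq g <- Q | quad_eq (quad_mul u g) (quad_mul g u)
                 || quad_eq (quad_mul u g) (quad_mul g (quad_mul u u))] in
    has (dihedral_quads 3 C u) C)
  [seq u <- Q | quad_eq (quad_exp u 3) quad_one & ~~ quad_eq u quad_one].

(** This holds because 2 = 3^2 is a square modulo 7: diagonal matrices of determinant 1 multiply the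
    off-diagonal entry of a unipotent triangular matrix by squares. *)
Definition quads_order7 (Q : seq quad) := all (fun u =>
    has (fun g => quad_eq (quad_mul u g) (quad_mul g (quad_mul u u))) Q)
  [seq u <- Q | quad_eq (quad_exp u 7) quad_one & ~~ quad_eq u quad_one].

Definition quads_opp (Q : seq quad) := all (fun p =>
  (quad_mul (quad_opp quad_one) p == quad_opp p) &&
    (quad_mul p (quad_opp quad_one) == quad_opp p)) Q.

Lemma quads_size : size quads = 336%N. Proof. by vm_compute. Qed.
Lemma quads_uniq : uniq quads. Proof. by vm_compute. Qed.
Lemma quads_centerT : quads_center quads. Proof. by vm_compute. Qed.
Lemma quads_oppT : quads_opp quads. Proof. by vm_compute. Qed.
Lemma quads_order2T : quads_order2 quads. Proof. by vm_compute. Qed.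
Lemma quads_order3T : quads_order3 quads. Proof. by vm_compute. Qed.
Lemma quads_order7T : quads_order7 quads. Proof. by vm_compute. Qed.

Section QuadMatrix.

Lemma mul_mx2E (R : pzRingType) m p (A : 'M[R]_(m, 2)) (B : 'M[R]_(2, p)) i j :
  (A *m B) i j = A i 0 * B 0 j + A i 1 * B 1 j.
Proof.
by rewrite mxE big_ord_recl big_ord1; congr (_ + A i _ * B _ j); apply/val_inj.
Qed.

Lemma det_mx2E (R : comPzRingType) (A : 'M[R]_2) : \det A = A 0 0 * A 1 1 - A 0 1 * A 1 0.
Proof.
rewrite (expand_det_row _ 0) big_ord_recl big_ord1 /cofactor !det_mx11 !mxE /=.
rewrite expr0 expr1 mul1r mulN1r mulrN; congr (A 0 _ * A _ _ - A 0 _ * A _ _); exact/val_inj.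
Qed.

Definition mx_quad (A : 'M['F_7]_2) : quad := (A 0 0 : nat, A 0 1 : nat, A 1 0 : nat,
  A 1 1 : nat).

Definition quad_mx (p : quad) : 'M['F_7]_2 :=
  let: (a, b, c, d) := p in
  \matrix_(i, j) if i == 0 then if j == 0 then a%:R else b%:R
                 else if j == 0 then c%:R else d%:R.

Lemma mx_quadK : cancel mx_quad quad_mx.
Proof.
move=> A; apply/matrixP => i j; rewrite mxE.
by case: i j => [[|[|i]] lti] [[|[|j]] ltj] //=; rewrite natr_Zp; congr (A _ _); apply/val_inj.
Qed.

Lemma mx_quadM A B : mx_quad (A *m B) = quad_mul (mx_quad A) (mx_quad B).
Proof. by rewrite /mx_quad !mul_mx2E /= !modnDm. Qed.

Lemma mx_quad1 : mx_quad 1%:M = quad_one.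
Proof. by rewrite /mx_quad !mxE. Qed.

Lemma quads_mx A : \det A = 1 -> mx_quad A \in quads.
Proof.
rewrite det_mx2E => dA; rewrite mem_filter; apply/andP; split.
  apply/eqP; transitivity (nat_of_ord (A 0 0 * A 1 1 - A 0 1 * A 1 0)); last by rewrite dA.
  have subE (a b : 'F_7) : nat_of_ord (a - b) = ((a + 6 * b) %% 7)%N.
    by case: a b => [[|[|[|[|[|[|[|]]]]]]] ?] // [[|[|[|[|[|[|[|]]]]]]]].
  have mulE (a b : 'F_7) : nat_of_ord (a * b) = (a * b %% 7)%N by [].
  by rewrite subE !mulE modnDml -[in RHS]modnDmr modnMmr modnDmr.
have F7 (a : 'F_7) : nat_of_ord a \in iota 0 7 by rewrite mem_iota; apply: ltn_ord.
apply/allpairsP; exists ((A 0 0 : nat, A 0 1 : nat), (A 1 0 : nat, A 1 1 : nat)); split=> //.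
  by apply/allpairsP; exists (A 0 0 : nat, A 0 1 : nat); rewrite !F7.
by apply/allpairsP; exists (A 1 0 : nat, A 1 1 : nat); rewrite !F7.
Qed.

Lemma mem_quads p : p \in quads -> mx_quad (quad_mx p) = p /\ \det (quad_mx p) = 1.
Proof.
rewrite mem_filter => /andP[/eqP dp /allpairsP[[q q'] [/allpairsP[[a b] [/= Fa Fb ->]]
  /allpairsP[[c d] [/= Fc Fd ->]] pE]]].
rewrite {}pE in dp *; have {}dp : quad_det (a, b, c, d) = 1%N := dp.
have F7 k : k \in iota 0 7 -> nat_of_ord (k%:R : 'F_7) = k.
  by rewrite mem_iota => lt7; rewrite val_Fp_nat // modn_small.
split; first by rewrite /mx_quad !mxE !F7.
rewrite det_mx2E !mxE /=; transitivity ((quad_det (a, b, c, d))%:R : 'F_7); last by rewrite dp.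
rewrite /quad_det Fp_nat_mod // natrD !natrM (_ : 6%:R = -1 :> 'F_7) ?mulN1r //.
by apply/val_inj; rewrite [LHS]val_Fp_nat.
Qed.

End QuadMatrix.

(* S is SL(2, 7), kept abstract so that conversion never unfolds matrix groups. *)
Section CentralQuotient.
Local Open Scope group_scope.
Variables (gT : finGroupType) (S : {group gT}) (q : gT -> quad).
Local Notation Z := 'Z(S).
Local Notation PS := (S / 'Z(S)).
Implicit Types (u v : gT) (x y z g : coset_of 'Z(S)).
Hypothesis qM : forall u v, q (u * v) = quad_mul (q u) (q v).
Hypothesis q1 : q 1 = quad_one.
Hypothesis q_inj : injective q.
Hypothesis S_quads : forall u, u \in S -> q u \in quads.
Hypothesis quads_S : forall p, p \in quads -> exists2 u, u \in S & q u = p.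

Lemma q_center u : u \in Z -> quad_eq (q u) quad_one.
Proof.
move=> /centerP[Su cu]; have /allP/(_ _ (S_quads Su)) := quads_centerT.
case/orP => // /hasP[p /quads_S[g Sg <-]].
by rewrite -!qM cu // eqxx.
Qed.

Lemma q_oppl v : v \in S -> quad_mul (quad_opp quad_one) (q v) = quad_opp (q v).
Proof. by move=> Sv; have /allP/(_ _ (S_quads Sv))/andP[/eqP] := quads_oppT. Qed.

Lemma q_oppr v : v \in S -> quad_mul (q v) (quad_opp quad_one) = quad_opp (q v).
Proof. by move=> Sv; have /allP/(_ _ (S_quads Sv))/andP[_ /eqP] := quads_oppT. Qed.

Lemma center_opp u : u \in S -> q u = quad_opp quad_one -> u \in Z.
Proof.
move=> Su uE; apply/centerP; split=> // v Sv; apply: q_inj.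
by rewrite !qM uE q_oppl // q_oppr.
Qed.

(** The centre consists of 1 and -1: one inclusion is [q_center], the other [center_opp]. This
    carries the checks on quadruples over to the quotient. *)
Lemma coset_quad_eq u v : u \in S -> v \in S ->
  (coset Z u = coset Z v) <-> quad_eq (q u) (q v).
Proof.
move=> Su Sv; have sZ : Z \subset S by apply: center_sub.
have nZ w : w \in S -> w \in 'N(Z) by apply/subsetP/gFnorm.
have uvE : q (u * v^-1 * v) = q u by rewrite mulgKV.
split=> [e|].
  have : u * v^-1 \in Z.
    have : coset Z (u * v^-1) = 1 by rewrite morphM ?morphV ?groupV ?nZ //= e mulgV.
    by move=> /coset_idr; apply; rewrite groupM ?groupV ?nZ.
  move=> /q_center/orP[] /eqP uv; rewrite -uvE qM uv.
    by rewrite -q1 -qM mul1g /quad_eq eqxx.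
  by rewrite q_oppl // /quad_eq eqxx orbT.
case/orP=> /eqP e; first by rewrite (q_inj e).
have [w Sw wE] : exists2 w, w \in S & q w = quad_opp quad_one.
  by apply: quads_S; vm_compute.
have -> : u = w * v by apply: q_inj; rewrite qM wE q_oppl.
by rewrite morphM ?nZ //= coset_id ?mul1g // center_opp.
Qed.

Lemma PSL_lift x : x \in PS -> exists2 u, u \in S & x = coset Z u.
Proof. by move=> /morphimP[u _ Su ->]; exists u. Qed.

Lemma coset_PSL u : u \in S -> coset Z u \in PS.
Proof. by move=> Su; apply: mem_quotient. Qed.

Let nZ u : u \in S -> u \in 'N(Z).
Proof. by apply/subsetP/gFnorm. Qed.

Let cosetM u v : u \in S -> v \in S -> coset Z (u * v) = coset Z u * coset Z v.
Proof. by move=> Su Sv; rewrite morphM ?nZ. Qed.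

Let coset1 : coset Z 1 = 1.
Proof. exact: morph1. Qed.

Let cosetX u i : u \in S -> coset Z (u ^+ i) = coset Z u ^+ i.
Proof. by move=> Su; rewrite morphX ?nZ. Qed.

Lemma qX u i : q (u ^+ i) = quad_exp (q u) i.
Proof.
elim: i => [|i IHi]; first by rewrite expg0 q1.
by rewrite expgS qM IHi.
Qed.

Lemma card_central_cover : #|S| = 336%N.
Proof.
rewrite -quads_size cardE -(size_map q); apply/eqP; rewrite eqn_leq.
rewrite !uniq_leq_size ?quads_uniq ?(map_inj_uniq q_inj) ?enum_uniq //.
  by move=> p /quads_S[u Su <-]; apply: map_f; rewrite mem_enum.
by move=> _ /mapP[u + ->]; rewrite mem_enum => /S_quads.
Qed.

(** As -1 is central, 2 divides the order of the centre. A divisibility is enough, since it serves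
    to bound the primes of H'. *)
Lemma card_PS : (#|PS| %| 168)%N.
Proof.
have [u Su uE] : exists2 u, u \in S & q u = quad_opp quad_one.
  by apply: quads_S; vm_compute.
have Zu := center_opp Su uE.
have u2 : #[u] = 2%N.
  apply: nt_prime_order => //.
    by apply: q_inj; rewrite qX uE q1.
  by apply: contra_eq_neq uE => ->; rewrite q1.
have /dvdnP[k kE] : (2 %| #|Z|)%N by rewrite -u2 order_dvdG.
have := card_central_cover; rewrite -(Lagrange (center_sub S)) -card_quotient ?gFnorm // kE.
rewrite mulnAC -[336%N]/(168 * 2)%N => /eqP; rewrite eqn_pmul2r // => /eqP <-.
by rewrite dvdn_mull.
Qed.

(** Applied with [n] equal to 4 for centralizers of involutions and to 3 for normalizers of
    subgroups of order 3; exponents below [n] fit in the range that [dihedral8] allows. *)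
Lemma quads_dihedral8 n (D : {group coset_of Z}) (C : seq quad) c s : (n <= 4)%N ->
  D \subset PS ->
  (forall u, u \in S -> (coset Z u \in D) = (q u \in C)) ->
  c \in S -> s \in S -> q c \in C -> q s \in C ->
  dihedral_quads n C (q c) (q s) -> dihedral8 D.
Proof.
move=> le4 sD DC Sc Ss Cc Cs; rewrite /dihedral_quads; case: ifP => // /and3P[ss csc cc] /allP Cg.
rewrite -!qM -!q1 in ss csc cc *.
exists (coset Z c), (coset Z s); split; first split.
- by rewrite DC.
- by rewrite DC.
- by rewrite expgS expg1 -cosetM // -coset1; apply/coset_quad_eq; rewrite ?groupM.
(* The test on quadruples is [c s c = s], which avoids inverses; the relation [c ^ s = c^-1] is
   recovered from it. *)
- have e : coset Z c * (coset Z s * coset Z c) = coset Z s.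
    by rewrite -!cosetM ?groupM //; apply/coset_quad_eq; rewrite ?groupM.
  rewrite conjgE; apply: (mulgI (coset Z s)); rewrite mulKVg; apply: (mulIg (coset Z c)).
  by rewrite mulgKV -mulgA.
- apply: contra cc => /eqP; rewrite expgS expg1 -cosetM // -coset1.
  by move=> /coset_quad_eq; apply; rewrite ?groupM.
move=> x Dx; have [g Sg xE] := PSL_lift (subsetP sD x Dx).
have Cqg : q g \in C by rewrite -DC // -xE.
rewrite xE; have H := Cg _ Cqg; move/hasP: H => -[i +]; rewrite mem_iota add0n => /= ltin.
have lt4 : (i < 4)%N by apply: leq_trans le4.
case/orP; rewrite -!qX -?qM => /coset_quad_eq e.
  exists (Ordinal lt4), ord0; rewrite expg0 mulg1 -cosetX //; apply: e => //; exact: groupX.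
exists (Ordinal lt4), ord_max; rewrite expg1 -cosetX // -cosetM ?groupX //; apply: e => //.
by rewrite groupM ?groupX.
Qed.

Lemma PS_centraliser2 z : z \in PS -> #[z] = 2%N ->
  dihedral8 ('C_(PS)[z])%G.
Proof.
move=> Gz oz; have [u Su zE] := PSL_lift Gz.
have u2 : quad_eq (quad_mul (q u) (q u)) quad_one.
  rewrite -qM -q1; apply/coset_quad_eq; rewrite ?groupM //.
  by rewrite cosetM // -zE coset1 -[z * z]/(z ^+ 2) -oz expg_order.
have u1 : ~~ quad_eq (q u) quad_one.
  rewrite -q1; apply/negP => /coset_quad_eq; rewrite -zE coset1 => z1.
  by rewrite z1 // order1 in oz.
have /allP/(_ (q u)) := quads_order2T.
rewrite mem_filter u2 u1 S_quads // => /(_ isT); set C := filter _ _.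
move=> /hasP[c Cc /hasP[s Cs dcs]].
have [c' Sc cE] : exists2 c', c' \in S & q c' = c.
  by apply: quads_S; move: Cc; rewrite mem_filter => /andP[].
have [s' Ss sE] : exists2 s', s' \in S & q s' = s.
  by apply: quads_S; move: Cs; rewrite mem_filter => /andP[].
apply: (@quads_dihedral8 4 _ C c' s') => //; rewrite ?cE ?sE //; first exact: subsetIl.
move=> g Sg; rewrite inE coset_PSL //= mem_filter S_quads // andbT.
rewrite -!qM; apply/cent1P/idP => [e|/(coset_quad_eq (groupM Sg Su) (groupM Su Sg)) e].
  by apply/coset_quad_eq; rewrite ?groupM // !cosetM // -zE.
by rewrite /commute zE -!cosetM.
Qed.

Lemma PS_normaliser3 y : y \in PS -> #[y] = 3%N ->
  dihedral8 ('N_(PS)(<[y]>))%G.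
Proof.
move=> Gy oy; have [u Su yE] := PSL_lift Gy.
have u3 : quad_eq (quad_exp (q u) 3) quad_one.
  rewrite -qX -q1; apply/coset_quad_eq; rewrite ?groupX //.
  by rewrite cosetX // -yE coset1 -oy expg_order.
have y1 : y != 1 by rewrite -order_eq1 oy.
have u1 : ~~ quad_eq (q u) quad_one.
  apply: contra y1; rewrite -q1 => /coset_quad_eq; rewrite -yE coset1 => yE1.
  by rewrite yE1.
have /allP/(_ (q u)) := quads_order3T.
rewrite mem_filter u3 u1 S_quads // => /(_ isT); set C := filter _ _.
move=> /hasP[s Cs dcs].
have [s' Ss sE] : exists2 s', s' \in S & q s' = s.
  by apply: quads_S; move: Cs; rewrite mem_filter => /andP[].
have CE (g : gT) : g \in S -> (coset Z g \in 'N_(PS)(<[y]>)) = (q g \in C).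
  move=> Sg; rewrite inE coset_PSL //= mem_filter S_quads // andbT.
  rewrite -!qM; apply/idP/orP.
    move=> /normP Ny; have : y ^ coset Z g \in <[y]> by rewrite -Ny memJ_conjg cycle_id.
    (* The conjugate of [y] is a power with exponent below 3. Exponent 0 would make [y] trivial;
       exponents 1 and 2 are the two alternatives in [C]. *)
    move=> /cyclePmin[k]; rewrite oy conjgE => ltk3 /(canRL (mulKVg _)).
    case: k ltk3 => [|[|[|k]]] // _ e.
    - by case/eqP: y1; apply: (mulIg (coset Z g)); rewrite e expg0 mulg1 mul1g.
    - by left; apply/coset_quad_eq; rewrite ?groupM // !cosetM // -yE e.
    - by right; apply/coset_quad_eq; rewrite ?groupM // !cosetM ?groupM // -yE e.
  move=> yg; rewrite inE -cycleJ cycle_subG.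
  suff [->|->] : y ^ coset Z g = y \/ y ^ coset Z g = y ^+ 2 by rewrite ?cycle_id ?mem_cycle.
  case: yg => /coset_quad_eq e; [left | right]; rewrite conjgE yE -cosetM // e ?groupM //.
    by rewrite cosetM // mulKg.
  by rewrite !cosetM ?groupM // mulKg.
apply: (@quads_dihedral8 3 _ C u s') => //; rewrite ?sE //; first exact: subsetIl.
by rewrite mem_filter S_quads // andbT -qM /quad_eq eqxx.
Qed.

Lemma PS_conj7 x : x \in PS -> #[x] = 7%N ->
  exists2 g, g \in PS & x ^ g = x ^+ 2.
Proof.
move=> Gx ox; have [u Su xE] := PSL_lift Gx.
have u7 : quad_eq (quad_exp (q u) 7) quad_one.
  rewrite -qX -q1; apply/coset_quad_eq; rewrite ?groupX //.
  by rewrite cosetX // -xE coset1 -ox expg_order.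
have u1 : ~~ quad_eq (q u) quad_one.
  rewrite -q1; apply/negP => /coset_quad_eq; rewrite -xE coset1 => x1.
  by rewrite x1 // order1 in ox.
have /allP/(_ (q u)) := quads_order7T.
rewrite mem_filter u7 u1 S_quads // => /(_ isT)/hasP[g /quads_S[v Sv <-]].
rewrite -!qM => /coset_quad_eq e; exists (coset Z v); first exact: coset_PSL.
by rewrite conjgE xE -cosetM ?e ?groupM // !cosetM ?groupM // mulKg.
Qed.

End CentralQuotient.

Section PSL27.
Local Open Scope group_scope.
Local Notation SL27 := (SL 2 'F_7).

Definition gl_quad (u : {'GL_2['F_7]}) := mx_quad (GLval u).

Let gl_quadM u v : gl_quad (u * v) = quad_mul (gl_quad u) (gl_quad v).
Proof. exact: mx_quadM. Qed.

Let gl_quad1 : gl_quad 1 = quad_one.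
Proof. exact: mx_quad1. Qed.

Let gl_quad_inj : injective gl_quad.
Proof. by move=> u v /(can_inj mx_quadK) e; apply: val_inj. Qed.

Let SL_quads u : u \in SL27 -> gl_quad u \in quads.
Proof. by rewrite inE => /eqP /quads_mx. Qed.

Let quads_SL p : p \in quads -> exists2 u, u \in SL27 & gl_quad u = p.
Proof.
move=> /mem_quads[pK dp].
have up : quad_mx p \in unitmx by rewrite unitmxE dp unitr1.
exists (FinRing.unit _ up : {'GL_2['F_7]}); last exact: pK.
by rewrite inE; apply/eqP.
Qed.

Lemma PSL27_card : (#|PSL 2 'F_7| %| 168)%N.
Proof. exact: (card_PS gl_quadM gl_quad1 gl_quad_inj SL_quads quads_SL). Qed.

Lemma PSL27_centraliser2 z : z \in PSL 2 'F_7 -> #[z] = 2%N ->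
  dihedral8 ('C_(PSL 2 'F_7)[z])%G.
Proof. exact: (PS_centraliser2 gl_quadM gl_quad1 gl_quad_inj SL_quads quads_SL). Qed.

Lemma PSL27_normaliser3 y : y \in PSL 2 'F_7 -> #[y] = 3%N ->
  dihedral8 ('N_(PSL 2 'F_7)(<[y]>))%G.
Proof. exact: (PS_normaliser3 gl_quadM gl_quad1 gl_quad_inj SL_quads quads_SL). Qed.

Lemma PSL27_conj7 x : x \in PSL 2 'F_7 -> #[x] = 7%N ->
  exists2 g, g \in PSL 2 'F_7 & x ^ g = x ^+ 2.
Proof. exact: (PS_conj7 gl_quadM gl_quad1 gl_quad_inj SL_quads quads_SL). Qed.

End PSL27.

From mathcomp Require Import boolp classical_sets functions mpoly ring.
Local Open Scope classical_set_scope.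

(** * Completions *)

Section IdealPowers.
Variables (A : comNzRingType) (m : set A).

Lemma ideal_pow_0 (a : A) : ideal_pow m 0 a.
Proof.
by exists 1%N, (fun=> a), (fun _ _ => 0); split=> [i []//|]; rewrite big_ord1 big_ord0 mulr1.
Qed.

Lemma ideal_powS k (a b : A) : m a -> ideal_pow m k b -> ideal_pow m k.+1 (a * b).
Proof.
move=> ma [N [c [x [mx ->]]]].
exists N, c, (fun i j => if unlift ord0 j is Some j' then x i j' else a); split.
  by move=> i j; case: unliftP.
rewrite mulr_sumr; apply: eq_bigr => i _.
rewrite big_ord_recl unlift_none mulrCA; congr (_ * (_ * _)).
by apply: eq_bigr => j _; rewrite liftK.
Qed.

(** Hides the explicit families of coefficients and factors in [ideal_pow] behind products and
    sums. *)
Lemma ideal_pow_ind (P : nat -> A -> Prop) : m 0 ->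
  (forall a, P 0%N a) ->
  (forall k a b, m a -> P k b -> P k.+1 (a * b)) ->
  (forall k a b, P k a -> P k b -> P k (a + b)) ->
  forall k a, ideal_pow m k a -> P k a.
Proof.
move=> m0 P0 PM PD k _ [N [c [x [mx ->]]]].
apply: (big_ind (P k)) => [|a b|i _]; [|exact: PD|].
  (* The empty sum: 0 is reached at level [k] as a product of [k] factors equal to 0. *)
  by clear x mx; elim: k => [|k IHk] //; rewrite -(mul0r 0); apply: PM.
move: (x i) (mx i) => {x mx}; elim: k => [y _ //|k IHk y my].
by rewrite big_ord_recl mulrCA; apply: PM => //; apply: IHk => j; apply: my.
Qed.

Lemma ideal_pow_le j k a : (j <= k)%N -> ideal_pow m k a -> ideal_pow m j a.
Proof.
move=> /subnKC <- [N [c [x [mx ->]]]].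
exists N, (fun i => c i * \prod_(l < k - j) x i (rshift j l)),
  (fun i l => x i (lshift (k - j) l)); split=> //.
by apply: eq_bigr => i _; rewrite big_split_ord /= -mulrA; congr (_ * _); rewrite mulrC.
Qed.

End IdealPowers.

Lemma ideal_pow_morph (A B : comNzRingType) (m : set A) (n : set B)
    (phi : {additive A -> B}) k a :
  monoid_morphism phi -> (forall x, m x -> n (phi x)) ->
  ideal_pow m k a -> ideal_pow n k (phi a).
Proof.
move=> [phi1 phiM] mn [N [c [x [mx ->]]]].
exists N, (fun i => phi (c i)), (fun i j => phi (x i j)); split.
  by move=> i j; apply/mn.
rewrite raddf_sum; apply: eq_bigr => i _; rewrite phiM; congr (_ * _).
exact: (big_morph phi phiM phi1).
Qed.

Section CompletionMorphism.
Variables (K : comNzRingType) (A B : comAlgType K) (m : set A) (n : set B).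
Variable phi : {linear A -> B}.
Hypothesis phiM : monoid_morphism phi.
Hypothesis phi_m : forall x, m x -> n (phi x).

Lemma coherent_comp (a : nat -> A) : coherent m a -> coherent n (phi \o a).
Proof.
move=> ca k; rewrite /= -raddfB.
exact: ideal_pow_morph phiM phi_m (ca k).
Qed.

Definition completion_map (c : completion m) : completion n :=
  @sq_class _ _ _ (completion_data n) _ (coherent_comp (sq_repr_sub c)).

Lemma completion_mapE a (ca : coherent m a) :
  completion_map (@sq_class _ _ _ (completion_data m) a ca) =
  @sq_class _ _ _ (completion_data n) _ (coherent_comp ca).
Proof.
apply/sq_classP => k; have := @sq_class_repr _ _ _ (completion_data m) a ca k.
by move=> /(ideal_pow_morph phiM phi_m); rewrite -[(_ - a) k]/(_ k - a k) raddfB.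
Qed.

Fact completion_map_linear : linear completion_map.
Proof.
move=> k; elim/sq_ind => a ca; elim/sq_ind => b cb.
have -> : k *: @sq_class _ _ _ (completion_data m) a ca + @sq_class _ _ _ (completion_data m) b cb
   = sq_class (sq_subD (sq_subZ k ca) cb).
  by rewrite -sq_addE -sq_scaleE.
rewrite !completion_mapE /GRing.scale /GRing.add /= sq_scaleE sq_addE.
by apply/sq_class_eq/funext => i /=; rewrite linearP.
Qed.
HB.instance Definition _ :=
  GRing.isLinear.Build K (completion m) (completion n) _ completion_map
    completion_map_linear.

Lemma completion_map_monoid : monoid_morphism completion_map.
Proof.
split=> [|]; last first.
  elim/sq_ind => a ca; elim/sq_ind => b cb.
  rewrite /GRing.mul /= sq_mulE !completion_mapE sq_mulE.
  by apply/sq_class_eq/funext => i /=; rewrite phiM.2.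
rewrite /GRing.one /= completion_mapE.
by apply/sq_class_eq/funext => i /=; rewrite phiM.1.
Qed.

Hypothesis phi_inj : forall k, exists j, forall a,
  ideal_pow n j (phi a) -> ideal_pow m k a.
Hypothesis phi_surj : forall b k, exists a, ideal_pow n k (b - phi a).

(** [phi_inj] says that the topology of [A] is the one induced by [B], and [phi_surj] that the image
    of [phi] is dense. Such a map induces a bijection of completions without being bijective
    itself. *)
Lemma completions_isomorphic_morph : completions_isomorphic m n.
Proof.
exists completion_map; split; first exact: completion_map_monoid.
suff [inj surj] : injective completion_map /\ forall d, exists c, completion_map c = d.
  pose g d := projT1 (cid (surj d)).
  have gK d : completion_map (g d) = d by rewrite /g; case: cid.
  by exists g => // c; apply: inj; rewrite gK.
have [J phiJ] := choice phi_inj.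
(* The sum makes [j] monotone and at least [J k]; the summand [k] makes it at least [k]. *)
pose j k := (k + \sum_(i < k.+1) J i)%N.
have jP k a : ideal_pow n (j k) (phi a) -> ideal_pow m k a.
  move=> /ideal_pow_le H; apply: phiJ; apply: H.
  by rewrite /j big_ord_recr /= addnA leq_addl.
have j_mono k : (j k <= j k.+1)%N
  by rewrite /j [in leqRHS]big_ord_recr /= addSn leqW // leq_add2l leq_addr.
have le_j k : (k <= j k)%N by rewrite leq_addr.
have coh_le (C : comAlgType K) (l : set C) a i i' : coherent l a -> (i <= i')%N ->
  ideal_pow l i (a i' - a i).
  move=> ca /subnKC <-; elim: (i' - i)%N => [|d IHd].
    by rewrite addn0 subrr; apply: ideal_pow0.
  have -> : a (i + d.+1)%N - a i = (a (i + d).+1 - a (i + d)%N) + (a (i + d)%N - a i).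
    by rewrite addnS addrA subrK.
  by apply: ideal_powD => //; apply: ideal_pow_le (ca _); apply: leq_addr.
split.
  move=> c d /eqP; rewrite -subr_eq0 => /eqP e; apply/eqP; rewrite -subr_eq0; apply/eqP.
  move: e; rewrite -raddfB /=; move: (c - d); elim/sq_ind => a ca.
  rewrite completion_mapE => /sq_classP; rewrite subr0 => na.
  apply/sq_classP; rewrite subr0 => k.
  have ka : ideal_pow m k (a (j k)) by apply: jP; apply: na.
  rewrite -[a k](subKr (a (j k))); apply: ideal_powB => //.
  exact: coh_le.
elim/sq_ind => b cb.
(* Approximation to order [j k] instead of [k] is what allows [jP] to turn the coherence of [b] into
   that of [a]. *)
have /choice[a aP] : forall k, exists x, ideal_pow n (j k) (b (j k) - phi x).
  by move=> k; apply: phi_surj.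
have ca : coherent m a.
  move=> k; apply: jP; rewrite raddfB /=.
  have -> : phi (a k.+1) - phi (a k) = (b (j k.+1) - b (j k)) +
      ((b (j k) - phi (a k)) - (b (j k.+1) - phi (a k.+1))).
    ring.
  apply: ideal_powD; first exact: coh_le.
  by apply: ideal_powB => //; apply: ideal_pow_le (aP _).
exists (@sq_class _ _ _ (completion_data m) a ca).
rewrite completion_mapE; apply/sq_classP => k.
rewrite -[(_ - _) k]/(phi (a k) - b k).
have -> : phi (a k) - b k = (b (j k) - b k) - (b (j k) - phi (a k)) by ring.
apply: ideal_powB; first exact: coh_le.
exact: ideal_pow_le (aP k).
Qed.

End CompletionMorphism.

Lemma completions_isomorphic_sym (K : comNzRingType) (A B : comAlgType K)
    (m : set A) (n : set B) :
  completions_isomorphic m n -> completions_isomorphic n m.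
Proof.
move=> [f [[f1 fM] [g fK gK]]].
have g_lin : linear g.
  by move=> k x y; apply: (can_inj fK); rewrite linearP !gK.
pose gL := GRing.isLinear.Build K (completion n) (completion m) _ g g_lin.
exists (HB.pack_for {linear completion n -> completion m} g gL); split; last by exists f.
split=> [|x y] /=; apply: (can_inj fK); first by rewrite gK f1.
by rewrite fM !gK.
Qed.

Lemma completions_isomorphic_trans (K : comNzRingType) (A B C : comAlgType K)
    (m : set A) (n : set B) (l : set C) :
  completions_isomorphic m n -> completions_isomorphic n l ->
  completions_isomorphic m l.
Proof.
move=> [f [[f1 fM] fB]] [g [[g1 gM] gB]].
exists (g \o f : {linear _ -> _}); split; last exact: bij_comp.
by split=> [|x y] /=; rewrite ?f1 ?fM.
Qed.

(** * Germs of regular functions *)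

Section FunctionPowers.
Variables (K : comNzRingType) (T : Type).

(* Sums of products of k elements of M and one of C, as functions on U. *)
Inductive pow_on (U : set T) (C M : set (T -> K)) : nat -> (T -> K) -> Prop :=
| pow_on0 f : C f -> pow_on U C M 0 f
| pow_onS k a f : M a -> pow_on U C M k f -> pow_on U C M k.+1 (a \* f)
| pow_onD k f g : pow_on U C M k f -> pow_on U C M k g -> pow_on U C M k (f \+ g)
| pow_on_ext k f g : (forall x, U x -> f x = g x) ->
    pow_on U C M k f -> pow_on U C M k g.

Lemma pow_on_sub (U V : set T) (C D M N : set (T -> K)) k f :
  V `<=` U -> C `<=` D -> M `<=` N -> pow_on U C M k f -> pow_on V D N k f.
Proof.
move=> VU CD MN; elim=> {k f} [f /CD|k a f /MN Na _ Df|k f g _ Df _ Dg|k f g fg _ Df].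
- exact: pow_on0.
- exact: pow_onS.
- exact: pow_onD.
- by apply: pow_on_ext Df => x /VU /fg.
Qed.

Lemma pow_on_mul (U : set T) (C M : set (T -> K)) k f g :
  (forall f g, C f -> C g -> C (f \* g)) -> C f -> pow_on U C M k g ->
  pow_on U C M k (f \* g).
Proof.
move=> CM Cf; elim=> {k g} [g Cg|k a g Na _ Dg|k g h _ Dg _ Dh|k g h fg _ Dg].
- exact/pow_on0/CM.
- apply: (pow_on_ext (f := a \* (f \* g))); first by move=> x _ /=; rewrite mulrCA.
  exact: pow_onS.
- apply: (pow_on_ext (f := (f \* g) \+ (f \* h))); first by move=> x _ /=; rewrite mulrDr.
  exact: pow_onD.
- by apply: pow_on_ext Dg => x Ux /=; rewrite fg.
Qed.

Lemma pow_on_exp (U : set T) (C M : set (T -> K)) k a f :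
  M a -> C f -> pow_on U C M k (fun x => a x ^+ k * f x).
Proof.
move=> Ma Cf; elim: k => [|k IHk].
  by apply: (pow_on_ext (f := f)); [move=> x _; rewrite mul1r | apply: pow_on0].
by apply: pow_on_ext (pow_onS Ma IHk) => x _ /=; rewrite exprS mulrA.
Qed.

Lemma pow_on_zero (U : set T) (C M : set (T -> K)) k :
  C (fun=> 0) -> M (fun=> 0) -> pow_on U C M k (fun=> 0).
Proof.
move=> C0 M0; elim: k => [|k IHk]; first exact: pow_on0.
by apply: (pow_on_ext (f := (fun=> 0) \* (fun=> 0))); [move=> x _ /=;
  rewrite mul0r | apply: pow_onS].
Qed.

Lemma pow_on_sum (U : set T) (C M : set (T ->
  K)) k (I : Type) (r : seq I) (P : pred I) (F : I -> T -> K) :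
  C (fun=> 0) -> M (fun=> 0) -> (forall i, P i -> pow_on U C M k (F i)) ->
  pow_on U C M k (fun x => \sum_(i <- r | P i) F i x).
Proof.
move=> C0 M0 PF; elim: r => [|i r IHr].
  by apply: pow_on_ext (pow_on_zero U k C0 M0) => x _; rewrite big_nil.
have [Pi|nPi] := boolP (P i); last first.
  by apply: pow_on_ext IHr => x _; rewrite big_cons (negPf nPi).
apply: pow_on_ext (pow_onD (PF i Pi) IHr) => x _ /=.
by rewrite big_cons Pi.
Qed.

End FunctionPowers.

Lemma pow_on_comp (K : comNzRingType) (S T : Type) (h : S -> T) (V : set S) (U : set T)
    (C M : set (T -> K)) (D N : set (S -> K)) k f :
  (forall y, V y -> U (h y)) ->
  (forall f, C f -> D (f \o h)) -> (forall f, M f -> N (f \o h)) ->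
  pow_on U C M k f -> pow_on V D N k (f \o h).
Proof.
move=> VU CD MN; elim=> {k f} [f /CD|k a f /MN Na _ Df|k f g _ Df _ Dg|k f g fg _ Df].
- exact: pow_on0.
- exact: pow_onS.
- exact: pow_onD.
- by apply: pow_on_ext Df => x /VU /fg.
Qed.

Section RegularFunctions.
Variables (K : comNzRingType) (X : fspace K) (U : set X).
Hypothesis oU : fopen U.

Lemma fregular_eq f g : (forall x, f x = g x) -> fregular U f -> fregular U g.
Proof. by move=> fg; apply: fregular_ext => // x _. Qed.

Lemma fregular_const k : fregular U (fun=> k).
Proof. exact: fregular_cst. Qed.

Lemma fregular_sub f g : fregular U f -> fregular U g -> fregular U (fun x => f x - g x).
Proof. exact: fregularB. Qed.

Lemma fregular_opp f : fregular U f -> fregular U (fun x => - f x).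
Proof.
move=> Uf; apply: (fregular_eq (f := fun x => 0 - f x)); first by move=> x; rewrite sub0r.
by apply: fregular_sub => //; apply: fregular_const.
Qed.

Lemma fregular_add f g : fregular U f -> fregular U g -> fregular U (fun x => f x + g x).
Proof.
move=> Uf Ug; apply: (fregular_eq (f := fun x => f x - - g x)); first by move=> x; rewrite opprK.
by apply: fregular_sub => //; apply: fregular_opp.
Qed.

Lemma fregular_mul f g : fregular U f -> fregular U g -> fregular U (fun x => f x * g x).
Proof. exact: fregularM. Qed.

Lemma fregular_exp f n : fregular U f -> fregular U (fun x => f x ^+ n).
Proof.
move=> Uf; elim: n => [|n IHn].
  by apply: fregular_eq (fregular_const 1) => x; rewrite expr0.
by apply: fregular_eq (fregular_mul Uf IHn) => x; rewrite exprS.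
Qed.

Lemma fregular_sum I (r : seq I) (P : pred I) (F : I -> X -> K) :
  (forall i, P i -> fregular U (F i)) ->
  fregular U (fun x => \sum_(i <- r | P i) F i x).
Proof.
move=> UF; elim: r => [|i r IHr].
  by apply: fregular_eq (fregular_const 0) => x; rewrite big_nil.
have [Pi|nPi] := boolP (P i); last first.
  by apply: fregular_eq IHr => x; rewrite big_cons (negPf nPi).
apply: fregular_eq (fregular_add (UF i Pi) IHr) => x.
by rewrite big_cons Pi.
Qed.

End RegularFunctions.

Definition regular_zero (K : comNzRingType) (X : fspace K) (U Z : set X) : set (X -> K) :=
  [set f | fregular U f /\ forall z, Z z -> f z = 0].

Section Germs.
Variables (K : fieldType) (X : fspace K) (x : X).
Implicit Types (U V : set X) (f g : X -> K).

Lemma germ_eq f g (nf : regular_near x f) (ng : regular_near x g) :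
  germ nf = germ ng <-> exists U, [/\ fopen U, U x & forall y, U y -> f y = g y].
Proof.
split=> [/sq_classP[U [oU Ux UB]]|[U [oU Ux UB]]].
  by exists U; split=> // y /UB /eqP; rewrite -[(_ - _) y]/(f y - g y) subr_eq0 => /eqP.
apply/sq_classP; exists U; split=> // y /UB e.
by rewrite -[(_ - _) y]/(f y - g y) e subrr.
Qed.

Lemma germ_ind (P : local_ring x -> Prop) :
  (forall f (nf : regular_near x f), P (germ nf)) -> forall a, P a.
Proof. by move=> H a; apply: (@sq_ind _ _ _ (germ_data x)) => f Sf; apply: H. Qed.

Lemma germD f g (nf : regular_near x f) (ng : regular_near x g)
    (nh : regular_near x (f \+ g)) :
  germ nf + germ ng = germ nh.
Proof.
rewrite [LHS]sq_addE; exact: sq_class_eq.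
Qed.

Lemma germM f g (nf : regular_near x f) (ng : regular_near x g)
    (nh : regular_near x (f \* g)) :
  germ nf * germ ng = germ nh.
Proof.
rewrite [LHS]sq_mulE; exact: sq_class_eq.
Qed.

Lemma germB f g (nf : regular_near x f) (ng : regular_near x g)
    (nh : regular_near x (fun x => f x - g x)) :
  germ nf - germ ng = germ nh.
Proof.
rewrite [- _]sq_oppE [LHS]sq_addE; exact: sq_class_eq.
Qed.

Lemma max_ideal_germ f (nf : regular_near x f) : max_ideal (germ nf) <-> f x = 0.
Proof.
split=> [[g [ng [/germ_eq[U [_ Ux ->]]]]] //|f0].
by exists f, nf.
Qed.

Lemma pow_on_regular U Z k f : fopen U ->
  pow_on U (fregular U) (regular_zero U Z) k f -> fregular U f.
Proof.
move=> oU; elim=> {k f} [//|k a f [ra _] _ rf|k f g _ rf _ rg|k f g fg _ rf].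
- exact: fregular_mul.
- exact: fregular_add.
- exact: fregular_ext rf.
Qed.

Lemma ideal_pow_germ U k f (nf : regular_near x f) : fopen U -> U x ->
  pow_on U (fregular U) (regular_zero U [set x]) k f ->
  ideal_pow (max_ideal (x := x)) k (germ nf).
Proof.
move=> oU Ux Uf; move: nf; have near g : fregular U g -> regular_near x g by exists U.
elim: Uf => {k f} [f _ nf|k a f [ra a0] /(pow_on_regular oU)/near nf IHf naf|
  k f g /(pow_on_regular oU)/near nf IHf /(pow_on_regular oU)/near ng IHg nfg|
  k f g fg /(pow_on_regular oU)/near nf IHf ng].
- exact: ideal_pow_0.
- have na := near a ra; rewrite -(germM na nf).
  by apply/ideal_powS/IHf/max_ideal_germ/a0.
- by rewrite -(germD nf ng); apply: ideal_powD.
- by rewrite -(_ : germ nf = germ ng) //; apply/germ_eq; exists U.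
Qed.

Lemma regular_near0 : regular_near x (fun=> 0).
Proof. by exists setT; split; [exact: fopenT | | exact: (fregular_cst 0 (fopenT X))]. Qed.

(** Converse of [ideal_pow_germ]. An element of the power involves finitely many germs, so one
    neighbourhood serves for all the representatives, and shrinking it is harmless. *)
Lemma germ_ideal_pow k f (nf : regular_near x f) :
  ideal_pow (max_ideal (x := x)) k (germ nf) ->
  exists U, [/\ fopen U, U x & pow_on U (fregular U) (regular_zero U [set x]) k f].
Proof.
move=> pf; suff H : forall a, ideal_pow (max_ideal (x := x)) k a ->
  forall g (ng : regular_near x g), a = germ ng ->
  exists U, [/\ fopen U, U x & pow_on U (fregular U) (regular_zero U [set x]) k g]
    by exact: H pf _ _ _.
have powS (U V : set X) j g : fopen U -> fopen V -> V `<=` U ->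
    pow_on U (fregular U) (regular_zero U [set x]) j g ->
    pow_on V (fregular V) (regular_zero V [set x]) j g.
  move=> oU oV VU; apply: pow_on_sub => // [h|h [rh h0]]; first exact: fregularS.
  by split=> //; apply: fregularS rh.
apply: (@ideal_pow_ind _ _ (fun j a => forall g (ng : regular_near x g), a = germ ng ->
  exists U, [/\ fopen U, U x & pow_on U (fregular U) (regular_zero U [set x]) j g]))
  => [|a g [U [oU Ux Ug]] _|j a b [h [nh [-> h0]]] IHb g ng e|j a b IHa IHb g ng e].
- exists (fun=> 0), regular_near0; split=> //.
  by apply/germ_eq; exists setT; split=> //; apply: fopenT.
- by exists U; split=> //; apply: pow_on0.
- elim/germ_ind: b IHb e => b nb /(_ b nb erefl)[U [oU Ux Ub]].
  have [V [oV Vx Vh]] := nh.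
  have oUV := fopenI oU oV.
  have UVh : pow_on (U `&` V) (fregular (U `&` V)) (regular_zero (U `&` V) [set x]) j.+1 (h \* b).
    apply: pow_onS; last exact: powS Ub.
    by split; [apply: fregularS Vh => // y []|move=> _ ->].
  have nhb : regular_near x (h \* b).
    by exists (U `&` V); split=> //; apply: pow_on_regular UVh.
  rewrite (germM nh nb nhb) => /germ_eq[W [oW Wx We]].
  have oUVW := fopenI oUV oW.
  exists (U `&` V `&` W); split=> //.
  apply: (pow_on_ext (f := h \* b)); first by move=> y [_ /We].
  by apply: powS UVh => // y [].
- elim/germ_ind: a IHa e => a na /(_ a na erefl)[U [oU Ux Ua]].
  elim/germ_ind: b IHb => b nb /(_ b nb erefl)[V [oV Vx Vb]].
  have oUV := fopenI oU oV.
  have UVh : pow_on (U `&` V) (fregular (U `&` V)) (regular_zero (U `&` V) [set x]) j (a \+ b).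
    by apply: pow_onD; [apply: powS Ua => // y [] | apply: powS Vb => // y []].
  have nab : regular_near x (a \+ b).
    by exists (U `&` V); split=> //; apply: pow_on_regular UVh.
  rewrite (germD na nb nab) => /germ_eq[W [oW Wx We]].
  have oUVW := fopenI oUV oW.
  exists (U `&` V `&` W); split=> //.
  apply: (pow_on_ext (f := a \+ b)); first by move=> y [_ /We].
  by apply: powS UVh => // y [].
Qed.

End Germs.

(** * Quotients by finite groups *)

Section Polarization.
Variables (K : numFieldType) (T : Type) (I J : set (T -> K)).
Hypothesis I0 : I (fun=> 0).
Hypothesis I_add : forall f g, I f -> I g -> I (fun x => f x + g x).
Hypothesis I_scale : forall c f, I f -> I (fun x => c * f x).
Hypothesis J0 : J (fun=> 0).
Hypothesis J_add : forall f g, J f -> J g -> J (fun x => f x + g x).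
Hypothesis J_scale : forall c f, J f -> J (fun x => c * f x).

Lemma I_sum n (F : 'I_n -> T -> K) : (forall i, I (F i)) -> I (fun x => \sum_i F i x).
Proof.
elim: n F => [|n IHn] F IF.
  by move: I0; congr I; apply/funext => x; rewrite big_ord0.
have := I_add (IF ord0) (IHn _ (fun i => IF (lift ord0 i))).
by congr I; apply/funext => x; rewrite big_ord_recl.
Qed.

(* [q (2 t) - 2 ^ n * q t] kills the top coefficient of [q]. *)
Lemma coef_in_of_horner_in n (a : nat -> T -> K) :
  (forall t, I (fun x => \sum_(j < n) t ^+ j * a j x)) ->
  forall j, (j < n)%N -> I (a j).
Proof.
elim: n a => [//|n IHn] a Ia.
have lo j : (j < n)%N -> I (a j).
  move=> jn; pose b j x := (2 ^+ j - 2 ^+ n) * a j x.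
  have Ib : I (b j).
    apply: IHn jn => t.
    have := I_add (Ia (2 * t)) (I_scale (- 2 ^+ n) (Ia t)).
    congr I; apply/funext => x; rewrite !big_ord_recr /= !exprMn mulrDr !mulr_sumr.
    rewrite addrACA -big_split /= mulNr !mulrA subrr addr0.
    by apply: eq_bigr => i _; rewrite exprMn /b; ring.
  have := I_scale (2 ^+ j - 2 ^+ n)^-1 Ib; congr I; apply/funext => x.
  rewrite /b mulKf // subr_eq0 -!natrX eqr_nat eqn_exp2l //; by rewrite ltn_eqF.
move=> j; rewrite ltnS leq_eqVlt => /predU1P[->|/lo//].
have Is : I (fun x => \sum_(j < n) (- 1) * a j x).
  by apply: I_sum => i; apply/I_scale/lo.
have := I_add (Ia 1) Is; congr I; apply/funext => x.
rewrite big_ord_recr /= expr1n mul1r addrAC -big_split big1 ?add0r //= => i _.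
by rewrite expr1n mul1r mulN1r subrr.
Qed.

(** Polarization: the factors of [x ^+ N] are replaced one at a time by members of [s]. The
    coefficient of t in (x + t b)^(n+1) is (n+1) x^n b; it stays in [I] by [coef_in_of_horner_in],
    and n + 1 is invertible. *)
Lemma prod_in_of_exp_in N : (forall x, J x -> I (fun y => x y ^+ N)) ->
  forall s, (forall a, a \in s -> J a) -> size s = N ->
  I (fun y => \prod_(a <- s) a y).
Proof.
move=> JN s Js sN.
suff: forall x, J x -> I (fun y => x y ^+ (N - size s) * \prod_(a <- s) a y).
  move=> /(_ _ J0); congr I; apply/funext => y; by rewrite sN subnn mul1r.
have : (size s <= N)%N by rewrite sN.
elim: s {sN} Js => [|b s IHs] Js ltsN x Jx.
  by have := JN x Jx; congr I; apply/funext => y; rewrite big_nil mulr1 subn0.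
have Jb : J b by apply: Js; rewrite mem_head.
have {}IHs := IHs (fun a sa => Js a (mem_behead (s := b :: s) sa)) (ltnW ltsN).
move: ltsN => /=; set n := (N - (size s).+1)%N => ltsN.
have Nn : (N - size s = n.+1)%N by rewrite /n subnSK.
(* The coefficient of t^i in the expansion of (x + t b)^(n+1), times the factors already
   introduced. *)
pose c i y := 'C(n.+1, i)%:R * (x y ^+ (n.+1 - i) * b y ^+ i * \prod_(a <- s) a y).
have /coef_in_of_horner_in : forall t, I (fun y => \sum_(i < n.+2) t ^+ i * c i y).
  move=> t; have := IHs _ (J_add Jx (J_scale t Jb)); congr I; apply/funext => y.
  rewrite Nn exprDn mulr_suml; apply: eq_bigr => i _.
  by rewrite /c exprMn -mulr_natl; ring.
move=> /(_ 1 isT) /(I_scale (n.+1%:R)^-1); congr I; apply/funext => y.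
rewrite /c bin1 mulKf ?pnatr_eq0 // subn1 expr1 big_cons; ring.
Qed.
End Polarization.

Definition fspace_morph (K : comNzRingType) (X Y : fspace K) (h : X -> Y) :=
  (forall U, fopen U -> fopen (h @^-1` U)) /\
  (forall U f, fopen U -> fregular U f -> fregular (h @^-1` U) (f \o h)).

(** The axioms of [fspace] say nothing on inverses, which are needed to divide by a trace that does
    not vanish at the point. *)
Definition inverse_closed (K : fieldType) (X : fspace K) :=
  forall (U : set X) f, fopen U -> fregular U f ->
    fopen (U `&` [set x | f x != 0]) /\
    fregular (U `&` [set x | f x != 0]) (fun x => (f x)^-1).

Section Invariants.
Variables (K : numFieldType) (X : fspace K) (gT : finGroupType) (G : {group gT}).
Variable to : action G X.
Hypothesis morph_to : forall g, g \in G -> fspace_morph (fun x : X => to x g).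
Implicit Types (U Z : set X) (f : X -> K).

Lemma act_mul x g h : g \in G -> h \in G -> to x (g * h)%g = to (to x g) h.
Proof. by case: to => act [/= _]; apply. Qed.

Lemma act_one x : to x 1%g = x.
Proof.
have [inj _] : is_action G to by case: to.
by apply: (inj 1%g); rewrite -act_mul ?mulg1.
Qed.

Definition act_stable U := forall x g, g \in G -> U x -> U (to x g).

Definition invariant_on U f := forall x g, g \in G -> U x -> f (to x g) = f x.

Definition trace f x := \sum_(g in G) f (to x g).

Lemma stableV U x g : act_stable U -> g \in G -> U (to x g) -> U x.
Proof.
move=> sU Gg /(sU _ _ (groupVr Gg)).
by rewrite -act_mul ?groupV // mulgV act_one.
Qed.

Lemma fregular_act U f g : fopen U -> act_stable U -> g \in G -> fregular U f ->
  fregular U (fun x => f (to x g)).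
Proof.
move=> oU sU Gg Uf; have [Mo Mr] := morph_to Gg.
by apply: fregularS (Mr _ _ oU Uf) => //; [apply: Mo | move=> x /sU; apply].
Qed.

Lemma fregular_trace U f : fopen U -> act_stable U -> fregular U f -> fregular U (trace f).
Proof. by move=> oU sU Uf; apply: fregular_sum => // g Gg; apply: fregular_act. Qed.

Lemma invariant_trace f : invariant_on setT (trace f).
Proof.
move=> x h Gh _; rewrite /trace [RHS](reindex_inj (mulgI h)) /=.
by apply: eq_big => [g|g Gg]; rewrite ?groupMl // act_mul.
Qed.

(** The intersection of the translates of [V], open because [G] is finite. *)
Lemma stable_core V x : fopen V -> (forall g, g \in G -> V (to x g)) ->
  exists U, [/\ fopen U, act_stable U, U x & U `<=` V].
Proof.
move=> oV Vx.
exists [set y | forall g, g \in G -> V (to y g)]; split=> //.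
- suff: forall r : seq gT, (forall g, g \in r -> g \in G) ->
      fopen [set y | forall g, g \in r -> V (to y g)].
    move=> /(_ (enum G)) H; have /H : forall g, g \in enum G -> g \in G by move=> g;
      rewrite mem_enum.
    by congr fopen; apply/seteqP; split=> y Ay g; have := Ay g; rewrite mem_enum.
  elim=> [_|g r IHr Gr].
    rewrite (_ : [set _ | _] = setT); [exact: fopenT|].
    by apply/seteqP; split.
  have [Mo _] := morph_to (Gr g (mem_head _ _)).
  have := fopenI (Mo V oV) (IHr (fun h rh => Gr h (mem_behead (s := g :: r) rh))).
  congr fopen; apply/seteqP; split=> y /= => [[Vg Vr] h|Vr].
    by rewrite in_cons => /predU1P[->|/Vr].
  by split=> [|h rh]; apply: Vr; rewrite in_cons ?eqxx // rh orbT.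
- by move=> y g Gg Vy h Gh; rewrite -act_mul //; apply: Vy; apply: groupM.
- by move=> y /(_ 1%g (group1 _)); rewrite act_one.
Qed.

Section OnStable.
Variables (U Z : set X).
Hypotheses (oU : fopen U) (sU : act_stable U) (sZ : act_stable Z).

Local Notation R := (fregular U).
Local Notation J := (regular_zero U Z).
Local Notation RI := (fregular U `&` invariant_on U).
Local Notation JI := (regular_zero U Z `&` invariant_on U).

(** Up to sign the coefficients are the elementary symmetric functions of the [a]; all but the
    leading one have positive degree, so they vanish with the [a]. *)
Lemma regular_zero_coef (r : seq (X -> K)) : (forall a, a \in r -> J a) ->
  (forall i, R (fun x => (\prod_(a <- r) ('X - (a x)%:P))`_i)) /\
  (forall i, (i < size r)%N -> J (fun x => (\prod_(a <- r) ('X - (a x)%:P))`_i)).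
Proof.
elim: r => [_|b r IHr Jr].
  split=> // i; apply: fregular_ext (fregular_const oU (i == 0%N)%:R) => // x _.
  by rewrite big_nil coef1.
have [rb b0] := Jr b (mem_head _ _).
have [IHR IHJ] := IHr (fun a ra => Jr a (mem_behead (s := b :: r) ra)).
have coefE i x : (\prod_(a <- b :: r) ('X - (a x)%:P))`_i =
    (if i is j.+1 then (\prod_(a <- r) ('X - (a x)%:P))`_j else 0) -
    b x * (\prod_(a <- r) ('X - (a x)%:P))`_i.
  by rewrite big_cons mulrBl coefB coefXM coefCM; case: i.
have rC i : R (fun x => (\prod_(a <- b :: r) ('X - (a x)%:P))`_i).
  apply: (fregular_ext oU (fun x _ => esym (coefE i x))).
  apply: fregular_sub => //; last exact: fregular_mul.
  by case: i => [|i]; [apply: fregular_const | apply: IHR].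
split=> // i /= ir; split=> // z Zz; rewrite coefE b0 // mul0r subr0.
by case: i ir => // i /IHJ[_ ->].
Qed.

(* Each [a] is a root of the orbit polynomial [prod_g (X - g a)]. *)
Lemma exp_card_in a : J a -> pow_on U R JI 1 (fun x => a x ^+ #|G|).
Proof.
move=> [ra a0].
pose P x : {poly K} := \prod_(g in G) ('X - (a (to x g))%:P).
pose r := [seq (fun x => a (to x g)) | g <- enum G].
have PE x : P x = \prod_(b <- r) ('X - (b x)%:P).
  by rewrite big_map big_enum_cond /=; apply: eq_bigl => g; rewrite andbT.
have [] := @regular_zero_coef r.
  move=> b /mapP[g]; rewrite mem_enum => Gg ->; split; first exact: fregular_act.
  by move=> z Zz; rewrite a0 //; apply: sZ.
rewrite size_map -cardE => RP JP.
have szP x : size (P x) = #|G|.+1 by rewrite PE size_prod_XsubC size_map -cardE.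
have PG x : (P x)`_#|G| = 1.
  have /monicP := monic_prod_XsubC r xpredT (fun b => b x).
  by rewrite -PE lead_coefE szP.
have Pa x : (P x).[a x] = 0.
  by rewrite horner_prod (bigD1 1%g) //= act_one hornerXsubC subrr mul0r.
have aE x : a x ^+ #|G| = \sum_(i < #|G|) - (P x)`_i * a x ^+ i.
  have := Pa x; rewrite horner_coef szP big_ord_recr /= PG mul1r addrC => /eqP.
  by rewrite addr_eq0 => /eqP ->; rewrite -sumrN; apply: eq_bigr => i _; rewrite mulNr.
apply: (pow_on_ext (f := fun x => \sum_(i < #|G|) - (P x)`_i * a x ^+ i)).
  by move=> x _; rewrite aE.
have J0 : JI (fun=> 0).
  by split=> //; split=> //; apply: fregular_const.
apply: pow_on_sum => [||i _]; [exact: fregular_const | exact: J0 |].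
apply: (@pow_onS _ _ _ _ _ 0 (fun x => - (P x)`_i) (fun x => a x ^+ i)); last first.
  by apply/pow_on0/fregular_exp.
have [RPi Pi0] := JP i (ltn_ord i); split; first split.
- by apply: fregular_opp => //; apply: fregular_eq RPi => // x; rewrite PE.
- by move=> z Zz; rewrite PE Pi0 // oppr0.
move=> x h Gh _; suff -> : P (to x h) = P x by [].
rewrite /P [RHS](reindex_inj (mulgI h)) /=.
by apply: eq_big => [g|g Gg]; rewrite ?groupMl // act_mul.
Qed.

Lemma pow_on_mulr j k f g : pow_on U R JI j f -> pow_on U R JI k g ->
  pow_on U R JI (j + k) (fun x => f x * g x).
Proof.
move=> Uf Ug; elim: Uf => {j f} [f Rf|j a f Ja _ IH|j f f' _ IH _ IH'|j f f' ff' _ IH].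
- by apply: pow_on_mul => // a b; apply: fregular_mul.
- by apply: pow_on_ext (pow_onS Ja IH) => x _ /=; rewrite mulrA.
- by apply: pow_on_ext (pow_onD IH IH') => x _ /=; rewrite mulrDl.
- by apply: pow_on_ext IH => x Ux; rewrite ff'.
Qed.

(** Exposes [n] of the [n + m] factors as an explicit product, the form to which polarization
    applies. *)
Lemma pow_on_split n m (P : (X -> K) -> Prop) :
  (forall f g, P f -> P g -> P (f \+ g)) ->
  (forall f g, (forall x, U x -> f x = g x) -> P f -> P g) ->
  (forall s g, (forall a, a \in s -> J a) -> size s = n -> pow_on U R J m g ->
     P (fun x => (\prod_(a <- s) a x) * g x)) ->
  forall f, pow_on U R J (n + m) f -> P f.
Proof.
elim: n P => [|n IHn] P PD Pext Pprod f.
  rewrite add0n => /(Pprod [::]) H; apply: Pext (H _ _) => // x _.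
  by rewrite big_nil mul1r.
move Dk : (n.+1 + m)%N => k Uf;
  elim: Uf Dk => {k f} [//|k a f Ja Uf _|k f g _ IHf _ IHg|k f g fg _ IHf] Dk.
- move: Dk; rewrite addSn => -[Dk]; rewrite -Dk in Uf.
  apply: (IHn (fun h => P (a \* h))) Uf => [g h Pg Ph|g h gh|s g Js sn Ug].
  + by apply: Pext (PD _ _ Pg Ph) => x _ /=; rewrite mulrDr.
  + by apply: Pext => x Ux /=; rewrite gh.
  + apply: Pext (Pprod (a :: s) g _ _ Ug) => [x _|b|] /=.
    * by rewrite big_cons mulrA.
    * by rewrite in_cons => /predU1P[->|/Js].
    * by rewrite sn.
- by apply: PD; [apply: IHf | apply: IHg].
- exact: Pext (IHf Dk).
Qed.

(** By [exp_card_in] and polarization, a product of |G| functions vanishing on [Z] lies in the ideal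
    generated by the invariant ones. Each block of |G| factors thus yields one invariant factor; the
    coefficients need not be invariant yet. *)
Lemma pow_on_invariant k f : pow_on U R J (#|G| * k) f -> pow_on U R JI k f.
Proof.
have R0 : R (fun=> 0) by apply: fregular_const.
have J0 : J (fun=> 0) by split.
have JI0 : JI (fun=> 0) by split.
elim: k f => [|k IHk] f.
  by rewrite muln0 => /(pow_on_regular oU); apply: pow_on0.
rewrite mulnS; apply: pow_on_split => [||s g Js sN /IHk Ig];
  [exact: pow_onD | exact: pow_on_ext |].
rewrite -[k.+1]add1n; apply: pow_on_mulr Ig.
apply: (@prod_in_of_exp_in _ _ (pow_on U R JI 1) J) sN => //.
- exact: pow_on_zero.
- by move=> a b; apply: pow_onD.
- move=> c a; apply: (pow_on_mul (f := fun=> c)); last exact: fregular_const.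
  by move=> a' b'; apply: fregular_mul.
- move=> a b [ra a0] [rb b0]; split; first exact: fregular_add.
  by move=> z Zz; rewrite a0 // b0 // addr0.
- move=> c a [ra a0]; split; last by move=> z Zz; rewrite a0 // mulr0.
  by apply: fregular_mul => //; apply: fregular_const.
- by move=> a Ja; apply: exp_card_in.
Qed.

(** The trace is linear over the invariant functions: the factors come out of it and only the
    coefficients are averaged. *)
Lemma pow_on_trace k f : pow_on U R JI k f -> pow_on U RI JI k (trace f).
Proof.
elim=> {k f} [f Rf|k a f Ja _ IH|k f g _ IHf _ IHg|k f g fg _ IH].
- apply: pow_on0; split; first exact: fregular_trace.
  by move=> x g Gg _; apply: invariant_trace.
- apply: pow_on_ext (pow_onS Ja IH) => x Ux /=; rewrite /trace mulr_sumr.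
  by apply: eq_bigr => g Gg /=; rewrite (Ja.2 _ _ Gg Ux).
- by apply: pow_on_ext (pow_onD IHf IHg) => x Ux /=; rewrite /trace -big_split.
- apply: pow_on_ext IH => x Ux; apply: eq_bigr => h Gh; apply: fg; exact: sU.
Qed.

End OnStable.

Local Notation pi := (orbit_proj to).

Lemma orbit_projP x y : pi x = pi y <-> exists2 g, g \in G & y = to x g.
Proof.
split=> [/(congr1 sval) /= e|[g Gg ->]].
  have : orbit_of to y y by exists 1%g; rewrite ?group1 ?act_one.
  by rewrite -e.
have e : orbit_of to x = orbit_of to (to x g).
  apply/seteqP; split=> z [h Gh ->].
    by exists (g^-1 * h)%g; rewrite ?groupM ?groupV // -act_mul ?groupM ?groupV // mulKVg.
  by exists (g * h)%g; rewrite ?groupM // act_mul.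
by apply: eq_exist; exact: e.
Qed.

Lemma orbit_repr_subproof (O : quotient_space to) : exists x, O = pi x.
Proof.
case: O => O [x e]; exists x.
by apply: eq_exist.
Qed.

(** An arbitrary section of the projection; an invariant function descends to the quotient by
    composition with it. *)
Definition orbit_repr (O : quotient_space to) : X := projT1 (cid (orbit_repr_subproof O)).

Lemma orbit_reprK O : pi (orbit_repr O) = O.
Proof. by rewrite /orbit_repr; case: cid. Qed.

Lemma orbit_repr_proj x : exists2 g, g \in G & orbit_repr (pi x) = to x g.
Proof. by apply/orbit_projP; rewrite orbit_reprK. Qed.

Lemma invariant_repr U f x : invariant_on U f -> U x -> f (orbit_repr (pi x)) = f x.
Proof. by move=> If Ux; have [g Gg ->] := orbit_repr_proj x; apply: If. Qed.

Lemma stable_repr U x : act_stable U -> U (orbit_repr (pi x)) <-> U x.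
Proof.
move=> sU; have [g Gg ->] := orbit_repr_proj x.
by split=> [/(stableV sU Gg)|/sU]; last apply.
Qed.

Lemma preimage_repr U : act_stable U -> pi @^-1` (orbit_repr @^-1` U) = U.
Proof. by move=> sU; apply/seteqP; split=> x /(stable_repr x sU). Qed.

Lemma fopen_repr U : fopen U -> act_stable U ->
  @fopen _ (quotient_space to) (orbit_repr @^-1` U).
Proof. by move=> oU sU; rewrite /= preimage_repr. Qed.

Lemma fregular_repr U f : fopen U -> act_stable U -> fregular U f -> invariant_on U f ->
  @fregular _ (quotient_space to) (orbit_repr @^-1` U) (f \o orbit_repr).
Proof.
move=> oU sU Rf If; rewrite /= preimage_repr //.
by apply: fregular_ext Rf => // x Ux /=; rewrite (invariant_repr If).
Qed.

Hypothesis X_inv : inverse_closed X.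

(** The trace of [q] times the pullback of [F] is the trace of [q] times that pullback, and the
    trace of [q] is invertible near [x]. The multiplier [q] confines the hypothesis to the part of
    the orbit where [F] is under control. *)
Lemma ideal_pow_of_trace k x U q (F : quotient_space to -> K)
    (nF : @regular_near _ (quotient_space to) (pi x) F) :
  fopen U -> act_stable U -> U x -> fregular U q -> trace q x != 0 ->
  pow_on U (fregular U) (regular_zero U (orbit_of to x)) (#|G| * k)
    (fun y => q y * F (pi y)) ->
  ideal_pow (@max_ideal _ (quotient_space to) (pi x)) k (germ nF).
Proof.
move=> oU sU Ux Rq qx.
have sZ : act_stable (orbit_of to x).
  by move=> _ h Gh [g Gg ->]; exists (g * h)%g; rewrite ?groupM // act_mul.
move=> /(pow_on_invariant oU sU sZ)/(pow_on_trace oU sU) UF.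
have Rt := fregular_trace oU sU Rq.
have [oV RV] := X_inv oU Rt; set V := _ `&` _ in oV RV.
have It : invariant_on V (trace q) by move=> y g Gg _; apply: invariant_trace.
have sV : act_stable V.
  move=> y g Gg [Uy qy]; split; first exact: sU.
  by move: qy => /=; rewrite invariant_trace.
have VU : V `<=` U by move=> y [].
have VF : pow_on V (fregular V `&` invariant_on V)
    (regular_zero V (orbit_of to x) `&` invariant_on V) k (F \o pi).
  apply: (pow_on_ext (f := (fun y => (trace q y)^-1) \* trace (fun y => q y * F (pi y)))).
    move=> y [Uy qy] /=; rewrite /trace.
    have -> : \sum_(g in G) q (to y g) * F (pi (to y g)) = trace q y * F (pi y).
      rewrite mulr_suml; apply: eq_bigr => g Gg; congr (_ * F _).
      by apply/esym/orbit_projP; exists g.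
    by rewrite mulKf.
  apply: pow_on_mul.
  - move=> f g [Rf If] [Rg Ig]; split; first exact: fregular_mul.
    by move=> y h Gh Vy /=; rewrite If // Ig.
  - by split=> // y g Gg Vy; rewrite It.
  apply: pow_on_sub UF => // f [Rf If]; split.
  - exact: fregularS Rf.
  - by move=> y g Gg /VU; apply: If.
  - by case: Rf => Rf f0; split=> //; apply: fregularS Rf.
  - by move=> y g Gg /VU; apply: If.
have oW : @fopen _ (quotient_space to) (orbit_repr @^-1` V) by rewrite /= preimage_repr.
apply: (@ideal_pow_germ _ (quotient_space to) _ (orbit_repr @^-1` V)) => //.
  by apply/(stable_repr x sV); split.
apply: (pow_on_ext (f := (F \o pi) \o orbit_repr)).
  by move=> O _ /=; rewrite orbit_reprK.
apply: pow_on_comp VF => //.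
- by move=> f [Rf If]; apply: fregular_repr.
- move=> f [[Rf f0] If]; split; first exact: fregular_repr.
  move=> _ -> /=; have [g Gg ->] := orbit_repr_proj x.
  by apply: f0; exists g.
Qed.

End Invariants.

(** * Slices *)

Lemma germZ (K : fieldType) (X : fspace K) (x : X) (k : K) (f : X -> K) (nf : regular_near x f)
    (nh : regular_near x (fun y => k * f y)) :
  k *: germ nf = germ nh.
Proof. by rewrite [LHS]sq_scaleE; apply: sq_class_eq. Qed.

Section Pullback.
Variables (K : fieldType) (X Y : fspace K) (h : X -> Y).
Hypothesis morph_h : fspace_morph h.
Variables (x : X) (y : Y).
Hypothesis hx : h x = y.

Lemma regular_near_comp (f : Y -> K) : regular_near y f -> regular_near x (f \o h).
Proof.
move=> [U [oU Uy Uf]]; have [Mo Mr] := morph_h.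
by exists (h @^-1` U); split; [exact: Mo | rewrite /= hx | exact: Mr].
Qed.

Definition germ_comp (a : local_ring y) : local_ring x :=
  germ (regular_near_comp (sq_repr_sub a)).

Lemma germ_compE f (nf : regular_near y f) : germ_comp (germ nf) = germ (regular_near_comp nf).
Proof.
apply/germ_eq; have [U [oU Uy Ue]] := sq_class_repr (D := germ_data y) nf.
have [Mo _] := morph_h; exists (h @^-1` U).
split; [exact: Mo | by rewrite /= hx |].
move=> z /Ue /eqP; rewrite -[(_ - _) (h z)]/(_ (h z) - f (h z)) subr_eq0 => /eqP.
exact.
Qed.

Fact germ_comp_linear : linear germ_comp.
Proof.
move=> k; elim/germ_ind => f nf; elim/germ_ind => g ng.
have nk : regular_near y (fun z => k * f z) := regular_nearZ k nf.
have nkg : regular_near y ((fun z => k * f z) \+ g) by apply: (@sq_subD _ _ _ (germ_data y)).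
rewrite (germZ nf nk) (germD nk ng nkg) !germ_compE.
rewrite (germZ _ (regular_near_comp nk)) (germD _ _ (regular_near_comp nkg)) //.
Qed.
HB.instance Definition _ :=
  GRing.isLinear.Build K (local_ring y) (local_ring x) _ germ_comp germ_comp_linear.

Lemma germ_comp_monoid : monoid_morphism germ_comp.
Proof.
split=> [|]; last first.
  elim/germ_ind => f nf; elim/germ_ind => g ng.
  rewrite (germM nf ng (regular_nearM nf ng)) !germ_compE.
  by rewrite (germM _ _ (regular_near_comp (regular_nearM nf ng))).
rewrite -[1 in LHS]/(germ (regular_near1 y)) germ_compE.
exact: sq_class_eq.
Qed.

Lemma germ_comp_max_ideal a : max_ideal a -> max_ideal (germ_comp a).
Proof.
elim/germ_ind: a => f nf /max_ideal_germ fy.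
by rewrite germ_compE; apply/max_ideal_germ; rewrite /= hx.
Qed.

End Pullback.

Section QuotientMorphism.
Variables (K : numFieldType) (X Y : fspace K) (gT hT : finGroupType).
Variables (G : {group gT}) (H : {group hT}) (toX : action G X) (toY : action H Y).
Variable psi : Y -> X.
Hypothesis morph_psi : fspace_morph psi.
Hypothesis psi_orbit : forall y h, h \in H ->
  exists2 g, g \in G & psi (toY y h) = toX (psi y) g.

Definition quotient_map (O : quotient_space toY) : quotient_space toX :=
  orbit_proj toX (psi (orbit_repr O)).

Lemma quotient_map_proj y : quotient_map (orbit_proj toY y) = orbit_proj toX (psi y).
Proof.
rewrite /quotient_map; have [h Hh ->] := orbit_repr_proj toY y.
have [g Gg ->] := psi_orbit y Hh.
by apply/esym/orbit_projP; exists g.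
Qed.

Lemma quotient_map_morph : fspace_morph quotient_map.
Proof.
have [Mo Mr] := morph_psi.
have e U : orbit_proj toY @^-1` (quotient_map @^-1` U) = psi @^-1` (orbit_proj toX @^-1` U).
  by apply/seteqP; split=> y; rewrite /= quotient_map_proj.
split=> [U /= oU|U f oU /= Rf]; first by rewrite e; apply: Mo.
rewrite e; apply: fregular_ext (Mr _ _ oU Rf); first exact: Mo.
by move=> y _ /=; rewrite quotient_map_proj.
Qed.

End QuotientMorphism.

Section Slice.
Variables (K : numFieldType) (X Y : fspace K) (gT : finGroupType).
Variables (G H : {group gT}) (toX : action G X) (toY : action H Y).
Hypothesis morph_toX : forall g, g \in G -> fspace_morph (fun x : X => toX x g).
Hypothesis morph_toY : forall g, g \in H -> fspace_morph (fun y : Y => toY y g).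
Hypotheses (X_inv : inverse_closed X) (Y_inv : inverse_closed Y).
Hypothesis sHG : H \subset G.
Variable psi : Y -> X.
Hypothesis morph_psi : fspace_morph psi.
Hypothesis psi_equiv : forall y h, h \in H -> psi (toY y h) = toX (psi y) h.
Variable y0 : Y.
Hypothesis y0_fix : forall h, h \in H -> toY y0 h = y0.

(* F extends e f, where e is 1 at psi y0 and 0 at the rest of its G-orbit: f need not
   make sense near the other points of the orbit, nor on the whole of U. *)
Definition slice_ext (V : set Y) (f : Y -> K) (U : set X) (e F : X -> K) :=
  [/\ fopen U, (forall g, g \in G -> U (toX (psi y0) g)), fregular U e & fregular U F] /\
  [/\ e (psi y0) = 1,
      (forall g, g \in G -> g \notin H -> e (toX (psi y0) g) = 0),
      (forall y, U (psi y) -> F (psi y) = e (psi y) * f y),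
      (forall y, U (psi y) -> ~ V y -> e (psi y) = 0) &
      (forall x, U x -> (forall y, psi y <> x) -> e x = 0 /\ F x = 0)].

Hypothesis ext : forall V f, fopen V -> V y0 -> fregular V f ->
  exists U e F, slice_ext V f U e F.

Local Notation pX := (orbit_proj toX).
Local Notation pY := (orbit_proj toY).

(** The orbit has three kinds of points: [psi y0] itself, where [f] vanishes; other points in the
    image of [psi], where [e] does; and points outside the image, where [F] is 0 by construction. *)
Lemma slice_ext_zero V f U e F : V y0 -> f y0 = 0 -> slice_ext V f U e F ->
  forall z, orbit_of toX (psi y0) z -> F z = 0.
Proof.
move=> Vy0 f0 [[oU UO Re RF] [e1 e0 Fe eV eX]] _ [g Gg ->].
have [Hg|nHg] := boolP (g \in H).
  by rewrite -psi_equiv // y0_fix // Fe ?f0 ?mulr0 // -[psi y0](act_one toX); apply: UO.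
have [[y ey]|nE] := pselect (exists y, psi y = toX (psi y0) g); last first.
  by apply: (eX _ (UO g Gg) _).2 => y ey; apply: nE; exists y.
by rewrite -ey Fe ?ey ?e0 ?mul0r //; apply: UO.
Qed.

Lemma slice_ext_shrink V f U e F : slice_ext V f U e F ->
  exists U', [/\ slice_ext V f U' e F, act_stable toX U' & U' `<=` U].
Proof.
move=> [[oU UO Re RF] [e1 e0 Fe eV eX]].
have [U' [oU' sU' U'x U'U]] := stable_core morph_toX oU UO.
exists U'; split=> //; split; split=> //.
- by move=> g Gg; apply: sU'.
- exact: fregularS Re.
- exact: fregularS RF.
- by move=> y /U'U; apply: Fe.
- by move=> y /U'U; apply: eV.
- by move=> x /U'U; apply: eX.
Qed.

(** The two multipliers differ, so the extensions are first brought to the common multiplier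
    [e \* e'], as fractions to a common denominator. *)
Lemma slice_extD V f U e F f' U' e' F' :
  slice_ext V f U e F -> slice_ext V f' U' e' F' ->
  slice_ext V (f \+ f') (U `&` U') (e \* e') ((F \* e') \+ (e \* F')).
Proof.
move=> [[oU UO Re RF] [e1 e0 Fe eV eX]] [[oU' UO' Re' RF'] [e1' e0' Fe' eV' eX']].
have oUU := fopenI oU oU'.
have [RSe RSF RSe' RSF'] : [/\ fregular (U `&` U') e, fregular (U `&` U') F,
    fregular (U `&` U') e' & fregular (U `&` U') F'].
  by split; [apply: fregularS Re | apply: fregularS RF | apply: fregularS Re' |
    apply: fregularS RF'] => // x [].
split; split=> //.
- by move=> g Gg; split; [apply: UO | apply: UO'].
- exact: fregular_mul.
- by apply: fregular_add => //; apply: fregular_mul.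
- by rewrite /= e1 e1' mulr1.
- by move=> g Gg nHg; rewrite /= e0 ?mul0r.
- by move=> y [Uy Uy'] /=; rewrite Fe // Fe' //; ring.
- by move=> y [Uy _] nVy /=; rewrite eV ?mul0r.
- move=> x [Ux Ux'] nx /=; have [-> ->] := eX x Ux nx.
  by rewrite !mul0r addr0.
Qed.

Lemma slice_extM V f U e F f' U' e' F' :
  slice_ext V f U e F -> slice_ext V f' U' e' F' ->
  slice_ext V (f \* f') (U `&` U') (e \* e') (F \* F').
Proof.
move=> [[oU UO Re RF] [e1 e0 Fe eV eX]] [[oU' UO' Re' RF'] [e1' e0' Fe' eV' eX']].
have oUU := fopenI oU oU'.
have [RSe RSF RSe' RSF'] : [/\ fregular (U `&` U') e, fregular (U `&` U') F,
    fregular (U `&` U') e' & fregular (U `&` U') F'].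
  by split; [apply: fregularS Re | apply: fregularS RF | apply: fregularS Re' |
    apply: fregularS RF'] => // x [].
split; split=> //.
- by move=> g Gg; split; [apply: UO | apply: UO'].
- exact: fregular_mul.
- exact: fregular_mul.
- by rewrite /= e1 e1' mulr1.
- by move=> g Gg nHg; rewrite /= e0 ?mul0r.
- by move=> y [Uy Uy'] /=; rewrite Fe // Fe' //; ring.
- by move=> y [Uy _] nVy /=; rewrite eV ?mul0r.
- move=> x [Ux Ux'] nx /=; have [-> ->] := eX x Ux nx.
  by rewrite !mul0r.
Qed.

(** The factors are extended separately, each extension of a function vanishing at [y0] vanishes on
    the whole orbit by [slice_ext_zero], and the multipliers are multiplied. *)
Lemma slice_ext_pow V k f : fopen V -> V y0 ->
  pow_on V (fregular V) (regular_zero V [set y0]) k f ->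
  exists U e F, slice_ext V f U e F /\
    pow_on U (fregular U) (regular_zero U (orbit_of toX (psi y0))) k F.
Proof.
move=> oV Vy0.
have powS (U U' : set X) j g : fopen U -> fopen U' -> U' `<=` U ->
    pow_on U (fregular U) (regular_zero U (orbit_of toX (psi y0))) j g ->
    pow_on U' (fregular U') (regular_zero U' (orbit_of toX (psi y0))) j g.
  move=> oU oU' UU; apply: pow_on_sub => // [h|h [rh h0]]; first exact: fregularS.
  by split=> //; apply: fregularS rh.
elim=> {k f} [f Rf|k a f [Ra a0] _ [U [e [F [sE UF]]]]|
  k f f' _ [U [e [F [sE UF]]]] _ [U' [e' [F' [sE' UF']]]]|k f f' ff' _ [U [e [F [sE UF]]]]].
- have [U [e [F sE]]] := ext oV Vy0 Rf; exists U, e, F; split=> //.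
  by apply: pow_on0; case: sE => [[]].
- have [U' [e' [F' sE']]] := ext oV Vy0 Ra.
  exists (U' `&` U), (e' \* e), (F' \* F); split; first exact: slice_extM.
  have [[oU' _ _ RF'] _] := sE'; have [[oU _ _ _] _] := sE.
  have oUU := fopenI oU' oU.
  apply: pow_onS; last by apply: powS UF => // x [].
  split; first by apply: fregularS RF' => // x [].
  by apply: slice_ext_zero sE' => //; apply: a0.
- exists (U `&` U'), (e \* e'), ((F \* e') \+ (e \* F')); split; first exact: slice_extD.
  have [[oU _ Re _] _] := sE; have [[oU' _ Re' _] _] := sE'.
  have oUU := fopenI oU oU'.
  apply: pow_onD.
    apply: (pow_on_ext (f := e' \* F)); first by move=> x _ /=; rewrite mulrC.
    apply: pow_on_mul; first by move=> *; apply: fregular_mul.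
      by apply: fregularS Re' => // x [].
    by apply: powS UF => // x [].
  apply: pow_on_mul; first by move=> *; apply: fregular_mul.
    by apply: fregularS Re => // x [].
  by apply: powS UF' => // x [].
- exists U, e, F; split=> //.
  (* The two functions agree on [V] only, but outside [V] the multiplier is 0 and the same [F]
     serves. *)
  case: sE => [[oU UO Re RF] [e1 e0 Fe eV eX]]; split; split=> // y Uy.
  have [Vy|nVy] := pselect (V y); first by rewrite -ff' // Fe.
  by rewrite Fe // eV // !mul0r.
Qed.

Let psi_orbit y h : h \in H -> exists2 g, g \in G & psi (toY y h) = toX (psi y) g.
Proof. by move=> Hh; exists h; [apply: (fintype.subsetP sHG) | apply: psi_equiv]. Qed.

Let Psi := @quotient_map _ _ _ _ _ G H toX toY psi.
Let Psi_morph : fspace_morph Psi := quotient_map_morph morph_psi psi_orbit.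
Let Psi0 : Psi (pY y0) = pX (psi y0) := quotient_map_proj psi_orbit y0.

(** The extension [F] of the pullback to the slice equals [e] times the pullback to [X], also off
    the image of [psi]. At [psi y0] the trace of [e] is |H|, one for each element of [H], so
    [ideal_pow_of_trace] applies. *)
Lemma slice_injective k (a : @local_ring _ (quotient_space toX) (pX (psi y0))) :
  ideal_pow (@max_ideal _ (quotient_space toY) (pY y0)) (#|G| * k) (germ_comp Psi_morph Psi0 a) ->
  ideal_pow (@max_ideal _ (quotient_space toX) (pX (psi y0))) k a.
Proof.
elim/germ_ind: a => f nf; rewrite germ_compE => /germ_ideal_pow[U [oU Uy UF]].
have : pow_on (pY @^-1` U) (fregular (pY @^-1` U)) (regular_zero (pY @^-1` U) [set y0])
    (#|G| * k) ((f \o Psi) \o pY).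
  apply: pow_on_comp UF => // g [Rg g0]; split=> // _ ->.
  exact: g0.
move=> /(slice_ext_pow oU Uy)[W [e [F [sE WF]]]].
have [W' [sE' sW' W'W]] := slice_ext_shrink sE.
have [[oW _ _ _] _] := sE.
have [[oW' WO Re RF] [e1 e0 Fe eV eX]] := sE'.
have W'x : W' (psi y0) by rewrite -[psi y0](act_one toX); apply: WO.
apply: (ideal_pow_of_trace (U := W') (q := e) morph_toX X_inv) => //.
  suff -> : trace toX e (psi y0) = #|H|%:R by rewrite pnatr_eq0 -lt0n cardG_gt0.
  rewrite /trace (big_setID H) /= (finset.setIidPr sHG) [X in _ + X]big1 ?addr0.
    rewrite -sum1_card natr_sum; apply: eq_bigr => h Hh.
    by rewrite -psi_equiv // y0_fix.
  by move=> g; rewrite inE => /andP[nHg Gg]; apply: e0.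
apply: (pow_on_ext (f := F)); last first.
  apply: pow_on_sub WF => // [h|h [rh h0]]; first exact: fregularS.
  by split=> //; apply: fregularS rh.
move=> x W'x'; have [[y yx]|nE] := pselect (exists y, psi y = x).
  by rewrite -yx Fe ?yx //= /Psi (quotient_map_proj psi_orbit) yx.
by have [|-> ->] := eX x W'x'; [move=> y yx; apply: nE; exists y | rewrite mul0r].
Qed.

Lemma slice_surjective k (b : @local_ring _ (quotient_space toY) (pY y0)) :
  exists a, ideal_pow (@max_ideal _ (quotient_space toY) (pY y0)) k (b - germ_comp Psi_morph
    Psi0 a).
Proof.
elim/germ_ind: b => f nf; have [V' [oV' V'y Vf]] := nf.
pose V := pY @^-1` V'.
have oV : fopen V by [].
have [U0 [e [F0 [+ _]]]] : exists U e F, slice_ext V (f \o pY) U e F /\ True.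
  by have [U [e [F sE]]] := ext oV V'y Vf; exists U, e, F.
move=> /slice_ext_shrink[U [[[oU UO Re RF0] [e1 e0 Fe eV eX]] sU _]].
have Ux : U (psi y0) by rewrite -[psi y0](act_one toX); apply: UO.
(* 1 - (1 - e^(n+1))^n = e^(n+1) S is 1 up to order n at psi y0, and vanishes to order n
   at the rest of its orbit. *)
pose n := (#|H| * k)%N.
pose S x := \sum_(i < n) (1 - e x ^+ n.+1) ^+ i.
(* On the slice [F0] is [e] times the germ, which supplies the last of the n + 1 factors [e]. *)
pose F x := e x ^+ n * (F0 x * S x).
have RS : fregular U S.
  apply: fregular_sum => // i _; apply: fregular_exp => //.
  apply: fregular_sub => //; first exact: fregular_const.
  exact: fregular_exp.
have RF : fregular U F by apply/fregular_mul/fregular_mul => //; apply: fregular_exp.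
have Fpsi y : U (psi y) -> F (psi y) = f (pY y) - f (pY y) * (1 - e (psi y) ^+ n.+1) ^+ n.
  move=> Uy; rewrite /F Fe // /S.
  have : e (psi y) ^+ n.+1 * \sum_(i < n) (1 - e (psi y) ^+ n.+1) ^+ i =
      1 - (1 - e (psi y) ^+ n.+1) ^+ n.
    have := subrX1 (1 - e (psi y) ^+ n.+1) n.
    by rewrite addrAC subrr add0r mulNr => /(congr1 -%R); rewrite opprK opprB.
  move=> E.
  have -> : f (pY y) - f (pY y) * (1 - e (psi y) ^+ n.+1) ^+ n =
      f (pY y) * (1 - (1 - e (psi y) ^+ n.+1) ^+ n) by ring.
  rewrite -E exprS /=; ring.
pose F' x := #|H|%:R^-1 * trace toX F x.
have RF' : fregular U F' by apply: fregular_mul; [|exact: fregular_const|exact: fregular_trace].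
have IF' : invariant_on toX setT F'.
  by move=> x g Gg _; rewrite /F' invariant_trace.
have oq : @fopen _ (quotient_space toX) ((@orbit_repr _ _ _ _ toX) @^-1` U)
  by rewrite /= preimage_repr.
have nF' : @regular_near _ (quotient_space toX) (pX (psi y0)) (F' \o (@orbit_repr _ _ _ _ toX)).
  exists ((@orbit_repr _ _ _ _ toX) @^-1` U); split=> //; first by apply/stable_repr.
  by apply: fregular_repr => // x g Gg _; apply: IF'.
exists (germ nF'); rewrite germ_compE.
have nB := regular_nearB nf (regular_near_comp Psi_morph Psi0 nF').
rewrite (germB _ _ nB).
pose W := V `&` psi @^-1` U.
have oW : fopen W by apply: fopenI => //; apply: morph_psi.1.
have sW : act_stable toY W.
  move=> y h Hh [Vy Uy]; split.
    by rewrite /V /= (_ : pY (toY y h) = pY y) //; apply/esym/orbit_projP; exists h.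
  by rewrite /= psi_equiv //; apply: sU => //; apply: (fintype.subsetP sHG).
have Wy : W y0 by split.
have fix_orbit z : orbit_of toY y0 z -> z = y0 by move=> [h Hh ->]; apply: y0_fix.
(* Passing from [Y] to its quotient costs a factor |H|, whence the value of [n]. All functions are
   now defined on the slice, and the multiplier is 1. *)
apply: (ideal_pow_of_trace (q := fun=> 1) morph_toY Y_inv nB oW sW Wy).
- exact: fregular_const.
- by rewrite /trace sumr_const pnatr_eq0 -lt0n cardG_gt0.
have RpsiW (g : gT) a : g \in G -> fregular U a -> fregular W (fun y => a (toX (psi y) g)).
  move=> Gg Ra; have := morph_psi.2 _ _ oU (fregular_act morph_toX oU sU Gg Ra).
  by apply: (fregularS (morph_psi.1 _ oU) oW) => y [].
have RfW : fregular W (f \o pY) by apply: (fregularS oV oW _ Vf) => y [].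
have R0 : fregular W (fun=> 0) by apply: fregular_const.
(* [T1] is the error made by an element of [H], [T2] the contribution of an element outside [H].
   Each has an n-th power of a function vanishing at [y0] as a factor. *)
pose T1 h y := (1 - e (toX (psi y) h) ^+ n.+1) ^+ n * f (pY y).
pose T2 g y := e (toX (psi y) g) ^+ n * (F0 (toX (psi y) g) * S (toX (psi y) g)).
apply: (pow_on_ext (f := fun y => (#|H|%:R^-1 * \sum_(h in H) T1 h y) +
     (- #|H|%:R^-1) * \sum_(g in G :\: H) T2 g y)).
  move=> y [Vy Uy]; rewrite mul1r /=.
  rewrite -[RHS]/(f (pY y) - F' (orbit_repr (Psi (pY y)))) /Psi (quotient_map_proj psi_orbit).
  rewrite (invariant_repr IF') // /F' /trace.
  rewrite [\sum_(g in G) F (toX (psi y) g)](big_setID H) /= (finset.setIidPr sHG).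
  have -> : \sum_(g in H) F (toX (psi y) g) = \sum_(g in H) (f (pY y) - T1 g y).
    apply: eq_bigr => h Hh; rewrite -psi_equiv // Fpsi; last first.
      by rewrite psi_equiv //; apply: sU => //; apply: (fintype.subsetP sHG).
    rewrite (_ : pY (toY y h) = pY y); last by apply/esym/orbit_projP; exists h.
    by rewrite /T1 -psi_equiv // [f _ * _ in LHS]mulrC.
  have H0 : #|H|%:R != 0 :> K by rewrite pnatr_eq0 -lt0n cardG_gt0.
  by rewrite sumrB sumr_const -[f _ *+ _]mulr_natl /T2 /F; field.
have J0 : regular_zero W (orbit_of toY y0) (fun=> 0) by split.
apply: pow_on_ext (pow_onD (pow_on_mul _ (fregular_const oW (#|H|%:R^-1)) (pow_on_sum _ R0 J0 _))
   (pow_on_mul _ (fregular_const oW (- #|H|%:R^-1)) (pow_on_sum _ R0 J0 _))) => //.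
- by move=> *; apply: fregular_mul.
- move=> h Hh; apply: pow_on_exp => //; split.
    apply: fregular_sub => //; first exact: fregular_const.
    apply: fregular_exp => //; apply: (RpsiW h) => //.
    exact: (fintype.subsetP sHG).
  by move=> z /fix_orbit->; rewrite -psi_equiv // y0_fix // e1 expr1n subrr.
- by move=> *; apply: fregular_mul.
- move=> g /=; rewrite finset.in_setD => /andP[nHg Gg]; apply: pow_on_exp.
    by split; [apply: (RpsiW g) | move=> z /fix_orbit->; apply: e0].
  by apply: (RpsiW g (fun z => F0 z * S z)) => //; apply: fregular_mul.
Qed.

Lemma slice_completions : completions_isomorphic
  (@max_ideal _ (quotient_space toX) (pX (psi y0)))
  (@max_ideal _ (quotient_space toY) (pY y0)).
Proof.
apply: (completions_isomorphic_morph (phi := germ_comp Psi_morph Psi0)).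
- exact: germ_comp_monoid.
- exact: germ_comp_max_ideal.
- by move=> k; exists (#|G| * k)%N; apply: slice_injective.
- by move=> b k; apply: slice_surjective.
Qed.

End Slice.

(** * Affine and projective space *)

Section PolynomialFunctions.
Variable K : fieldType.
Implicit Types n m d : nat.

(** Polynomials are handled through their values, for which composition and change of coordinates
    need no substitution. *)
Definition polyfun n (f : 'rV[K]_n -> K) := exists p : {mpoly K[n]}, forall v, f v = p.@[v 0].

Definition homfun n d (f : 'rV[K]_n -> K) :=
  exists2 p : {mpoly K[n]}, p \is d.-homog & forall v, f v = p.@[v 0].

Lemma homfun_polyfun n d f : @homfun n d f -> polyfun f.
Proof. by case=> p _; exists p. Qed.

Lemma homfun_ext n d f g : f =1 g -> @homfun n d f -> homfun d g.
Proof. by move=> fg [p hp fp]; exists p => // v; rewrite -fg. Qed.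

Lemma homfun0 n d : @homfun n d (fun=> 0).
Proof. by exists 0; [apply: rpred0 | move=> v; rewrite meval0]. Qed.

Lemma homfun_const n k : @homfun n 0 (fun=> k).
Proof.
exists k%:MP; last by move=> v; rewrite mevalC.
by rewrite -[k%:MP]mulr1 mul_mpolyC; apply/dhomogZ/dhomog1.
Qed.

Lemma homfunD n d f g : @homfun n d f -> homfun d g -> homfun d (fun v => f v + g v).
Proof.
move=> [p hp fp] [q hq gq]; exists (p + q); first exact: rpredD.
by move=> v; rewrite fp gq mevalD.
Qed.

Lemma homfunM n d e f g : @homfun n d f -> homfun e g -> homfun (d + e) (fun v => f v * g v).
Proof.
move=> [p hp fp] [q hq gq]; exists (p * q); first exact: dhomogM.
by move=> v; rewrite fp gq mevalM.
Qed.

Lemma homfunX n d f k : @homfun n d f -> homfun (d * k) (fun v => f v ^+ k).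
Proof.
move=> hf; elim: k => [|k IHk].
  by rewrite muln0; apply: homfun_ext (homfun_const n 1) => v; rewrite expr0.
by rewrite mulnS; apply: homfun_ext (homfunM hf IHk) => v; rewrite exprS.
Qed.

Lemma homfun_sum n d (I : Type) (r : seq I) (P : pred I) (F : I -> 'rV[K]_n -> K) :
  (forall i, P i -> homfun d (F i)) -> homfun d (fun v => \sum_(i <- r | P i) F i v).
Proof.
move=> HF; elim: r => [|i r IHr].
  by apply: homfun_ext (homfun0 n d) => v; rewrite big_nil.
have [Pi|nPi] := boolP (P i); last first.
  by apply: homfun_ext IHr => v; rewrite big_cons (negPf nPi).
by apply: homfun_ext (homfunD (HF i Pi) IHr) => v; rewrite big_cons Pi.
Qed.

Lemma homfun_prod n (I : Type) (r : seq I) (d : I -> nat) (F : I -> 'rV[K]_n -> K) :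
  (forall i, homfun (d i) (F i)) ->
  homfun (\sum_(i <- r) d i)%N (fun v => \prod_(i <- r) F i v).
Proof.
move=> HF; elim: r => [|i r IHr].
  by rewrite big_nil; apply: homfun_ext (homfun_const n 1) => v; rewrite big_nil.
by rewrite big_cons; apply: homfun_ext (homfunM (HF i) IHr) => v; rewrite big_cons.
Qed.

Lemma homfun_linear n m (A : 'M[K]_(n, m)) i j : homfun 1 (fun v : 'rV_n => (v *m A) i j).
Proof.
exists (\sum_k A k j *: 'X_k).
  by apply: rpred_sum => k _; apply: dhomogZ; rewrite dhomogX; apply/eqP/mdeg1.
move=> v; rewrite mxE raddf_sum; apply: eq_bigr => k _ /=.
by rewrite (ord1 i) mevalZ mevalXU mulrC.
Qed.

Lemma homfun_comp n m d (p : {mpoly K[m]}) (F : 'I_m -> 'rV[K]_n -> K) :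
  p \is d.-homog -> (forall i, homfun 1 (F i)) ->
  homfun d (fun v => p.@[fun i => F i v]).
Proof.
move=> /dhomogP hp HF.
apply: homfun_ext (fun v => esym (mevalE (fun i => F i v) p)) _ => /=.
rewrite /=.
suff H (s : seq 'X_{1..m}) : (forall mm, mm \in s -> mdeg mm = d) ->
    homfun d (fun v => \sum_(mm <- s) p@_mm * \prod_i F i v ^+ mm i).
  exact: H.
elim: s => [|mm s IHs] hs.
  by apply: homfun_ext (homfun0 n d) => v; rewrite big_nil.
have Fmm : homfun d (fun v => p@_mm * \prod_i F i v ^+ mm i).
  rewrite -(hs mm (mem_head _ _)) mdegE -[X in homfun X]add0n.
  apply: homfunM; first exact: homfun_const.
  by apply: homfun_prod => i; have := homfunX (mm i) (HF i); rewrite mul1n.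
have {}IHs := IHs (fun mm' sm => hs mm' (@mem_behead _ (mm :: s) mm' sm)).
by apply: homfun_ext (homfunD Fmm IHs) => v; rewrite big_cons.
Qed.

Lemma homfunZ n d f c (v : 'rV[K]_n) : homfun d f -> f (c *: v) = c ^+ d * f v.
Proof. by move=> [p hp fp]; rewrite !fp (homog_mevalZ _ _ hp). Qed.

Lemma polyfun_ext n f g : f =1 g -> @polyfun n f -> polyfun g.
Proof. by move=> fg [p fp]; exists p => v; rewrite -fg. Qed.

Lemma polyfun_const n k : @polyfun n (fun=> k).
Proof. exact: homfun_polyfun (homfun_const n k). Qed.

Lemma polyfunD n f g : @polyfun n f -> polyfun g -> polyfun (fun v => f v + g v).
Proof. by move=> [p fp] [q gq]; exists (p + q) => v; rewrite fp gq mevalD. Qed.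

Lemma polyfunM n f g : @polyfun n f -> polyfun g -> polyfun (fun v => f v * g v).
Proof. by move=> [p fp] [q gq]; exists (p * q) => v; rewrite fp gq mevalM. Qed.

Lemma polyfunX n f k : @polyfun n f -> polyfun (fun v => f v ^+ k).
Proof.
by move=> [p fp]; exists (p ^+ k) => v; rewrite fp rmorphXn.
Qed.

Lemma polyfun_linear n m (A : 'M[K]_(n, m)) i j : polyfun (fun v : 'rV_n => (v *m A) i j).
Proof. exact: homfun_polyfun (homfun_linear A i j). Qed.

Lemma polyfun_coord n j : polyfun (fun v : 'rV[K]_n => v 0 j).
Proof. by exists 'X_j => v; rewrite mevalXU. Qed.

Lemma polyfun_sum n (I : Type) (r : seq I) (P : pred I) (F : I -> 'rV[K]_n -> K) :
  (forall i, P i -> polyfun (F i)) -> polyfun (fun v => \sum_(i <- r | P i) F i v).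
Proof.
move=> HF; elim: r => [|i r IHr].
  by apply: polyfun_ext (polyfun_const n 0) => v; rewrite big_nil.
have [Pi|nPi] := boolP (P i); last first.
  by apply: polyfun_ext IHr => v; rewrite big_cons (negPf nPi).
by apply: polyfun_ext (polyfunD (HF i Pi) IHr) => v; rewrite big_cons Pi.
Qed.

Lemma polyfun_prod n (I : Type) (r : seq I) (P : pred I) (F : I -> 'rV[K]_n -> K) :
  (forall i, P i -> polyfun (F i)) -> polyfun (fun v => \prod_(i <- r | P i) F i v).
Proof.
move=> HF; elim: r => [|i r IHr].
  by apply: polyfun_ext (polyfun_const n 1) => v; rewrite big_nil.
have [Pi|nPi] := boolP (P i); last first.
  by apply: polyfun_ext IHr => v; rewrite big_cons (negPf nPi).
by apply: polyfun_ext (polyfunM (HF i Pi) IHr) => v; rewrite big_cons Pi.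
Qed.

Lemma polyfun_comp n m (f : 'rV[K]_m -> K) (F : 'rV[K]_n -> 'rV[K]_m) :
  polyfun f -> (forall i, polyfun (fun v => F v 0 i)) -> polyfun (f \o F).
Proof.
move=> [p fp] HF.
apply: (polyfun_ext (f := fun v => \sum_(mm <- msupp p) p@_mm * \prod_i F v 0 i ^+ mm i)).
  by move=> v; rewrite /= fp mevalE.
apply: polyfun_sum => mm _; apply: polyfunM; first exact: polyfun_const.
by apply: polyfun_prod => i _; apply: polyfunX.
Qed.

(** Each monomial is multiplied by the missing power of the first coordinate. As [msize] is the
    degree plus one, the degree is strictly below [d]; the slack is harmless. *)
Lemma homogenize n (p : {mpoly K[n]}) d : (msize p <= d)%N ->
  exists2 f : 'rV[K]_(1 + n) -> K, homfun d f & forall t : 'rV_n, f (row_mx 1 t) = p.@[t 0].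
Proof.
move=> lepd.
exists (fun w => \sum_(mm <- msupp p) p@_mm * (w 0 (lshift n 0) ^+ (d - mdeg mm) *
   \prod_i w 0 (rshift 1 i) ^+ mm i)); last first.
  move=> t; rewrite mevalE; apply: eq_bigr => mm _; congr (_ * _).
  rewrite row_mxEl mxE eqxx expr1n mul1r; apply: eq_bigr => i _.
  by rewrite row_mxEr.
have coord j : homfun 1 (fun w : 'rV[K]_(1 + n) => w 0 j).
  by apply: homfun_ext (homfun_linear 1%:M 0 j) => w; rewrite mulmx1.
suff H (s : seq 'X_{1..n}) : (forall mm, mm \in s -> mm \in msupp p) ->
    homfun d (fun w : 'rV[K]_(1 + n) => \sum_(mm <- s) p@_mm * (w 0 (lshift n 0) ^+ (d - mdeg
      mm) *
   \prod_i w 0 (rshift 1 i) ^+ mm i)).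
  exact: H.
elim: s => [|mm s IHs] hs.
  by apply: homfun_ext (homfun0 _ d) => v; rewrite big_nil.
have {}IHs := IHs (fun mm' sm => hs mm' (@mem_behead _ (mm :: s) mm' sm)).
apply: homfun_ext (homfunD (f := fun w => p@_mm * (w 0 (lshift n 0) ^+ (d - mdeg mm) *
   \prod_i w 0 (rshift 1 i) ^+ mm i)) _ IHs) => [v|]; first by rewrite big_cons.
have ltmm : (mdeg mm < d)%N.
  apply: leq_trans lepd; apply: msize_mdeg_lt; exact/hs/mem_head.
rewrite -[X in homfun X]add0n -{1}(subnK (ltnW ltmm)); apply: homfunM; first exact: homfun_const.
apply: homfunM; first by have := homfunX (d - mdeg mm) (coord (lshift n 0)); rewrite mul1n.
rewrite mdegE; apply: homfun_prod => i.
by have := homfunX (mm i) (coord (rshift 1 i)); rewrite mul1n.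
Qed.

End PolynomialFunctions.

Section LocallyFractions.
Variable K : fieldType.

Lemma fopen_local (X : fspace K) (U : set X) :
  (forall x, U x -> exists V, [/\ fopen V, V x & V `<=` U]) -> fopen U.
Proof.
move=> H; have /choice[V VP] : forall x : {x | U x}, exists V, [/\ fopen V,
  V (sval x) & V `<=` U].
  by case=> x Ux; apply: H.
rewrite (_ : U = \bigcup_x V x); first by apply: fopen_bigcup => x; case: (VP x).
apply/seteqP; split=> x.
  by move=> Ux; exists (exist _ x Ux) => //; case: (VP (exist _ x Ux)).
by move=> [y _]; case: (VP y) => _ _; apply.
Qed.

Lemma affine_inverse_closed n : inverse_closed (affine_space K n).
Proof.
move=> U f oU Rf.
have key x : (U `&` [set x | f x != 0]) x -> exists V, [/\ affine_open V, V x,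
    V `<=` U `&` [set x | f x != 0] & affine_frac V (fun x => (f x)^-1)].
  move=> [Ux fx]; have [V [oV Vx VU [p [q fE]]]] := Rf x Ux.
  exists (V `&` [set v | p.@[v 0] != 0]); split.
  - apply: affine_openI => //; exists [set p].
    by apply/seteqP; split=> v /= => [pv|[_ -> //]]; exists p.
  - split=> //=; move: fx => /=; have [_ ->] := fE x Vx.
    by rewrite mulf_eq0 negb_or => /andP[].
  - move=> v [Vv pv]; split; first exact: VU.
    rewrite /=; have [q0 ->] := fE v Vv; by rewrite /= mulf_neq0 ?invr_eq0.
  - exists q, p => v [Vv pv]; split=> //.
    by have [q0 ->] := fE v Vv; rewrite invf_div.
have oW : @fopen _ (affine_space K n) (U `&` [set x | f x != 0]).
  by apply: fopen_local => x /key[V [oV Vx VU _]]; exists V.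
by split.
Qed.

Lemma proj_inverse_closed n : inverse_closed (proj_space K n).
Proof.
move=> U f oU Rf.
have key x : (U `&` [set x | f x != 0]) x -> exists V, [/\ proj_open V, V x,
    V `<=` U `&` [set x | f x != 0] & proj_frac V (fun x => (f x)^-1)].
  move=> [Ux fx]; have [V [oV Vx VU [d [p [q [hp hq fE]]]]]] := Rf x Ux.
  exists (V `&` [set L | nonvanishing p L]); split.
  - apply: proj_openI => //; exists [set p]; split; first by move=> _ ->; exists d.
    by apply/seteqP; split=> v /= => [pv|[_ -> //]]; exists p.
  - split=> // w wx w0; move: fx => /=; have [_ ->] := fE x Vx w wx w0.
    by rewrite mulf_eq0 negb_or => /andP[].
  - move=> L [VL pL]; split=> /=; first exact: VU.
    have [w wL w0] := line_neq0 L; have [q0 ->] := fE L VL w wL w0.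
    by rewrite /= mulf_neq0 ?invr_eq0 ?pL.
  - exists d, q, p; split=> // L [VL pL] w wL w0; split; first exact: pL.
    by have [q0 ->] := fE L VL w wL w0; rewrite invf_div.
have oW : @fopen _ (proj_space K n) (U `&` [set x | f x != 0]).
  by apply: fopen_local => x /key[V [oV Vx VU _]]; exists V.
by split.
Qed.

Lemma affine_morph n m (F : 'rV[K]_n -> 'rV[K]_m) :
  (forall i, polyfun (fun v => F v 0 i)) ->
  fspace_morph (F : affine_space K n -> affine_space K m).
Proof.
move=> PF.
have comp (p : {mpoly K[m]}) : exists q : {mpoly K[n]}, forall v, p.@[F v 0] = q.@[v 0].
  by apply: (polyfun_comp (f := fun v => p.@[v 0])) => //; exists p.
have op U : affine_open U -> affine_open (F @^-1` U).
  move=> [S ->]; exists [set q | exists2 p, S p & forall v, p.@[F v 0] = q.@[v 0]].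
  apply/seteqP; split=> v /= [p Sp pv].
    by have [q qE] := comp p; exists q; [exists p | rewrite -qE].
  by case: Sp => r Sr rE; exists r => //; rewrite rE.
split=> // U f oU Rf x Ux; have [V [oV Vx VU [p [q fE]]]] := Rf _ Ux.
exists (F @^-1` V); split; [exact: op|by []|by move=> y /VU|].
have [p' pE] := comp p; have [q' qE] := comp q.
by exists p', q' => v /fE; rewrite pE qE.
Qed.

Lemma linear_action_morph (gT : finGroupType) (G : {group gT}) n (rG :
  mx_representation K G n) g :
  fspace_morph (fun v : affine_space K n => linear_action rG v g).
Proof. by apply: affine_morph => i; apply: polyfun_linear. Qed.

Lemma line_act_vector (gT : finGroupType) (G : {group gT}) n (rG :
  mx_representation K G n) (L : line K n) g w :
  w \in val L -> w *m rG (val (subg G g)) \in val (line_act rG L g).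
Proof. by move=> wL; rewrite -[_ *m _]/(linear_act rG w g) -act_homE; apply: memv_img. Qed.

Lemma linear_act_neq0 (gT : finGroupType) (G : {group gT}) n (rG :
  mx_representation K G n) g (w : 'rV[K]_n) :
  w != 0 -> w *m rG (val (subg G g)) != 0.
Proof.
apply: contraNneq => e; rewrite -[w](repr_mxK rG (valP (subg G g))) e mul0mx //.
Qed.

Lemma proj_action_morph (gT : finGroupType) (G : {group gT}) n (rG : mx_representation K G n) g :
  @fspace_morph _ (proj_space K n) (proj_space K n) (fun L => proj_action rG L g).
Proof.
set A := rG (val (subg G g)).
have comp d (p : {mpoly K[n]}) : p \is d.-homog ->
    exists2 q : {mpoly K[n]}, q \is d.-homog & forall v : 'rV[K]_n, p.@[(v *m A) 0] = q.@[v 0].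
  move=> hp; have [q hq qE] := homfun_comp hp (homfun_linear A 0).
  by exists q => // v; rewrite -qE; apply: meval_eq.
have nv d (p q : {mpoly K[n]}) L : p \is d.-homog -> q \is d.-homog ->
    (forall v : 'rV[K]_n, p.@[(v *m A) 0] = q.@[v 0]) ->
    nonvanishing p (line_act rG L g) <-> nonvanishing q L.
  move=> hp hq pq; split=> [H w wL w0|H].
    by rewrite -pq H ?line_act_vector ?linear_act_neq0.
  have [w wL w0] := line_neq0 L; apply/(nonvanishingE _ hp).
  exists (w *m A); first exact: line_act_vector.
  by rewrite linear_act_neq0 // pq H.
have op U : proj_open U -> proj_open ((line_act rG)^~ g @^-1` U).
  move=> [S [hS ->]]; exists [set q | exists d p, [/\ S p, p \is d.-homog, q \is d.-homog &
      forall v : 'rV[K]_n, p.@[(v *m A) 0] = q.@[v 0]]]; split.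
    by move=> q [d [p [_ _ hq _]]]; exists d.
  apply/seteqP; split=> L /=.
    move=> [p Sp pL]; have [d hp] := hS p Sp; have [q hq pq] := comp d p hp.
    by exists q; [exists d, p | apply/(nv _ _ _ _ hp hq pq)].
  move=> [q [d [p [Sp hp hq pq]]] qL]; exists p => //.
  exact/(nv _ _ _ _ hp hq pq).
split=> // U f oU Rf L UL; have [V [oV Vx VU [d [p [q [hp hq fE]]]]]] := Rf _ UL.
exists ((line_act rG)^~ g @^-1` V); split; [exact: op|by []|by move=> y /VU|].
have [p' hp' pE] := comp d p hp; have [q' hq' qE] := comp d q hq.
exists d, p', q'; split=> // M VM w wM w0.
by rewrite -pE -qE; apply: fE => //; [apply: line_act_vector | apply: linear_act_neq0].
Qed.

End LocallyFractions.

Section HomogeneousRatio.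
Variables (K : fieldType) (n : nat).
Implicit Types (P Q : 'rV[K]_n -> K) (L : line K n).

(** For forms of equal degree the choice of the vector does not matter, by [hratioE], even where [Q]
    vanishes. *)
Definition hratio P Q L := P (vpick (val L)) / Q (vpick (val L)).

Lemma homfun_line d P L v w : homfun d P -> v \in val L -> w \in val L ->
  v != 0 -> P v != 0 -> w != 0 -> P w != 0.
Proof.
move=> hP vL wL v0 Pv w0; have [c wE] := line_colinear vL wL v0.
rewrite wE (homfunZ _ _ hP) mulf_neq0 // expf_neq0 //.
by apply: contraNneq w0 => c0; rewrite wE c0 scale0r.
Qed.

Lemma hratioE d P Q L w : homfun d P -> homfun d Q -> w \in val L -> w != 0 ->
  hratio P Q L = P w / Q w.
Proof.
move=> hP hQ wL w0; rewrite /hratio; set v := vpick _.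
have vL : v \in val L by apply: memv_pick.
have v0 : v != 0 by rewrite vpick0 -dimv_eq0 (eqP (valP L)).
have [c vE] := line_colinear wL vL w0; rewrite vE in v0 *.
rewrite (homfunZ _ _ hP) (homfunZ _ _ hQ) -mulf_div divff ?mul1r //.
by rewrite expf_neq0 //; apply: contraNneq v0 => ->; rewrite scale0r.
Qed.

Lemma hratio_regular d P Q : homfun d P -> homfun d Q ->
  exists U, [/\ proj_open U, (forall L, U L <-> Q (vpick (val L)) != 0) &
    locally_frac (@proj_open K n) (@proj_frac K n) U (hratio P Q)].
Proof.
move=> hP hQ; have [p hp pE] := hP; have [q hq qE] := hQ.
have nv L : nonvanishing q L <-> Q (vpick (val L)) != 0.
  have v0 : vpick (val L) != 0 by rewrite vpick0 -dimv_eq0 (eqP (valP L)).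
  rewrite (nonvanishingE _ hq); split=> [[w wL /andP[w0]]|Qv].
    by rewrite -qE => Qw; apply: (homfun_line hQ wL (memv_pick _) w0 Qw v0).
  by exists (vpick (val L)); rewrite ?memv_pick // v0 -qE.
exists [set L | nonvanishing q L].
have oU : @proj_open K n [set L | nonvanishing q L].
  exists [set q]; split; first by move=> _ ->; exists d.
  by apply/seteqP; split=> L /= => [qL|[_ -> //]]; exists q.
split=> // L UL; exists [set L | nonvanishing q L]; split=> //.
exists d, p, q; split=> // M qM w wM w0; split; first exact: qM.
by rewrite (hratioE hP hQ wM w0) pE qE.
Qed.

End HomogeneousRatio.

Section SeparatingForms.
Variables (K : fieldType) (n : nat).
Implicit Types (L : line K n) (Z : seq (line K n)).

(** For distinct lines, a coordinate of the projection with kernel [L']; for equal lines, any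
    coordinate that is nonzero on [L]. Allowing equality lets [form_separates] multiply over all of
    [Z], in a degree independent of [L]. *)
Lemma linear_form_separates L L' : exists2 f : 'rV[K]_n -> K, homfun 1 f &
  (forall w, w \in val L -> w != 0 -> f w != 0) /\
  (L != L' -> forall w, w \in val L' -> f w = 0).
Proof.
have [v vL v0] := line_neq0 L; have [v' vL' v0'] := line_neq0 L'.
have vanish (f : 'rV[K]_n -> K) (M : line K n) u w : homfun 1 f -> u \in val M -> w \in val M ->
    u != 0 -> f u = 0 -> f w = 0.
  move=> hf uM wM u0 fu; have [c ->] := line_colinear uM wM u0.
  by rewrite (homfunZ _ _ hf) fu mulr0.
have [e|neL] := eqVneq L L'.
  have [j vj] : exists j, v 0 j != 0.
    by apply/existsP; apply: contraNT v0 => /existsPn v0; apply/eqP/rowP => j; rewrite mxE;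
      apply/eqP; have := v0 j; rewrite negbK.
  have hj : homfun 1 (fun w : 'rV[K]_n => w 0 j).
    by apply: homfun_ext (homfun_linear 1%:M 0 j) => w; rewrite mulmx1.
  exists (fun w => w 0 j) => //; split=> // w wL w0.
  exact: (homfun_line hj vL).
have : v *m cokermx v' != 0.
  rewrite -submxE; apply: contraNN neL => /sub_rVP[c vE].
  have c0 : c != 0 by apply: contraNneq v0 => c0; rewrite vE c0 scale0r.
  apply/eqP/val_inj/eqP; rewrite eq_sym eqEdim (eqP (valP L)) (eqP (valP L')) leqnn andbT.
  apply/subvP => w wL'; have [d ->] := line_colinear vL' wL' v0'.
  by rewrite -[v'](scalerK c0) -vE !memvZ.
move=> vc; have [j vj] : exists j, (v *m cokermx v') 0 j != 0.
  apply/existsP; apply: contraNT vc => /existsPn vc; apply/eqP/rowP => j.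
  by rewrite [RHS]mxE; apply/eqP; have := vc j; rewrite negbK.
have hj := homfun_linear (cokermx v') 0 j.
exists (fun w => (w *m cokermx v') 0 j) => //; split=> [w wL w0|_ w wL'].
  exact: (homfun_line hj vL).
by apply: (vanish _ _ _ _ hj vL' wL' v0'); rewrite mulmx_coker mxE.
Qed.

Lemma form_separates L Z : exists2 f : 'rV[K]_n -> K, homfun (size Z) f &
  (forall w, w \in val L -> w != 0 -> f w != 0) /\
  (forall L', L' \in Z -> L != L' -> forall w, w \in val L' -> f w = 0).
Proof.
have /choice[f fP] : forall L', exists f : 'rV[K]_n -> K, homfun 1 f /\
    (forall w, w \in val L -> w != 0 -> f w != 0) /\
    (L != L' -> forall w, w \in val L' -> f w = 0).
  by move=> L'; have [f hf fP] := linear_form_separates L L'; exists f.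
exists (fun w => \prod_(L' <- Z) f L' w).
  rewrite -[size Z]sum1_size; apply: homfun_prod => L'; exact: (fP L').1.
split=> [w wL w0|L' ZL' neL w wL'].
  by rewrite prodf_seq_neq0; apply/allP => L' _ /=; apply: (fP L').2.1.
apply/eqP; rewrite prodf_seq_eq0; apply/hasP; exists L' => //=.
by apply/eqP; apply: (fP L').2.2.
Qed.

(** The forms of [form_separates] have a common degree, and on a line of [Z] only its own form
    survives in the sum. [undup] prevents that term from being repeated, which could kill it in
    positive characteristic. *)
Lemma form_nonvanishing Z : exists2 u : 'rV[K]_n -> K, homfun (size Z) u &
  forall L, L \in Z -> forall w, w \in val L -> w != 0 -> u w != 0.
Proof.
have /choice[f fP] : forall L, exists f : 'rV[K]_n -> K, homfun (size Z) f /\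
    (forall w, w \in val L -> w != 0 -> f w != 0) /\
    (forall L', L' \in Z -> L != L' -> forall w, w \in val L' -> f w = 0).
  by move=> L; have [f hf fP] := form_separates L Z; exists f.
exists (fun w => \sum_(L <- undup Z) f L w).
  by apply: homfun_sum => L _; apply: (fP L).1.
move=> L ZL w wL w0; rewrite (bigD1_seq L) ?mem_undup ?undup_uniq //=.
rewrite big1 ?addr0 => [|L' neL]; first exact: (fP L).2.1.
exact: ((fP L').2.2 L ZL neL w wL).
Qed.

End SeparatingForms.

(** * Affine charts of projective space, and extension of functions from a chart *)

Section Chart.
Variables (K : fieldType) (n : nat) (M : 'M[K]_(1 + n)).
Hypothesis M_unit : M \in unitmx.

Definition chart_vector (t : 'rV[K]_n) : 'rV[K]_(1 + n) := row_mx 1 t *m M.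

Lemma chart_vector_neq0 t : chart_vector t != 0.
Proof.
apply/eqP => /(congr1 (mulmxr (invmx M))); rewrite /= mulmxK // mul0mx.
move=> /(congr1 (fun A : 'rV_(1 + n) => A 0 (lshift n 0))); rewrite row_mxEl !mxE eqxx => /eqP.
by rewrite oner_eq0.
Qed.

Lemma chart_dim t : \dim <[chart_vector t]>%VS == 1%N.
Proof. by rewrite dim_vline chart_vector_neq0. Qed.

Definition chart (t : 'rV[K]_n) : line K (1 + n) :=
  exist (fun L : {vspace 'rV[K]_(1 + n)} => \dim L == 1%N) _ (chart_dim t).

Lemma chart_vector_mem t : chart_vector t \in val (chart t).
Proof. exact: memv_line. Qed.

Lemma chart_onto (L : line K (1 + n)) w : w \in val L ->
  (w *m invmx M) 0 (lshift n 0) != 0 -> exists t, chart t = L.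
Proof.
move=> wL c0; set c := (_ 0 _) in c0.
have w0 : w != 0 by apply: contraNneq c0 => w0; rewrite /c w0 mul0mx mxE.
exists (c^-1 *: rsubmx (w *m invmx M)).
apply/val_inj/eqP; rewrite eqEdim (eqP (valP L)) (eqP (valP (chart _))) leqnn andbT /=.
suff -> : chart_vector (c^-1 *: rsubmx (w *m invmx M)) = c^-1 *: w by rewrite -memvE memvZ.
rewrite /chart_vector; have -> :
  row_mx 1 (c^-1 *: rsubmx (w *m invmx M)) = c^-1 *: (w *m invmx M).
  rewrite -[in RHS](hsubmxK (w *m invmx M)) scale_row_mx; congr row_mx.
  by apply/matrixP => i j; rewrite !ord1 [RHS]mxE [lsubmx _ _ _]mxE mulVf // mxE eqxx.
by rewrite -scalemxAl mulmxKV.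
Qed.

Lemma chart_morph : @fspace_morph _ (affine_space K n) (proj_space K (1 + n)) chart.
Proof.
have comp (p : {mpoly K[1 + n]}) : exists q : {mpoly K[n]}, forall t,
  p.@[chart_vector t 0] = q.@[t 0].
  apply: (polyfun_comp (f := fun v => p.@[v 0])); first by exists p.
  move=> i; rewrite /chart_vector.
  apply: (polyfun_ext (f := fun t => \sum_j (row_mx 1 t : 'rV_(1 + n)) 0 j * M j i)).
    by move=> t; rewrite mxE.
  apply: polyfun_sum => j _; apply: polyfunM; last exact: polyfun_const.
  rewrite -[j]splitK; case: fintype.split => k /=.
    by apply: (polyfun_ext _ (polyfun_const _ ((1 : 'M_1) 0 k))) => t; rewrite row_mxEl.
  by apply: (polyfun_ext _ (polyfun_coord K k)) => t; rewrite row_mxEr.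
have nv d (p : {mpoly K[1 + n]}) t : p \is d.-homog ->
    nonvanishing p (chart t) <-> p.@[chart_vector t 0] != 0.
  move=> hp; split=> [|pt]; first by apply; rewrite ?chart_vector_mem ?chart_vector_neq0.
  apply/(nonvanishingE _ hp); exists (chart_vector t); first exact: chart_vector_mem.
  by rewrite chart_vector_neq0.
have op U : proj_open U -> affine_open (chart @^-1` U).
  move=> [S [hS ->]]; exists [set q | exists2 p, S p & forall t,
    p.@[chart_vector t 0] = q.@[t 0]].
  apply/seteqP; split=> t /= [p Sp pt].
    have [q qE] := comp p; exists q; first by exists p.
    by rewrite -qE; have [d hp] := hS p Sp; apply/(nv _ _ _ hp).
  case: Sp => r Sr rE; have [d hr] := hS r Sr.
  by exists r => //; apply/(nv _ _ _ hr); rewrite rE.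
split=> // U f oU Rf x Ux; have [V [oV Vx VU [d [p [q [hp hq fE]]]]]] := Rf _ Ux.
exists (chart @^-1` V); split; [exact: op|by []|by move=> y /VU|].
have [p' pE] := comp p; have [q' qE] := comp q.
exists p', q' => v Vv; rewrite -pE -qE; apply: (fE _ Vv); first exact: chart_vector_mem.
exact: chart_vector_neq0.
Qed.

End Chart.

Section ChartExtension.
Variables (K : fieldType) (n : nat) (M : 'M[K]_(1 + n)).
Hypothesis M_unit : M \in unitmx.
Local Notation chart := (chart M_unit).
Local Notation cvec := (chart_vector M).

Let c0 (w : 'rV[K]_(1 + n)) := (w *m invmx M) 0 (lshift n 0).

Let c0_hom : homfun 1 c0.
Proof. exact: homfun_linear. Qed.

Let c0_chart t : c0 (cvec t) = 1.
Proof. by rewrite /c0 /chart_vector mulmxK // row_mxEl mxE eqxx. Qed.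

Lemma homogenize_chart (p : {mpoly K[n]}) d : (msize p <= d)%N ->
  exists2 f : 'rV[K]_(1 + n) -> K, homfun d f & forall t, f (cvec t) = p.@[t 0].
Proof.
move=> /homogenize[f [q hq fq] fp].
exists (fun w => f (w *m invmx M)); last by move=> t; rewrite /chart_vector mulmxK.
apply: homfun_ext (homfun_comp hq (homfun_linear (invmx M) 0)) => w.
by rewrite /= fq; apply: meval_eq.
Qed.

(** Near 0, [f] is a fraction p / q where some polynomial r is nonzero. [e] and [F] are ratios of
    forms with the same denominator, a power of a form that vanishes on no line of [Z]. *)
Lemma chart_ext (Z : seq (line K (1 + n))) (V : set (affine_space K n)) (f : 'rV[K]_n -> K) :
  chart 0 \in Z -> fopen V -> V 0 -> fregular V f ->
  exists (U : set (proj_space K (1 + n))) e F,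
  [/\ fopen U, (forall L, L \in Z -> U L), fregular U e & fregular U F] /\
  [/\ e (chart 0) = 1,
      (forall L, L \in Z -> L != chart 0 -> e L = 0),
      (forall t, U (chart t) -> F (chart t) = e (chart t) * f t),
      (forall t, U (chart t) -> ~ V t -> e (chart t) = 0) &
      (forall L, U L -> (forall t, chart t <> L) -> e L = 0 /\ F L = 0)].
Proof.
move=> Z0 oV V0 Rf.
have [V1 [[S V1E] V10 V1V [p [q fE]]]] := Rf 0 V0.
have [r Sr r0] : exists2 r, S r & r.@[(0 : 'rV[K]_n) 0] != 0 by move: V10; rewrite V1E.
have rV1 (t : 'rV[K]_n) : r.@[t 0] != 0 -> V1 t by move=> rt; rewrite V1E; exists r.
set b := size Z.
have b_gt0 : (0 < b)%N by rewrite lt0n size_eq0; apply: contraTneq Z0 => ->.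
pose d0 := maxn (msize p) (msize q).
(* Numerators must have the degree [b * j] of [u ^+ j]. Of it [d0 + 1 + b] goes to [Q], [c0] and
   [B], and the rest [d1] to [R]; with this [j], [d1] is at least [msize r]. *)
pose j := (msize r + (d0 + 1 + b))%N.
pose d1 := (b * j - (d0 + 1 + b))%N.
have ltj : (j <= b * j)%N by apply: leq_pmull.
have [P hP PE] := homogenize_chart (leq_maxl (msize p) (msize q)).
have [Q hQ QE] := homogenize_chart (leq_maxr (msize p) (msize q)).
have [R hR RE] : exists2 f : 'rV[K]_(1 + n) -> K, homfun d1 f & forall t, f (cvec t) = r.@[t 0].
  by apply: homogenize_chart; rewrite leq_subRL /j ?(leq_trans _ ltj) ?leq_addl // addnC.
have [B hB [B0 BZ]] := form_separates (chart 0) Z.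
have [u hu uZ] := form_nonvanishing Z.
(* [R] vanishes at the points of the chart outside [V], [c0] on the hyperplane at infinity and [B]
   on the other lines of [Z]. Replacing [Q] by [P] multiplies the values on the chart by p / q. *)
pose N w := R w * (Q w * c0 w * B w); pose N' w := R w * (P w * c0 w * B w).
have dE : (d1 + (d0 + 1 + b) = b * j)%N by rewrite /d1 subnK // (leq_trans _ ltj) // leq_addl.
have hN : homfun (b * j) N by rewrite -dE; do !apply: homfunM.
have hN' : homfun (b * j) N' by rewrite -dE; do !apply: homfunM.
have huj := homfunX j hu.
have [U [oU UE RN]] := hratio_regular hN huj.
have [U' [oU' UE' RN']] := hratio_regular hN' huj.
have UU : U' = U by apply/seteqP; split=> L; rewrite UE UE'.
rewrite {}UU {oU' UE'} in RN'.
pose k := (hratio N (fun w => u w ^+ j) (chart 0))^-1.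
have v0 (L : line K (1 + n)) : vpick (val L) != 0 by rewrite vpick0 -dimv_eq0 (eqP (valP L)).
have ratioE t := hratioE hN huj (chart_vector_mem M_unit t) (chart_vector_neq0 M_unit t).
have ratioE' t := hratioE hN' huj (chart_vector_mem M_unit t) (chart_vector_neq0 M_unit t).
have k0 : hratio N (fun w => u w ^+ j) (chart 0) != 0.
  rewrite ratioE mulf_neq0 ?invr_eq0 ?expf_neq0 //; last first.
    by apply: (uZ _ Z0); [apply: chart_vector_mem | apply: chart_vector_neq0].
  rewrite /N RE QE c0_chart mulr1 !mulf_neq0 //; first exact: (fE 0 V10).1.
  by apply: B0; [apply: chart_vector_mem | apply: chart_vector_neq0].
have oUp : @fopen _ (proj_space K (1 + n)) U by [].
exists U, (fun L => k * hratio N (fun w => u w ^+ j) L),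
  (fun L => k * hratio N' (fun w => u w ^+ j) L); split; split=> //.
- by move=> L ZL; apply/UE; rewrite expf_neq0 //; apply: (uZ L ZL) => //; apply: memv_pick.
- by apply: fregular_mul => //; apply: fregular_const.
- by apply: fregular_mul => //; apply: fregular_const.
- by rewrite /k mulVf.
- move=> L ZL neL; rewrite /hratio /N (BZ L ZL) ?mulr0 ?mul0r ?mulr0 //; first by rewrite eq_sym.
  exact: memv_pick.
- move=> t Ut; rewrite ratioE ratioE' /N /N' RE PE QE.
  (* Where [r] vanishes, p / q is not known to represent [f], but both sides are 0. *)
  have [rt0|rt0] := eqVneq r.@[t 0] 0; first by rewrite rt0 !mul0r mulr0 mul0r.
  have [q0 ->] := fE t (rV1 t rt0).
  by move: ((u (cvec t) ^+ j)^-1) => X; field.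
- move=> t Ut nVt; rewrite ratioE /N RE; have [->|/rV1/V1V //] := eqVneq r.@[t 0] 0.
  by rewrite !mul0r mulr0.
- move=> L UL nL; have cL : c0 (vpick (val L)) = 0.
    apply/eqP; apply: contrapT => /negP c; have [t tL] := chart_onto M_unit (memv_pick _) c.
    exact: nL tL.
  by rewrite /hratio /N /N' cL !mulr0 !mul0r !mulr0 !mul0r !mulr0.
Qed.

End ChartExtension.

Section ProjectiveSlice.
Variables (K : numFieldType) (n : nat) (gT : finGroupType) (G H : {group gT}).
Variables (W : mx_representation K G (1 + n)) (rH : mx_representation K H n).
Variables (M : 'M[K]_(1 + n)) (c : gT -> K).
Hypotheses (M_unit : M \in unitmx) (sHG : H \subset G).
Hypothesis W_block : forall h, h \in H -> c h != 0 /\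
  forall t, chart_vector M t *m W h = c h *: chart_vector M (t *m rH h).
Hypothesis stab : forall g, g \in G ->
  line_act W (chart M_unit 0) g = chart M_unit 0 -> g \in H.

Lemma chart_equivariant t h : h \in H ->
  chart M_unit (linear_action rH t h) = proj_action W (chart M_unit t) h.
Proof.
move=> Hh; have Gh : h \in G by apply: (fintype.subsetP sHG).
have [ch0 WE] := W_block Hh.
apply/val_inj/eqP; rewrite eqEdim (eqP (valP (chart _ _))) (eqP (valP (proj_action W _ _)))
  leqnn andbT /=.
rewrite -memvE -[chart_vector _ _](scalerK ch0) memvZ // /linear_act subgK //= -WE.
have := line_act_vector W h (chart_vector_mem M_unit t).
by rewrite subgK.
Qed.

(** [Z] is the orbit of [chart 0], listed over [G]. By [stab] an element outside [H] moves
    [chart 0], so [chart_ext] makes the multiplier vanish there. *)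
Lemma projective_slice : completions_isomorphic
  (@max_ideal _ (proj_quotient W) (orbit_proj (proj_action W) (chart M_unit 0)))
  (@max_ideal _ (linear_quotient rH) (origin_image rH)).
Proof.
apply: (@slice_completions _ (proj_space K (1 + n)) (affine_space K n) _ G H
  (proj_action W) (linear_action rH)).
- by move=> g _; apply: proj_action_morph.
- by move=> g _; apply: linear_action_morph.
- exact: proj_inverse_closed.
- exact: affine_inverse_closed.
- exact: sHG.
- exact: chart_morph.
- by move=> t h; apply: chart_equivariant.
- by move=> h Hh; rewrite /= /linear_act mul0mx.
- move=> V f oV V0 Vf.
  pose Z : seq (line K (1 + n)) := [seq proj_action W (chart M_unit 0) g | g <- enum G].
  have ZP g : g \in G -> proj_action W (chart M_unit 0) g \in Z.
    by move=> Gg; apply: map_f; rewrite mem_enum.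
  have Z0 : chart M_unit 0 \in Z.
    by have := ZP 1%g (group1 G); rewrite (act_one (proj_action W)).
  have [U [e [F [[oU UZ Re RF] [e1 e0 eF eV eX]]]]] := chart_ext Z0 oV V0 Vf.
  exists U, e, F; split; split=> // g Gg; first exact/UZ/ZP.
  move=> nHg; by apply: e0; [apply: ZP | apply: contraNneq nHg; apply: stab].
Qed.

End ProjectiveSlice.

(** * Quotients by dihedral groups *)

Lemma germ0 (K : fieldType) (X : fspace K) (x : X) : germ (regular_near0 x) = 0.
Proof. exact: sq_class_eq. Qed.

Lemma completions_isomorphic_bij (K : comNzRingType) (A B : comAlgType K)
    (m : set A) (n : set B) (phi : {linear A -> B}) :
  monoid_morphism phi -> injective phi -> (forall b, exists a, phi a = b) ->
  n 0 -> (forall a, m a <-> n (phi a)) -> completions_isomorphic m n.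
Proof.
move=> phiM phi_inj phi_surj n0 mn.
apply: (completions_isomorphic_morph phiM) => [a /mn//|k|b k]; last first.
  by have [a <-] := phi_surj b; exists a; rewrite subrr; apply: ideal_pow0.
suff H b : ideal_pow n k b -> forall a, phi a = b -> ideal_pow m k a.
  by exists k => a ka; apply: H ka a erefl.
move: k b; apply: (@ideal_pow_ind _ n (fun k b => forall a, phi a = b -> ideal_pow m k a) n0).
- by move=> b a _; apply: ideal_pow_0.
- move=> k b b' nb IHb a e; have [x xb] := phi_surj b; have [x' xb'] := phi_surj b'.
  rewrite (phi_inj a (x * x')); last by rewrite e (phiM.2 x x') xb xb'.
  by apply: ideal_powS; [apply/mn; rewrite xb | apply: IHb].
- move=> k b b' IHb IHb' a e; have [x xb] := phi_surj b; have [x' xb'] := phi_surj b'.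
  rewrite (phi_inj a (x + x')); last by rewrite e [RHS]linearD xb xb'.
  by apply: ideal_powD; [apply: IHb | apply: IHb'].
Qed.

Lemma poly_eq0_natr (K : numFieldType) (p : {poly K}) : (forall i, p.[i%:R] = 0) -> p = 0.
Proof.
move=> p0; apply/eqP; apply: contraT => nzp.
have := @max_poly_roots _ p [seq i%:R | i <- iota 0 (size p)] nzp.
rewrite size_map size_iota ltnn; apply.
  by apply/allP => _ /mapP[i _ ->]; rewrite rootE p0.
rewrite map_inj_uniq ?iota_uniq // => i j /eqP; by rewrite eqr_nat => /eqP.
Qed.

Lemma polyfun_line (K : fieldType) n (f : 'rV[K]_n -> K) v : polyfun f ->
  exists p : {poly K}, forall s, f (s *: v) = p.[s].
Proof.
move=> [p fp]; exists (\sum_(m <- msupp p) p@_m *: \prod_i ((v 0 i) *: 'X) ^+ m i).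
move=> s; rewrite fp mevalE horner_sum; apply: eq_bigr => m _.
rewrite hornerZ horner_prod; congr (_ * _); apply: eq_bigr => i _.
by rewrite horner_exp hornerZ hornerX mxE mulrC.
Qed.

(* Restrict to the lines through the origin. *)
Lemma polyfun_mul_eq0 (K : numFieldType) n (f g : 'rV[K]_n -> K) :
  polyfun f -> polyfun g -> f 0 != 0 -> (forall v, f v * g v = 0) -> forall v, g v = 0.
Proof.
move=> pf pg f0 fg v.
have [p pE] := polyfun_line v pf; have [q qE] := polyfun_line v pg.
have /eqP : p * q = 0.
  by apply: poly_eq0_natr => i; rewrite hornerM -pE -qE.
rewrite mulf_eq0 => /orP[/eqP p0|/eqP q0]; last by rewrite -[v]scale1r qE q0 horner0.
by move: f0; rewrite -(scale0r v) pE p0 horner0 eqxx.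
Qed.

Section Dihedral.
Variables (K : numClosedFieldType) (gT : finGroupType) (H : {group gT}).
Variables (rH : mx_representation K H 2) (A : 'M[K]_2) (c s : gT) (z : K) (m : nat).
Hypotheses (A_unit : A \in unitmx) (z_prim : m.-primitive_root z).
Local Notation xx t := ((t *m A) 0 0).
Local Notation yy t := ((t *m A) 0 1).
Hypotheses (Hc : c \in H) (Hs : s \in H).
Hypothesis H_gen : forall h, h \in H -> exists i j, h = (c ^+ i * s ^+ j)%g.
Hypothesis xc : forall t : 'rV_2, xx (t *m rH c) = z * xx t.
Hypothesis yc : forall t : 'rV_2, yy (t *m rH c) = z^-1 * yy t.
Hypothesis xs : forall t : 'rV_2, xx (t *m rH s) = yy t.
Hypothesis ys : forall t : 'rV_2, yy (t *m rH s) = xx t.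

Let z0 : z != 0.
Proof.
apply: contraTneq (oner_neq0 K) => z00.
by rewrite -(prim_expr_order z_prim) z00 expr0n gtn_eqF ?eqxx // (prim_order_gt0 z_prim).
Qed.

Lemma dihedral_act h (t : 'rV_2) : h \in H -> exists i,
  (xx (t *m rH h) = z ^+ i * xx t /\ yy (t *m rH h) = z ^- i * yy t) \/
  (xx (t *m rH h) = z ^- i * yy t /\ yy (t *m rH h) = z ^+ i * xx t).
Proof.
move=> /H_gen[i [j ->]]; exists i.
have Hci : (c ^+ i)%g \in H by apply: groupX.
have Hsj : (s ^+ j)%g \in H by apply: groupX.
have ci : xx (t *m rH (c ^+ i)%g) = z ^+ i * xx t /\ yy (t *m rH (c ^+ i)%g) = z ^- i * yy t.
  elim: i {Hci} => [|i [IHx IHy]]; first by rewrite expg0 repr_mx1 mulmx1 expr0 invr1 !mul1r.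
  rewrite expgSr repr_mxM ?groupX // mulmxA xc yc IHx IHy exprS invfM; split; ring.
rewrite repr_mxM // mulmxA.
elim: j {Hsj} => [|j IHj]; first by left; rewrite expg0 repr_mx1 mulmx1.
rewrite expgSr repr_mxM ?groupX // mulmxA xs ys.
by case: IHj => -[-> ->]; [right | left].
Qed.

(* x y and x^m + y^m generate the invariants of the dihedral group. *)
Definition dihedral_map (t : 'rV[K]_2) : 'rV[K]_2 :=
  \row_i if i == 0 then xx t * yy t else xx t ^+ m + yy t ^+ m.
Local Notation pi := dihedral_map.

Lemma dihedral_mapE t i :
  pi t 0 i = if i == 0 then xx t * yy t else xx t ^+ m + yy t ^+ m.
Proof. by rewrite mxE. Qed.

Lemma dihedral_map0 : pi 0 = 0.
Proof.
have m0 := prim_order_gt0 z_prim.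
apply/rowP => i; rewrite dihedral_mapE [RHS]mxE; case: ifP => _.
  by rewrite mul0mx mxE mul0r.
by rewrite mul0mx !mxE expr0n gtn_eqF // addr0.
Qed.

Lemma dihedral_map_act h t : h \in H -> pi (t *m rH h) = pi t.
Proof.
move=> Hh; have [i xyi] := dihedral_act t Hh; have zi0 : z ^+ i != 0 by rewrite expf_neq0.
have zim : (z ^+ i) ^+ m = 1 by rewrite exprAC (prim_expr_order z_prim) expr1n.
case: xyi => -[xh yh]; apply/rowP => k; rewrite !dihedral_mapE xh yh; case: ifP => _.
- by field.
- by rewrite !exprMn exprVn zim invr1 !mul1r.
- by field.
- by rewrite !exprMn exprVn zim invr1 !mul1r addrC.
Qed.

Lemma dihedral_map_poly i : polyfun (fun t => pi t 0 i).
Proof.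
apply: (polyfun_ext (f := fun t => if i == 0 then xx t * yy t else xx t ^+ m + yy t ^+ m)).
  by move=> t; rewrite dihedral_mapE.
case: eqP => _; first by apply: polyfunM; apply: polyfun_linear.
by apply: polyfunD; apply: polyfunX; apply: polyfun_linear.
Qed.

(** x^m and y^m have to be the roots of X^2 - q X + p^m. A nonzero root has an m-th root [a], and
    [p / a] is the other coordinate; if no root is nonzero, p = q = 0. *)
Lemma dihedral_map_onto u : exists t, pi t = u.
Proof.
have m0 := prim_order_gt0 z_prim.
pose p := u 0 0; pose q := u 0 1.
suff [a [b [ab abm]]] : exists a b, a * b = p /\ a ^+ m + b ^+ m = q.
  exists ((\row_i if i == 0 then a else b) *m invmx A).
  apply/rowP => i; rewrite dihedral_mapE mulmxKV // !mxE /= ab abm.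
  by case: (i =P 0) => [->|/eqP i0] //; congr (u 0 _); case: i i0 => [[|[|]]] // i lti;
    apply/val_inj.
pose r := sqrtC (q ^+ 2 - 4 * p ^+ m).
have rr : r ^+ 2 = q ^+ 2 - 4 * p ^+ m by rewrite sqrtCK.
have two0 : (2 : K) != 0 by rewrite pnatr_eq0.
have [X [XY X0]] : exists X, X * (q - X) = p ^+ m /\ (X = 0 -> q = 0 /\ p = 0).
  have XYr e : e ^+ 2 = 1 -> (q + e * r) / 2 * (q - (q + e * r) / 2) = p ^+ m.
    move=> e1; have -> : (q + e * r) / 2 * (q - (q + e * r) / 2) = (q ^+ 2 - e ^+ 2 * r ^+ 2)
      / 4 by field.
    by rewrite e1 rr; field.
  have p0 X : X * (q - X) = p ^+ m -> X = 0 -> p = 0.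
    move=> + X0; rewrite X0 mul0r => /esym/eqP; by rewrite expf_eq0 m0 /= => /eqP.
  have [e|ne] := eqVneq ((q + 1 * r) / 2) 0.
    exists ((q + (- 1) * r) / 2); split; first by rewrite XYr // sqrrN expr1n.
    move=> e'; split; last by apply: (p0 ((q + 1 * r) / 2)) => //; rewrite XYr ?expr1n.
    have -> : q = (q + 1 * r) / 2 + (q + (- 1) * r) / 2 by field.
    by rewrite e e' addr0.
  exists ((q + 1 * r) / 2); split; first by rewrite XYr ?expr1n.
  by move=> e; rewrite e eqxx in ne.
have [X00|X00] := eqVneq X 0.
  have [-> ->] := X0 X00; exists 0, 0; rewrite mul0r expr0n gtn_eqF // addr0; by split.
pose a := m.-root X; have am : a ^+ m = X by rewrite /a rootCK.
have a0 : a != 0 by apply: contraNneq X00 => a0; rewrite -am a0 expr0n gtn_eqF.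
exists a, (p / a); split; first by field.
by rewrite expr_div_n am -XY; field.
Qed.

(* Newton's recursion for the power sums of x^m and y^m. *)
Lemma power_sum_poly k : exists2 f : 'rV[K]_2 -> K, polyfun f &
  forall t, xx t ^+ (m * k) + yy t ^+ (m * k) = f (pi t).
Proof.
suff : (exists2 f : 'rV[K]_2 -> K, polyfun f &
    forall t, xx t ^+ (m * k) + yy t ^+ (m * k) = f (pi t)) /\
  (exists2 f : 'rV[K]_2 -> K, polyfun f &
    forall t, xx t ^+ (m * k.+1) + yy t ^+ (m * k.+1) = f (pi t)) by case.
elim: k => [|k [[f pf fE] [g pg gE]]]; split.
- exists (fun=> 2); first exact: polyfun_const.
  by move=> t; rewrite muln0 !expr0.
- exists (fun u : 'rV[K]_2 => u 0 1); first exact: polyfun_coord.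
  by move=> t; rewrite muln1 dihedral_mapE.
- by exists g.
exists (fun u : 'rV[K]_2 => u 0 1 * g u + (-1) * (u 0 0 ^+ m * f u)).
  apply: polyfunD; first by apply: polyfunM => //; apply: polyfun_coord.
  apply: polyfunM; first exact: polyfun_const.
  by apply: polyfunM => //; apply: polyfunX; apply: polyfun_coord.
move=> t; rewrite -fE -gE !dihedral_mapE /= !exprM !exprS exprMn; ring.
Qed.

(** Shifting by [c] multiplies the sum by z^a / z^b, so it is 0 unless z^a = z^b. Then m divides a -
    b, and pairing x^a y^b with its image under [s] gives, for b at most a, (x y)^b times a power
    sum. *)
Lemma sum_monomial_poly a b : exists2 f : 'rV[K]_2 -> K, polyfun f &
  forall t, \sum_(h in H) xx (t *m rH h) ^+ a * yy (t *m rH h) ^+ b = f (pi t).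
Proof.
pose F (t : 'rV_2) := \sum_(h in H) xx (t *m rH h) ^+ a * yy (t *m rH h) ^+ b.
have shift g t : g \in H -> F t = \sum_(h in H) xx (t *m rH h *m rH g) ^+ a * yy (t *m rH h *m
  rH g) ^+ b.
  move=> Hg; rewrite /F (reindex_inj (mulIg g)) /=.
  by apply: eq_big => [h|h Hh]; rewrite ?groupMr // repr_mxM ?mulmxA // -(groupMr _ Hg).
have [zab|nzab] := eqVneq (z ^+ a) (z ^+ b); last first.
  exists (fun=> 0); first exact: polyfun_const.
  move=> t; apply/eqP; have := shift c t Hc.
  have -> : \sum_(h in H) xx (t *m rH h *m rH c) ^+ a * yy (t *m rH h *m rH c) ^+ b = z ^+ a *
    z ^- b * F t.
    rewrite /F mulr_sumr; apply: eq_bigr => h _; rewrite xc yc !exprMn exprVn; ring.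
  rewrite -[LHS]mul1r -/(F t) => /eqP; rewrite -subr_eq0 -mulrBl mulf_eq0 => /orP[|//].
  rewrite subr_eq0 eq_sym => /eqP e; case/eqP: nzab.
  by rewrite -[LHS](divfK (expf_neq0 b z0)) e mul1r.
have [f pf fE] : exists2 f : 'rV[K]_2 -> K, polyfun f &
    forall t, xx t ^+ a * yy t ^+ b + xx t ^+ b * yy t ^+ a = f (pi t).
  wlog leba : a b {F shift} zab / (b <= a)%N.
    move=> W; case/orP: (leq_total b a) => [/W|/(W b a)]; first by apply.
    by move=> /(_ (esym zab))[f pf fE]; exists f => // t; rewrite -fE addrC.
  have /dvdnP[k kE] : (m %| a - b)%N.
    by rewrite -eqn_mod_dvd // -(eq_prim_root_expr z_prim) zab.
  have [f pf fE] := power_sum_poly k.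
  exists (fun u : 'rV[K]_2 => u 0 0 ^+ b * f u); first by apply: polyfunM => //;
    apply: polyfunX; apply: polyfun_coord.
  move=> t; rewrite -fE dihedral_mapE /= -(subnK leba) kE mulnC !exprD exprMn; ring.
exists (fun u : 'rV[K]_2 => #|H|%:R / 2 * f u); first by apply: polyfunM => //;
  apply: polyfun_const.
move=> t; rewrite -/(F t).
have two0 : (2 : K) != 0 by rewrite pnatr_eq0.
(* One copy of the sum is shifted by [s], which exchanges the two exponents; each pair of terms then
   takes the same value at every translate of [t]. *)
have -> : F t = (F t + F t) / 2 by field.
rewrite {2}(shift s t Hs) /F -big_split /= mulrAC -mulr_natl; congr (_ / _).
rewrite mulr_natl -sumr_const; apply: eq_bigr => h Hh.
by rewrite xs ys [_ ^+ a * _ in X in _ + X]mulrC fE dihedral_map_act.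
Qed.

Lemma sum_polyfun_poly (p : 'rV[K]_2 -> K) : polyfun p -> exists2 f : 'rV[K]_2 -> K, polyfun f &
  forall t, \sum_(h in H) p (t *m rH h) = f (pi t).
Proof.
move=> pp.
have [q qE] : polyfun (p \o mulmxr (invmx A)).
  by apply: polyfun_comp => // i; apply: polyfun_linear.
have pE t : p t = \sum_(k <- msupp q) q@_k * (xx t ^+ k 0 * yy t ^+ k 1).
  have := qE (t *m A); rewrite /= mulmxK // => ->.
  rewrite mevalE; apply: eq_bigr => k _; congr (_ * _).
  by rewrite big_ord_recl big_ord1; congr (_ * (t *m A) 0 _ ^+ k _); apply/val_inj.
have /choice[f fP] : forall k : 'X_{1..2}, exists f : 'rV[K]_2 -> K, polyfun f /\
    forall t, \sum_(h in H) xx (t *m rH h) ^+ k 0 * yy (t *m rH h) ^+ k 1 = f (pi t).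
  by move=> k; have [f pf fE] := sum_monomial_poly (k 0) (k 1); exists f.
exists (fun u => \sum_(k <- msupp q) q@_k * f k u).
  apply: polyfun_sum => k _; apply: polyfunM; first exact: polyfun_const.
  exact: (fP k).1.
move=> t; under eq_bigr => h _ do rewrite pE.
rewrite exchange_big /=; apply: eq_bigr => k _.
by rewrite -mulr_sumr (fP k).2.
Qed.

(** The affine plane in the form that [abelian_singularity] expects, a quotient by the trivial
    group. It is transparent so that its matrices reduce to 1. *)
Definition trivial_mx_repr : mx_representation K (1%G : {group gT}) 2.
Proof.
exists (fun=> 1%:M); split=> // g h _ _; by rewrite mulmx1.
Defined.

Local Notation r1 := trivial_mx_repr.
Local Notation p1 := (orbit_proj (linear_action r1)).
Local Notation pH := (orbit_proj (linear_action rH)).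

Lemma trivial_act u g : g \in (1%G : {group gT}) -> linear_action r1 u g = u.
Proof. by move=> _; rewrite /= /linear_act mulmx1. Qed.

Lemma trivial_repr u : orbit_repr (p1 u) = u.
Proof. by have [g Gg ->] := orbit_repr_proj (linear_action r1) u; rewrite trivial_act. Qed.

Lemma trivial_stable U : act_stable (linear_action r1) U.
Proof. by move=> u g Gg; rewrite trivial_act. Qed.

Let pi_orbit t h : h \in H ->
  exists2 g, g \in (1%G : {group gT}) & pi (linear_action rH t h) = linear_action r1 (pi t) g.
Proof.
move=> Hh; exists 1%g => //; rewrite trivial_act //= /linear_act subgK //.
exact: dihedral_map_act.
Qed.

Let rho := @quotient_map _ (affine_space K 2) (affine_space K 2) _ _ _ H
  (linear_action r1) (linear_action rH) pi.

Let rhoE t : rho (pH t) = p1 (pi t).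
Proof. exact: quotient_map_proj. Qed.

Let rho_morph : @fspace_morph _ (linear_quotient rH) (linear_quotient r1) rho.
Proof.
apply: quotient_map_morph => //; apply: affine_morph => i.
exact: dihedral_map_poly.
Qed.

Let rho0 : rho (origin_image rH) = origin_image r1.
Proof. by rewrite rhoE dihedral_map0. Qed.

Local Notation phi := (germ_comp rho_morph rho0).

Lemma polyfun_open n (f : 'rV[K]_n -> K) : polyfun f ->
  @fopen _ (affine_space K n) [set v | f v != 0].
Proof.
move=> [p pE]; exists [set p]; apply/seteqP; split=> v /=; first by rewrite pE; exists p.
by rewrite pE => -[_ ->].
Qed.

Lemma affine_near0 n (f : 'rV[K]_n -> K) (V : set (affine_space K n)) : V 0 -> fopen V ->
  fregular V f ->
  exists p q r : 'rV[K]_n -> K, [/\ polyfun p, polyfun q, polyfun r, r 0 != 0 &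
    forall t, r t != 0 -> [/\ V t, q t != 0 & f t = p t / q t]].
Proof.
move=> V0 oV Rf; have [U [[S UE] U0 UV [p [q fE]]]] := Rf 0 V0.
have [r Sr r0] : exists2 r, S r & r.@[(0 : 'rV[K]_n) 0] != 0 by move: U0; rewrite UE.
exists (fun t => p.@[t 0]), (fun t => q.@[t 0]), (fun t => r.@[t 0]).
split=> //; [by exists p | by exists q | by exists r |].
move=> t rt; have Ut : U t by rewrite UE; exists r.
by have [q0 fq] := fE t Ut; split=> //; apply: UV.
Qed.

(** If p / q pulls back to 0 near 0, then p composed with [dihedral_map] vanishes where some
    polynomial is nonzero, so everywhere by [polyfun_mul_eq0]; surjectivity of [dihedral_map] brings
    this down to the plane. *)
Lemma dihedral_germ_injective : injective phi.
Proof.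
move=> a b e; apply/eqP; rewrite -subr_eq0; apply/eqP.
have : phi (a - b) = 0 by rewrite linearB /= e subrr.
move: (a - b); elim/germ_ind => F [V [oV V0 RF]] {a b e}.
set nF := ex_intro _ _ _.
have [p [q [r [pp pq pr r0 FE]]]] := @affine_near0 2 (F \o p1) (p1 @^-1` V) V0 oV RF.
rewrite germ_compE -germ0 => /germ_eq[U [oU U0 UF]].
have [r' pr' [r'0 r'U]] : exists2 r' : 'rV[K]_2 -> K, polyfun r' &
    r' 0 != 0 /\ forall t, r' t != 0 -> U (pH t).
  have [f1 [f2 [r' [_ _ pr' r'0 r'U]]]] :=
    @affine_near0 2 (fun=> 0) (pH @^-1` U) U0 oU (fregular_const oU 0).
  by exists r' => //; split=> // t /r'U[].
have rpi : polyfun (r \o pi) by apply: polyfun_comp => // i; apply: dihedral_map_poly.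
have ppi : polyfun (p \o pi) by apply: polyfun_comp => // i; apply: dihedral_map_poly.
have pi_p : forall t, (p \o pi) t = 0.
  apply: (polyfun_mul_eq0 (polyfunM pr' rpi) ppi) => [|t].
    by rewrite mulf_neq0 //= dihedral_map0.
  rewrite /=; have [->|/r'U Ut] := eqVneq (r' t) 0; first by rewrite !mul0r.
  have [->|/FE[_ q0 e]] := eqVneq (r (pi t)) 0; first by rewrite mulr0 mul0r.
  have := UF _ Ut; rewrite /= rhoE -[F _]/((F \o p1) (pi t)) e => /eqP.
  by rewrite mulf_eq0 invr_eq0 (negPf q0) orbF => /eqP ->; rewrite mulr0.
rewrite -germ0; apply/germ_eq.
exists ((@orbit_repr _ _ _ _ (linear_action r1)) @^-1` [set u | r u != 0]); split.
- apply: (@fopen_repr _ (affine_space K 2) _ _ (linear_action r1));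
  [exact: polyfun_open | exact: trivial_stable].
- by rewrite /= trivial_repr.
move=> O /= rO; rewrite -(orbit_reprK O).
have [t tE] := dihedral_map_onto (orbit_repr O).
rewrite -tE in rO *; have [_ _ e] := FE _ rO.
rewrite -[LHS]/((F \o p1) (pi t)) e.
by have /= -> := pi_p t; rewrite mul0r.
Qed.

(** An invariant germ p / q is rewritten with the product [qb] of the conjugates of q as
    denominator, then numerator and denominator are summed over [H]. Both sums are polynomials in
    the invariants, and the denominator at 0 is |H| q(0)^|H|. *)
Lemma dihedral_germ_surjective b : exists a, phi a = b.
Proof.
elim/germ_ind: b => F [V [oV V0 RF]].
have [p [q [r [pp pq pr r0 FE]]]] := @affine_near0 2 (F \o pH) (pH @^-1` V) V0 oV RF.
pose W := (pH @^-1` V) `&` [set t | r t != 0].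
have oW : @fopen _ (affine_space K 2) W.
  by apply: (@fopenI _ (affine_space K 2)); [exact: oV | exact: polyfun_open].
have morphH g : g \in H -> fspace_morph (fun t : affine_space K 2 => linear_action rH t g).
  by move=> _; apply: linear_action_morph.
have [U [oU sU U0 UW]] : exists U, [/\ @fopen _ (affine_space K 2) U,
    act_stable (linear_action rH) U, U 0 & U `<=` W].
  apply: (stable_core morphH oW) => g Gg.
  by rewrite /= /linear_act mul0mx.
pose qb t := \prod_(h in H) q (t *m rH h).
pose p' t := p t * \prod_(h in H | h != 1%g) q (t *m rH h).
have act_poly (g : 'rV[K]_2 -> K) h : polyfun g -> polyfun (fun t => g (t *m rH h)).
  by move=> pg; apply: (polyfun_comp (F := fun t => t *m rH h) pg) => i; apply: polyfun_linear.
have pqb : polyfun qb by apply: polyfun_prod => h _; apply: act_poly.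
have pp' : polyfun p' by apply: polyfunM => //; apply: polyfun_prod => h _; apply: act_poly.
have [B pB BE] := sum_polyfun_poly pqb.
have [A' pA AE] := sum_polyfun_poly pp'.
have q0 : q 0 != 0 by have [] := FE 0 r0.
have B0 : B 0 != 0.
  rewrite -dihedral_map0 -BE; under eq_bigr => h _.
    rewrite /qb; under eq_bigr => h' _ do rewrite !mul0mx.
    over.
  by rewrite sumr_const prodr_const -mulr_natr mulf_neq0 ?expf_neq0 // pnatr_eq0 -lt0n cardG_gt0.
have Fact t h : h \in H -> F (pH (t *m rH h)) = F (pH t).
  move=> Hh; congr F; apply/esym/orbit_projP; exists h => //.
  by rewrite /= /linear_act subgK.
have key t : U t -> F (pH t) * B (pi t) = A' (pi t).
  move=> Ut; rewrite -AE -BE mulr_sumr; apply: eq_bigr => h Hh.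
  rewrite -(Fact t h Hh).
  have Uth : U (t *m rH h) by have := sU t h Hh Ut; rewrite /= /linear_act subgK.
  have [_ rth] := UW _ Uth; have [_ qth e] := FE _ rth.
  rewrite -[F _]/((F \o pH) (t *m rH h)) e /qb /p' (bigD1 1%g) //= repr_mx1 mulmx1.
  by rewrite mulrA divfK.
pose F' (O : linear_quotient r1) := A' (@orbit_repr _ _ _ _ (linear_action r1) O) /
  B (@orbit_repr _ _ _ _ (linear_action r1) O).
have oB : @fopen _ (affine_space K 2) [set u | B u != 0] by apply: polyfun_open.
have nF' : @regular_near _ (linear_quotient r1) (origin_image r1) F'.
  exists ((@orbit_repr _ _ _ _ (linear_action r1)) @^-1` [set u | B u != 0]); split.
  - apply: (@fopen_repr _ (affine_space K 2) _ _ (linear_action r1));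
    [exact: polyfun_open | exact: trivial_stable].
  - by rewrite /= trivial_repr.
  apply: (@fregular_repr _ _ _ _ (linear_action r1) _ (fun u => A' u / B u)) => //.
  - exact: trivial_stable.
  - move=> u Bu; exists [set u | B u != 0]; split=> //.
    have [a aE] := pA; have [b bE] := pB; exists a, b => v Bv.
    by rewrite -aE -bE.
  - by move=> u g Gg _; rewrite trivial_act.
exists (germ nF'); rewrite germ_compE; apply/germ_eq.
have sU' : act_stable (linear_action rH) (U `&` [set t | B (pi t) != 0]).
  move=> t h Hh [Ut Bt]; split; first exact: sU.
  by rewrite /= /linear_act subgK // dihedral_map_act.
exists ((@orbit_repr _ _ _ _ (linear_action rH)) @^-1` (U `&` [set t | B (pi t) != 0])); split.
- apply: (@fopen_repr _ (affine_space K 2) _ _ (linear_action rH)) => //;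
  apply: (@fopenI _ (affine_space K 2)) => //.
  apply: (polyfun_open (f := B \o pi)); apply: polyfun_comp => // i; exact: dihedral_map_poly.
- by apply/(stable_repr _ sU'); split=> //=; rewrite dihedral_map0.
move=> O [UO BO]; rewrite -(orbit_reprK O) /= rhoE /F' trivial_repr.
by rewrite -key // mulfK.
Qed.

Let phi_max_ideal (a : local_ring (origin_image r1)) : max_ideal a <-> max_ideal (phi a).
Proof. by elim/germ_ind: a => f nf; rewrite germ_compE !max_ideal_germ /= rho0. Qed.

Lemma dihedral_smooth : completions_isomorphic
  (@max_ideal _ (linear_quotient rH) (origin_image rH))
  (@max_ideal _ (linear_quotient r1) (origin_image r1)).
Proof.
apply/completions_isomorphic_sym/(completions_isomorphic_bij (phi := phi)).
- exact: germ_comp_monoid.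
- exact: dihedral_germ_injective.
- exact: dihedral_germ_surjective.
- by exists (fun=> 0), (@regular_near0 _ _ _); split=> //; apply/esym/sq_class_eq.
exact: phi_max_ideal.
Qed.

End Dihedral.

(** * Stabilizers of lines *)

Section LineStabilizer.
Variables (K : numClosedFieldType) (gT : finGroupType) (G : {group gT}).
Variables (n : nat) (W : mx_representation K G (1 + n)) (L : line K (1 + n)).

Definition line_stab_set := finset (fun g => (g \in G) && (line_act W L g == L)).

Lemma line_stab_group_set : group_set line_stab_set.
Proof.
have [_ actM] := line_act_is_action W.
have act1 : line_act W L 1%g = L := act_one (proj_action W) L.
apply/group_setP; split=> [|g h]; first by rewrite !inE group1 act1 eqxx.
by rewrite !inE => /andP[Gg /eqP Lg] /andP[Gh /eqP Lh]; rewrite groupM // actM // Lg Lh eqxx.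
Qed.
Definition line_stab : {group gT} := Group line_stab_group_set.
Local Notation H := line_stab.

Lemma line_stabP g : reflect (g \in G /\ line_act W L g = L) (g \in H).
Proof. by rewrite inE; apply: (iffP andP) => -[Gg /eqP]. Qed.

Lemma line_stab_sub : H \subset G.
Proof. by apply/fintype.subsetP => g /line_stabP[]. Qed.

(* The rows of M are a vector of L and a basis of an invariant complement. *)
Lemma line_stab_blocks : exists (M : 'M[K]_(1 + n)) (MU : M \in unitmx)
    (chi : gT -> K) (D : gT -> 'M[K]_n),
  chart MU 0 = L /\
  forall h, h \in H -> M *m W h = block_mx (chi h)%:M 0 0 (D h) *m M.
Proof.
have sHG := line_stab_sub.
pose rH := subg_repr W sHG.
set w := vpick (val L).
have w0 : w != 0 by rewrite vpick0 -dimv_eq0 (eqP (valP L)).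
have wL : w \in val L by apply: memv_pick.
have wH h : h \in H -> exists c, w *m W h = c *: w.
  move=> /line_stabP[Gh Lh].
  have := line_act_vector W h wL; rewrite subgK // Lh => wh.
  exact: line_colinear wL wh w0.
have modw : mxmodule rH w.
  apply/mxmoduleP => h Hh /=; have [c ->] := wH h Hh.
  exact: scalemx_sub.
have charK : pgroup (negn [pchar K]) H.
  by apply/pgroupP => p _ _; rewrite inE /= pchar_num.
have modw' : mxmodule rH <<w>>%MS by rewrite (eqmx_module _ (genmxE w)).
have [V modV VE dxV] := mx_Maschke_pchar rH charK modw' (submx1 _).
have rw : \rank w = 1%N by rewrite rank_rV w0.
have rV : \rank V = n.
  move: dxV => /mxdirectP /=; rewrite VE mxrank1 genmxE rw => e.
  by apply/esym/eqP; rewrite -(eqn_add2l 1); apply/eqP.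
pose N : 'M[K]_(n, 1 + n) := castmx (rV, erefl) (row_base V).
have NV : (N :=: V)%MS by apply: eqmx_trans (eqmx_cast _ _) (eq_row_base V).
pose M : 'M[K]_(1 + n) := col_mx w N.
have MU : M \in unitmx.
  rewrite -row_full_unit -sub1mx -VE.
  by rewrite -addsmxE addsmxS ?genmxE // NV.
have /choice[chi chiE] : forall h, exists c, h \in H -> w *m W h = c *: w.
  move=> h; have [Hh|nHh] := boolP (h \in H); last by exists 0.
  by have [c cE] := wH h Hh; exists c.
have /choice[D DE] : forall h, exists D, h \in H -> N *m W h = D *m N.
  move=> h; have [Hh|nHh] := boolP (h \in H); last by exists 0.
  have : (N *m W h <= N)%MS by rewrite NV (eqmxMr _ NV); apply: (mxmoduleP modV).
  by move=> /submxP[D DE]; exists D.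
exists M, MU, chi, D; split.
  apply/val_inj/eqP; rewrite eqEdim (eqP (valP L)) (eqP (valP (chart _ _))) leqnn andbT /=.
  suff -> : chart_vector M 0 = w by rewrite -memvE.
  by rewrite /chart_vector mul_row_col mul1mx mul0mx addr0.
move=> h Hh; rewrite mul_col_mx mul_block_col !mul0mx addr0 add0r.
by rewrite mul_scalar_mx chiE // DE.
Qed.

End LineStabilizer.

Lemma mx2_Cayley (R : comNzRingType) (A : 'M[R]_2) : A *m A = \tr A *: A - (\det A)%:M.
Proof.
apply/matrixP => i j; rewrite mul_mx2E det_mx2E /mxtrace big_ord_recl big_ord1 !mxE.
have -> : lift ord0 ord0 = 1 :> 'I_2 by apply/val_inj.
have case2 (k : 'I_2) : k = 0 \/ k = 1.
  by case: k => [[|[|]]] // lt2; [left | right]; apply/val_inj.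
by case: (case2 i) => ->; case: (case2 j) => -> /=; rewrite -?[ord0]/(0 : 'I_2); ring.
Qed.

(* A is diagonalizable, its minimal polynomial being a divisor of X^k - 1. *)
Lemma eigenvector_sqr_neq1 (K : numClosedFieldType) n (A : 'M[K]_n.+1) k :
  (0 < k)%N -> A ^+ k = 1 -> A ^+ 2 != 1 ->
  exists a (v : 'rV_n.+1), [/\ v != 0, v *m A = a *: v & a ^+ 2 != 1].
Proof.
move=> k0 Ak A2.
have : diagonalizable A.
  apply/diagonalizableP; have [r rE] := closed_field_poly_normal ('X^k - 1 : {poly K}).
  have monk : 'X^k - 1 \is @monic K by rewrite -[1]polyC1 monicXnsubC.
  rewrite (monicP monk) scale1r in rE.
  exists r; last by rewrite -rE; apply: mxminpoly_min;
    rewrite rmorphB rmorphXn rmorph1 /= horner_mx_X Ak subrr.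
  by rewrite -separable_prod_XsubC -rE cyclotomic.separable_Xn_sub_1 // pnatr_eq0 -lt0n.
move=> /diagonalizablePeigen[rs _ rs1].
apply: contrapT => nE; case/eqP: A2; apply/eqP; rewrite -subr_eq0.
have : (1%:M <= kermx (A ^+ 2 - 1))%MS.
  rewrite -rs1; elim: (rs) => [|a r IHr]; first by rewrite big_nil sub0mx.
  rewrite big_cons addsmx_sub IHr andbT; apply/rV_subP => v /eigenspaceP va.
  apply/sub_kermxP; rewrite mulmxBr mulmx1 [A ^+ 2]expr2 [_ *m (_ * _)]mulmxA va -scalemxAl va
    scalerA -expr2.
  have [->|v0] := eqVneq v 0; first by rewrite scaler0 subrr.
  have [->|a2] := eqVneq (a ^+ 2) 1; first by rewrite scale1r subrr.
  by case: nE; exists a, v.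
by move=> /sub_kermxP; rewrite mul1mx => ->.
Qed.

(** * Action of the stabilizer on the line and on the invariant complement *)

Section Blocks.
Variables (K : numClosedFieldType) (gT : finGroupType) (G H : {group gT}) (n : nat).
Variables (W : mx_representation K G (1 + n)) (M : 'M[K]_(1 + n)).
Variables (chi : gT -> K) (D : gT -> 'M[K]_n).
Hypotheses (sHG : H \subset G) (MU : M \in unitmx) (W_faithful : mx_faithful W).
Hypothesis blocks : forall h, h \in H -> M *m W h = block_mx (chi h)%:M 0 0 (D h) *m M.

Let HG h : h \in H -> h \in G. Proof. exact: (fintype.subsetP sHG). Qed.

Lemma blocksM g h : g \in H -> h \in H ->
  chi (g * h)%g = chi g * chi h /\ D (g * h)%g = D g *m D h.
Proof.
move=> Hg Hh; have := blocks (groupM Hg Hh).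
rewrite repr_mxM ?HG // mulmxA blocks // -mulmxA blocks // mulmxA => /(can_inj (mulmxK MU)).
rewrite mulmx_block !mul0mx !mulmx0 !addr0 !add0r => /eq_block_mx[/esym e _ _ ->]; split=> //.
by move: e; rewrite -scalar_mxM => /matrixP/(_ 0 0); rewrite !mxE eqxx !mulr1n.
Qed.

Lemma blocks1 : chi 1%g = 1 /\ D 1%g = 1%:M.
Proof.
have := blocks (group1 H); rewrite repr_mx1 mulmx1 -{1}[M]mul1mx => /(can_inj (mulmxK MU)).
rewrite scalar_mx_block => /eq_block_mx[/esym e _ _ ->]; split=> //.
by move/matrixP: e => /(_ 0 0); rewrite !mxE eqxx !mulr1n.
Qed.

Lemma chi_neq0 h : h \in H -> chi h != 0.
Proof.
move=> Hh; have [e _] := blocksM Hh (groupVr Hh).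
apply: contra_eq_neq e => ->; rewrite mul0r mulgV blocks1.1; exact: oner_neq0.
Qed.

Lemma blocks_inj g h : g \in H -> h \in H -> chi g = chi h -> D g = D h -> g = h.
Proof.
move=> Hg Hh cgh Dgh; apply: (mx_faithful_inj W_faithful (HG Hg) (HG Hh)).
apply: (can_inj (mulKmx MU)); by rewrite !blocks // cgh Dgh.
Qed.

(** The action on Hom(L, V): [D] on V, twisted by the inverse of the character [chi] of L. *)
Lemma slice_mx_repr : mx_repr H (fun h => (chi h)^-1 *: D h).
Proof.
split=> [|g h Hg Hh]; first by rewrite blocks1.1 blocks1.2 invr1 scale1r.
by have [-> ->] := blocksM Hg Hh; rewrite invfM -scalemxAl -scalemxAr scalerA mulrC.
Qed.
Definition slice_repr := MxRepresentation slice_mx_repr.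

Lemma slice_block h : h \in H -> chi h != 0 /\
  forall t, chart_vector M t *m W h = chi h *: chart_vector M (t *m slice_repr h).
Proof.
move=> Hh; split=> [|t]; first exact: chi_neq0.
rewrite /chart_vector -mulmxA blocks // mulmxA mul_row_block !mulmx0 addr0 add0r mul1mx.
rewrite scalemxAl scale_row_mx -scalemxAr scalerA mulfV ?chi_neq0 // scale1r;
  congr (row_mx _ _ *m _).
by rewrite scalemx1.
Qed.

(** Scalars on L and on V commute with all the blocks, and [W] is faithful. *)
Lemma block_scalar_central z h a : z \in H -> h \in H -> D z = a%:M -> (z * h = h * z)%g.
Proof.
move=> Hz Hh Dz; have [c1 D1] := blocksM Hz Hh; have [c2 D2] := blocksM Hh Hz.
apply: blocks_inj; rewrite ?groupM ?c1 ?c2 ?D1 ?D2 ?Dz ?scalar_mxC //.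
by rewrite mulrC.
Qed.

(** [chi] and the determinant of [D] are characters; their common kernel is a group that contains
    every commutator. *)
Lemma block_derived h : h \in (H^`(1))%g -> chi h = 1 /\ \det (D h) = 1.
Proof.
have grp : group_set (finset (fun h => [&& h \in H, chi h == 1 & \det (D h) == 1])).
  apply/group_setP; split=> [|g k]; first by rewrite !inE group1 blocks1.1 blocks1.2 det1 !eqxx.
  rewrite !inE => /and3P[Hg /eqP cg /eqP Dg] /and3P[Hk /eqP ck /eqP Dk].
  by have [-> ->] := blocksM Hg Hk; rewrite groupM // det_mulmx cg ck Dg Dk !mulr1 !eqxx.
suff /fintype.subsetP sub : (H^`(1) \subset Group grp)%g.
  by move=> /sub; rewrite inE => /and3P[_ /eqP-> /eqP->].
rewrite derg1 gen_subG; apply/fintype.subsetP => _ /imset2P[x y Hx Hy ->].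
have chV k : k \in H -> chi k^-1%g * chi k = 1.
  by move=> Hk; have [<- _] := blocksM (groupVr Hk) Hk; rewrite mulVg blocks1.1.
have dV k : k \in H -> \det (D k^-1%g) * \det (D k) = 1.
  move=> Hk; have [_ e] := blocksM (groupVr Hk) Hk.
  by rewrite -det_mulmx -e mulVg blocks1.2 det1.
have HxV := groupVr Hx; have HyV := groupVr Hy.
rewrite inE groupR //= commgEl conjgE.
have [e1 f1] := blocksM HxV (groupM HyV (groupM Hx Hy)).
have [e2 f2] := blocksM HyV (groupM Hx Hy).
have [e3 f3] := blocksM Hx Hy.
rewrite e1 f1 e2 f2 e3 f3 !det_mulmx; apply/andP; split; apply/eqP.
  have -> : chi x^-1%g * (chi y^-1%g * (chi x * chi y)) = (chi x^-1%g * chi x) * (chi y^-1%g *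
    chi y) by ring.
  by rewrite !chV // mulr1.
have -> : \det (D x^-1%g) * (\det (D y^-1%g) * (\det (D x) * \det (D y))) =
   (\det (D x^-1%g) * \det (D x)) * (\det (D y^-1%g) * \det (D y)) by ring.
by rewrite !dV // mulr1.
Qed.

Lemma block_exp h k : h \in H -> chi (h ^+ k)%g = chi h ^+ k.
Proof.
move=> Hh; elim: k => [|k IHk]; first by rewrite expg0 blocks1.1.
by rewrite expgSr (blocksM (groupX k Hh) Hh).1 IHk exprSr.
Qed.

(** An element acts trivially on the slice when it acts on [W] by a scalar. If [chi h ^+ k = 1] this
    scalar would be 1, against faithfulness. *)
Lemma slice_exp_neq1 h k : h \in H -> chi h ^+ k = 1 -> (h ^+ k != 1)%g ->
  slice_repr (h ^+ k)%g != 1%:M.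
Proof.
move=> Hh ck; apply: contraNneq => /=; rewrite block_exp // ck invr1 scale1r => Dk.
by apply/eqP; apply: blocks_inj;
  rewrite ?groupX // ?(block_exp _ Hh) ?ck ?Dk ?blocks1.1 ?blocks1.2.
Qed.

End Blocks.

Section PlaneBlocks.
Variables (K : numClosedFieldType) (gT : finGroupType) (G H : {group gT}).
Variables (W : mx_representation K G (1 + 2)) (M : 'M[K]_(1 + 2)).
Variables (chi : gT -> K) (D : gT -> 'M[K]_2).
Hypotheses (sHG : H \subset G) (MU : M \in unitmx) (W_faithful : mx_faithful W).
Hypothesis blocks : forall h, h \in H -> M *m W h = block_mx (chi h)%:M 0 0 (D h) *m M.

Lemma block_exp_mx h k : h \in H -> D (h ^+ k)%g = D h ^+ k.
Proof.
move=> Hh; elim: k => [|k IHk]; first by rewrite expg0 (blocks1 MU blocks).2.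
by rewrite expgSr (blocksM sHG MU blocks (groupX k Hh) Hh).2 IHk exprSr.
Qed.

(** With determinant 1 and square 1, Cayley-Hamilton says that [D z] times its trace is 2; so the
    trace is nonzero, [D z] is scalar, and [block_scalar_central] concludes. *)
Lemma derived_involution_central z : z \in (H^`(1))%g -> (z ^+ 2 = 1)%g -> H \subset 'C[z]%g.
Proof.
move=> H'z z2; have [chi1 det1] := block_derived sHG MU blocks H'z.
have Hz : z \in H by apply: (fintype.subsetP (der_sub 1 H)).
have DD : D z *m D z = 1%:M.
  by rewrite -[RHS](blocks1 MU blocks).2 -z2 block_exp_mx.
have := mx2_Cayley (D z); rewrite DD det1 => e.
have t0 : \tr (D z) != 0.
  apply/eqP => t0; move: e; rewrite t0 scale0r sub0r => /matrixP/(_ 0 0).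
  rewrite !mxE /= mulr1n => /eqP; rewrite -addr_eq0; apply/negP.
  by rewrite (_ : 1 + 1 = 2%:R :> K) ?pnatr_eq0.
have Dz : D z = ((\tr (D z))^-1 * 2)%:M.
  rewrite scalar_mxM mul_scalar_mx -[LHS](scalerK t0) (_ : 2%:M = 1%:M + 1%:M);
    last by rewrite -raddfD.
  by rewrite {1}e subrK.
apply/fintype.subsetP => h Hh; apply/cent1P.
exact: esym (block_scalar_central sHG MU W_faithful blocks Hz Hh Dz).
Qed.

(** As [chi] is 1 at [x], equality of the traces on [W] becomes t = t^2 - 2 for the trace t of
    [D x], by Cayley-Hamilton. So t is 2 or -1, and in both cases [D x ^+ 7 = 1] forces
    [D x = 1]. *)
Lemma derived_conj_sqr x g : x \in (H^`(1))%g -> g \in G -> (x ^ g = x ^+ 2)%g ->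
  (x ^+ 7 = 1)%g -> x = 1%g.
Proof.
move=> H'x Gg xg x7; have [chi1 det1] := block_derived sHG MU blocks H'x.
have Hx : x \in H by apply: (fintype.subsetP (der_sub 1 H)).
have Gx : x \in G by apply: (fintype.subsetP sHG).
have trE h : h \in H -> \tr (W h) = chi h + \tr (D h).
  move=> Hh; rewrite -[W h](mulKmx MU) blocks // mxtrace_mulC -mulmxA mulmxV // mulmx1.
  by rewrite mxtrace_block mxtrace_scalar.
have := mx2_Cayley (D x); rewrite det1 => DD.
have D7 : D x ^+ 7 = 1 by rewrite -block_exp_mx // x7 (blocks1 MU blocks).2.
have tE : \tr (D x) = \tr (D x) ^+ 2 - 2.
  have : \tr (W (x ^ g)%g) = \tr (W x).
    rewrite conjgE !repr_mxM ?groupM ?groupV // repr_mxV //.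
    by rewrite mxtrace_mulC mulmxK // repr_mx_unit.
  rewrite xg !trE ?groupX // (block_exp sHG MU blocks) // chi1 expr1n => /addrI.
  move=> e; rewrite -[LHS]e block_exp_mx // expr2 -[D x * D x]/(D x *m D x) DD raddfB /= mxtraceZ.
  by rewrite mxtrace_scalar expr2.
suff D1 : D x = 1%:M.
  apply: (blocks_inj sHG MU W_faithful blocks) => //.
    by rewrite chi1 (blocks1 MU blocks).1.
  by rewrite (blocks1 MU blocks).2.
have /eqP : (\tr (D x) - 2) * (\tr (D x) + 1) = 0.
  by rewrite (_ : _ * _ = \tr (D x) ^+ 2 - 2 - \tr (D x)); [rewrite -tE subrr | ring].
rewrite mulf_eq0 subr_eq0 addr_eq0 => /orP[] /eqP t; rewrite t in DD.
  (* For trace 2, [D x - 1] has square zero and powers of [D x] are affine in the exponent; the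
     seventh gives 7 D = 7. *)
  have DE k : D x ^+ k.+1 = k.+1%:R *: D x - k%:R%:M.
    elim: k => [|k IHk]; first by rewrite expr1 scale1r raddf0 subr0.
    rewrite exprSr IHk mulrBl -scalerAl -[D x * D x]/(D x *m D x) DD -[_ * D x]/(_ *m D x)
      mul_scalar_mx.
    by apply/matrixP => i j; rewrite !mxE; ring.
  move: D7; rewrite DE => /(canRL (subrK _)); rewrite -[(1 : 'M[K]_2)]/(1%:M) -raddfD.
  move=> e; apply: (@scalerI _ _ (7%:R : K)); first by rewrite pnatr_eq0.
  by rewrite e scalemx1 /=; congr (_%:M); ring.
(* For trace -1, [D x] is a root of X^2 + X + 1, hence a cube root of 1, while 7 is 1 modulo 3. *)
have D3 : D x ^+ 3 = 1.
  rewrite !exprS expr0 mulr1 -[D x * D x]/(D x *m D x) DD mulrBr -[D x * 1%:M]/(D x *m 1%:M)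
    mulmx1.
  by rewrite scaleN1r mulrN -[D x * D x]/(D x *m D x) DD scaleN1r opprB opprK addrK.
by move: D7; rewrite (exprD _ 6 1) (exprM _ 3 2) D3 expr1n mul1r expr1.
Qed.

End PlaneBlocks.

(** * Normal form of the dihedral action on the slice *)

Section DihedralSlice.
Variables (K : numClosedFieldType) (gT : finGroupType) (H : {group gT}).
Variables (rH : mx_representation K H 2) (c s : gT).
Hypotheses (Hc : c \in H) (Hs : s \in H) (s2 : (s ^+ 2 = 1)%g) (cs : (c ^ s = c^-1)%g).
Hypothesis H_gen : forall h, h \in H -> exists i j, h = (c ^+ i * s ^+ j)%g.
Hypothesis c2 : rH (c ^+ 2)%g != 1%:M.

(** If [v] is an eigenvector of [c] for [a], then [v] moved by [s] is one for the inverse of [a]. As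
    [a ^+ 2] is not 1 they form a basis, in which [c] is diagonal and [s] exchanges the
    coordinates. *)
Lemma dihedral_slice : completions_isomorphic
  (@max_ideal _ (linear_quotient rH) (origin_image rH))
  (@max_ideal _ _ (origin_image (trivial_mx_repr K gT))).
Proof.
have repX k : rH (c ^+ k)%g = rH c ^+ k.
  elim: k => [|k IHk]; first by rewrite expg0 repr_mx1.
  by rewrite expgSr repr_mxM ?groupX // IHk exprSr.
have Ck : rH c ^+ #[c]%g = 1 by rewrite -repX expg_order repr_mx1.
have [|a [v [v0 vC a2]]] := eigenvector_sqr_neq1 (order_gt0 c) Ck; first by rewrite -repX.
have ak : a ^+ #[c]%g = 1.
  have vk k : v *m rH c ^+ k = a ^+ k *: v.
    elim: k => [|k IHk]; first by rewrite !expr0 mulmx1 scale1r.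
    by rewrite exprSr -[_ * rH c]/(_ *m rH c) mulmxA IHk -scalemxAl vC scalerA -exprSr.
  have := vk #[c]%g; rewrite Ck mulmx1 -{1}[v]scale1r => /eqP.
  by rewrite -subr_eq0 -scalerBl scaler_eq0 (negPf v0) orbF subr_eq0 => /eqP <-.
(* [m] is the exact order of [a], a divisor of the order of [c]. *)
have [m mz _] := prim_order_exists (order_gt0 c) ak.
have a0 : a != 0.
  apply/eqP => a00; move/eqP: ak; rewrite a00 expr0n gtn_eqF ?order_gt0 //.
  by rewrite eq_sym oner_eq0.
have SS : rH s *m rH s = 1%:M by rewrite -repr_mxM // -[(s * s)%g]/(s ^+ 2)%g s2 repr_mx1.
have SC : rH s *m rH c = invmx (rH c) *m rH s.
  rewrite -repr_mxV // -!repr_mxM ?groupV //; congr (rH _).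
  have cs' : (c * s = s * c^-1)%g by rewrite -cs conjgE mulKVg.
  by apply: (mulgI c); rewrite mulKVg mulgA cs' mulgKV.
pose v2 := v *m rH s.
have v2S : v2 *m rH s = v by rewrite -mulmxA SS mulmx1.
have vCV : v *m invmx (rH c) = a^-1 *: v.
  apply: (can_inj (mulmxK (repr_mx_unit rH Hc))); rewrite mulmxKV ?repr_mx_unit //.
  by rewrite -scalemxAl vC scalerA mulVf // scale1r.
have v2C : v2 *m rH c = a^-1 *: v2 by rewrite /v2 -mulmxA SC mulmxA vCV scalemxAl.
have v20 : v2 != 0 by apply: contraNneq v0 => e; rewrite -v2S e mul0mx.
pose N : 'M[K]_2 := \matrix_(i < 2) (if i == 0 then v else v2).
have uN (u : 'rV_2) : u *m N = u 0 0 *: v + u 0 1 *: v2.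
  by apply/rowP => j; rewrite mul_mx2E !mxE.
have NU : N \in unitmx.
  rewrite -row_free_unit -kermx_eq0; apply/rowV0P => u /sub_kermxP; rewrite uN => e.
  have e' : (a * u 0 0) *: v + (a^-1 * u 0 1) *: v2 = 0.
    have := congr1 (mulmxr (rH c)) e; rewrite /= mul0mx mulmxDl -!scalemxAl vC v2C !scalerA.
    by rewrite mulrC [_ * a^-1]mulrC.
  have u0 : u 0 0 = 0.
    have : (a - a^-1) * u 0 0 *: v = 0.
      have : (a * u 0 0) *: v + (a^-1 * u 0 1) *: v2 - a^-1 *: (u 0 0 *: v + u 0 1 *: v2) = 0.
        by rewrite e e' scaler0 subrr.
      by rewrite scalerDr !scalerA opprD addrACA subrr addr0 -scalerBl -mulrBl.
    move/eqP; rewrite scaler_eq0 (negPf v0) orbF mulf_eq0 subr_eq0 => /orP[/eqP e2|/eqP //].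
    by case/eqP: a2; rewrite expr2 {2}e2 mulfV.
  have u1 : u 0 1 = 0.
    by move/eqP: e; rewrite u0 scale0r add0r scaler_eq0 (negPf v20) orbF => /eqP.
  apply/rowP => j; rewrite mxE; case: j => [[|[|]]] // ltj.
    by rewrite -[RHS]u0; congr (u _ _); apply/val_inj.
  by rewrite -[RHS]u1; congr (u _ _); apply/val_inj.
have coordN (u : 'rV_2) : u *m N *m invmx N = u by rewrite mulmxK.
have tE (t : 'rV_2) : t = (t *m invmx N) 0 0 *: v + (t *m invmx N) 0 1 *: v2.
  by rewrite -uN mulmxKV.
have coord p q : (p *: v + q *: v2) *m invmx N = \row_i if i == 0 then p else q.
  rewrite -[RHS](mulmxK NU) uN !mxE //.
apply: (@dihedral_smooth _ _ _ rH (invmx N) c s a m) => //.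
- by rewrite unitmx_inv.
- by move=> t; rewrite {1}(tE t) mulmxDl -!scalemxAl vC v2C !scalerA coord mxE /= mulrC.
- by move=> t; rewrite {1}(tE t) mulmxDl -!scalemxAl vC v2C !scalerA coord mxE /= mulrC.
- by move=> t; rewrite {1}(tE t) mulmxDl -!scalemxAl v2S addrC coord mxE /=.
- by move=> t; rewrite {1}(tE t) mulmxDl -!scalemxAl v2S addrC coord mxE /=.
Qed.

End DihedralSlice.

(** Linear algebra enters only through the two hypotheses on H'. They confine H to a centralizer or
    normalizer that is dihedral, and [dihedral8_sub] then applies as H is nonabelian. *)
Lemma PSL27_nonabelian_subgroup (H : {group coset_of 'Z(SL 2 'F_7)}) :
  H \subset PSL 2 'F_7 -> ~~ abelian H ->
  (forall z, z \in (H^`(1))%g -> (z ^+ 2 = 1)%g -> H \subset 'C[z]%g) ->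
  (forall x g, x \in (H^`(1))%g -> g \in PSL 2 'F_7 -> (x ^ g = x ^+ 2)%g -> (x ^+ 7 = 1)%g ->
    x = 1%g) ->
  dihedral8 H.
Proof.
move=> sHG nabH inv2 conj7.
have sDH : (H^`(1) \subset H)%g by apply: der_sub.
have GD x : x \in (H^`(1))%g -> x \in PSL 2 'F_7.
  by move=> Dx; apply: (fintype.subsetP sHG); apply: (fintype.subsetP sDH).
have [two|odd'] := boolP (2 %| #|(H^`(1))%g|)%N.
  have [z Dz oz] := Cauchy (isT : prime 2) two.
  have z2 : (z ^+ 2 = 1)%g by have := expg_order z; rewrite oz.
  apply: dihedral8_sub (PSL27_centraliser2 (GD z Dz) oz) _ nabH.
  by rewrite finset.subsetI sHG inv2.
have [seven|no7] := boolP (7 %| #|(H^`(1))%g|)%N.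
  have [x Dx ox] := Cauchy (isT : prime 7) seven.
  have [g Gg xg] := PSL27_conj7 (GD x Dx) ox.
  have x1 : x = 1%g by apply: conj7 Gg xg _ => //; have := expg_order x; rewrite ox.
  by rewrite x1 order1 in ox.
have d168 : (#|(H^`(1))%g| %| 168)%N.
  exact: dvdn_trans (cardSg (fintype.subset_trans sDH sHG)) PSL27_card.
(* What is left of 168 = 2^3 * 7 * 3 once 2 and 7 are excluded. Order 1 is excluded next, H being
   nonabelian. *)
have d3 : (#|(H^`(1))%g| %| 3)%N.
  have cop : coprime #|(H^`(1))%g| (2 ^ 3 * 7).
    by rewrite coprimeMr coprimeXr // coprime_sym prime_coprime // ?odd' coprime_sym
      prime_coprime.
  by rewrite -(Gauss_dvdr _ cop).
have o3 : #|(H^`(1))%g| = 3%N.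
  have := primeP (isT : prime 3) => -[_ /(_ _ d3)/orP[/eqP D1|/eqP//]].
  case/negP: nabH; rewrite /abelian; apply/commG1P; rewrite -derg1.
  exact: card1_trivg.
have d3' : (3 %| #|(H^`(1))%g|)%N by rewrite o3.
have [y Dy oy] := Cauchy (isT : prime 3) d3'.
have DE : (H^`(1))%g = <[y]>%g.
  by apply/eqP; rewrite eq_sym eqEcard cycle_subG Dy o3 -orderE oy.
apply: dihedral8_sub (PSL27_normaliser3 (GD y Dy) oy) _ nabH.
by rewrite finset.subsetI sHG -DE; apply: der_norm.
Qed.

Theorem proposition1p2p7 (R : realType)
    (W : mx_representation R[i]%C (PSL 2 'F_7) 3) :
  mx_faithful W ->
  forall v : proj_quotient W, singular_point v -> abelian_singularity v.
Proof.
move=> Wf v _; rewrite -(orbit_reprK v); set L := orbit_repr v.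
have [M [MU [chi [D [LE blocks]]]]] := @line_stab_blocks _ _ _ 2 W L.
set H := line_stab (W : mx_representation _ _ (1 + 2)) L in blocks.
have sHG : H \subset PSL 2 'F_7 := line_stab_sub _ _.
pose rH := slice_repr sHG MU blocks.
(* Generalized over the line because H and the blocks depend on [L], which therefore cannot be
   replaced by [chart MU 0] in place. *)
have /(_ L LE) iso : forall L', chart MU 0 = L' -> completions_isomorphic
    (@max_ideal _ (proj_quotient W) (orbit_proj (proj_action W) L'))
    (@max_ideal _ (linear_quotient rH) (origin_image rH)).
  move=> _ <-; apply: (projective_slice sHG (slice_block sHG MU blocks)) => g Gg Lg.
  by apply/line_stabP; split=> //; rewrite -LE.
have [abH|nabH] := boolP (abelian H).
  by exists 2%N, _, H, rH.
have [c [s [[Hc Hs s2] cs c2 Hgen]]] : dihedral8 H.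
  apply: (PSL27_nonabelian_subgroup sHG nabH).
    exact: (derived_involution_central sHG MU Wf blocks).
  exact: (derived_conj_sqr sHG MU Wf blocks).
exists 2%N, (coset_of 'Z(SL 2 'F_7)), 1%G, (trivial_mx_repr _ _); split; first exact: abelian1.
apply: completions_isomorphic_trans iso _.
apply: (dihedral_slice Hc Hs s2 cs) => [h /Hgen[i [j ->]]|]; first by exists i, j.
apply: (slice_exp_neq1 sHG MU Wf blocks) => //.
(* [s c = c^-1 s] and the values of [chi] commute, so [chi c] equals its inverse and its square is
   1: this is what makes [c ^+ 2] act nontrivially on the slice. *)
have [e1 _] := blocksM sHG MU blocks Hs Hc.
have [e2 _] := blocksM sHG MU blocks (groupVr Hc) Hs.
have e : (s * c = c^-1 * s)%g.
  have cs' : (c * s = s * c^-1)%g by rewrite -cs conjgE mulKVg.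
  by apply: (mulgI c); rewrite mulKVg mulgA cs' mulgKV.
have [e3 _] := blocksM sHG MU blocks (groupVr Hc) Hc.
move: e3; rewrite mulVg (blocks1 MU blocks).1 => ->.
rewrite expr2; congr (_ * _); apply: (mulfI (chi_neq0 sHG MU blocks Hs)).
by rewrite -e1 e e2 mulrC.
Qed.
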